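(* Let $T>0$. The set of finite gap potentials is dense in $L^2([0,T],\mathbb{C})$.
   Context: For $q\in L^2([0,T],\mathbb{C})$ (thought of as extended $T$-periodically) let $F(t,\lambda)$, $\lambda\in\mathbb{C}$, solve $\frac{d}{dt}F=F\alpha$, $F(0,\lambda)=\mathbb{1}$, with $\alpha=\frac12\begin{pmatrix}\mathbf{i}\lambda&q\\-\bar q&-\mathbf{i}\lambda\end{pmatrix}$, and let $M(\lambda)=F(T,\lambda)=\begin{pmatrix}a&b\\c&d\end{pmatrix}(\lambda)$ be the monodromy, with entire entries and determinant $1$; put $\Delta=\mathrm{tr}\,M$. The spectral curve is $\Sigma=\{(\lambda,\mu)\in\mathbb{C}^2:\mu^2-\Delta(\lambda)\mu+1=0\}$. The eigenlines of $M$ form a holomorphic line bundle on a partial desingularisation $\widehat\Sigma$ of $\Sigma$ (the one whose structure sheaf is the endomorphism sheaf of the eigen-sheaf), explicitly $\widehat\Sigma=\{\nu^2=(\Delta(\lambda)^2-4)/(4p(\lambda)^2)\}$, where $p$ is an entire function which is a greatest common divisor of $a-d,b,c$. The potential $q$ is called finite gap if it is stationary under all but finitely many flows of the nonlinear Schrödinger hierarchy; equivalently (use this as definition) $\widehat\Sigma$ has finite arithmetic genus after compactification, i.e. the entire function $(\Delta^2-4)/p^2$ has only finitely many zeros counted with multiplicity. *)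

(* Defs.v *)
From HB Require Import structures.
From mathcomp Require Import all_boot all_order all_algebra.
From mathcomp Require Import complex.
From mathcomp Require Import all_classical all_reals all_analysis.

Set Implicit Arguments.
Unset Strict Implicit.
Unset Printing Implicit Defensive.

Import Order.TTheory GRing.Theory Num.Theory.
Import numFieldNormedType.Exports.

Local Open Scope classical_set_scope.
Local Open Scope ring_scope.

(* R[i] itself carries no topology in the library; its alias R[i]^o does, and
   this is where continuity and complex differentiability are taken. *)
Definition entire (R : realType) (f : R[i] -> R[i]) : Prop :=
  forall z : R[i], derivable (f : R[i]^o -> R[i]^o) z 1.

(* An element of L^2([0,T],C) is given by a representative defined on R, of
   which only the values on [0,T] matter. *)
Definition L2norm (R : realType) (T : R) (q : R -> R[i]) : \bar R :=
  'N[@lebesgue_measure R]_(2%:E)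
    [(fun t => (Normc.normc (q t))%:E) \_ (`[0%R, T])]%E.

Definition L2 (R : realType) (T : R) : set (R -> R[i]) :=
  [set q | [/\ measurable_fun `[0, T] (fun t => complex.Re (q t)),
               measurable_fun `[0, T] (fun t => complex.Im (q t))
             & (L2norm T q < +oo)%E]].

(* Complex-valued Lebesgue integral. *)
Definition Cintegral (R : realType) (D : set R) (f : R -> R[i]) : R[i] :=
  (Rintegral lebesgue_measure D (fun t => complex.Re (f t))
   +i* Rintegral lebesgue_measure D (fun t => complex.Im (f t)))%C.

Definition mx2 (K : Type) (a b c d : K) : 'M[K]_2 :=
  \matrix_(i, j) if i == 0 then (if j == 0 then a else b)
                 else (if j == 0 then c else d).

Definition alpha (R : realType) (q lambda : R[i]) : 'M[R[i]]_2 :=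
  2^-1 *: mx2 ('i%C * lambda) q (- q^*%C) (- ('i%C * lambda)).

(* Solutions of F' = F alpha, F(0) = 1 on [0,T]; as q is merely square
   integrable, the initial value problem is understood in the sense of
   Caratheodory, i.e. through the integral equation. *)
Definition fundamental_solution (R : realType) (T : R) (q : R -> R[i])
    (F : R -> R[i] -> 'M[R[i]]_2) : Prop :=
  forall lambda : R[i],
    (forall i j, {within `[0, T],
       continuous ((fun t => F t lambda i j) : R -> R[i]^o)}) /\
    (forall t, t \in `[0, T] -> forall i j,
       F t lambda i j = (1%:M : 'M[R[i]]_2) i j +
         Cintegral `[0, t] (fun s => (F s lambda *m alpha (q s) lambda) i j)).

Definition monodromy (R : realType) (T : R) (q : R -> R[i])
    (M : R[i] -> 'M[R[i]]_2) : Prop :=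
  exists2 F, fundamental_solution T q F & forall lambda, M lambda = F T lambda.

(* Divisibility in the ring of entire functions. *)
Definition entire_dvd (R : realType) (f g : R[i] -> R[i]) : Prop :=
  exists2 h, entire h & forall z, g z = f z * h z.

Definition entire_gcd3 (R : realType) (f1 f2 f3 p : R[i] -> R[i]) : Prop :=
  [/\ entire p,
      entire_dvd p f1, entire_dvd p f2, entire_dvd p f3
    & forall r, entire r ->
        entire_dvd r f1 -> entire_dvd r f2 -> entire_dvd r f3 ->
        entire_dvd r p].

(* g vanishes at z to order exactly m (m = 0 meaning that g z <> 0). *)
Definition zero_order (R : realType) (g : R[i] -> R[i]) (z : R[i]) (m : nat) :
    Prop :=
  exists h, [/\ entire h, h z != 0 & forall w, g w = (w - z) ^+ m * h w].

(* The zeros of g, repeated according to multiplicity, form a finite list. *)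
Definition finitely_many_zeros (R : realType) (g : R[i] -> R[i]) : Prop :=
  exists s : seq R[i], forall z, zero_order g z (count_mem z s).

(* g is the quotient (Delta^2 - 4) / p^2. *)
Definition finite_gap (R : realType) (T : R) (q : R -> R[i]) : Prop :=
  exists (M : R[i] -> 'M[R[i]]_2) (p g : R[i] -> R[i]),
    [/\ monodromy T q M,
        entire_gcd3 (fun z => M z 0 0 - M z 1 1)
                    (fun z => M z 0 1) (fun z => M z 1 0) p
        /\ (exists z, p z != 0),
        entire g,
        forall z, (\tr (M z)) ^+ 2 - 4 = g z * p z ^+ 2
      & finitely_many_zeros g].

(* Density of a set A of potentials in L^2([0,T],C) for the L^2 norm. *)
Definition dense_in_L2 (R : realType) (T : R) (A : set (R -> R[i])) : Prop :=
  forall q, L2 T q -> forall eps : R, 0 < eps ->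
    exists2 q', (L2 T `&` A) q'
              & (L2norm T (fun t => q t - q' t)%R < eps%:E)%E.

(* Main.v *)
Require Import Defs.
From mathcomp Require Import all_boot all_order all_algebra.
From mathcomp Require Import complex.
From mathcomp Require Import all_classical all_reals all_analysis.
From mathcomp Require Import measurable_realfun ring lra zify.
Set Implicit Arguments.
Unset Strict Implicit.
Unset Printing Implicit Defensive.
Import Order.TTheory GRing.Theory Num.Theory.
Import numFieldNormedType.Exports.
Local Open Scope classical_set_scope.
Local Open Scope ring_scope.

(* A Fourier series q is finite gap as soon as all spectral gaps beyond some index close.
   Near a trigonometric polynomial p such a q is found by a contraction: for each large |k|
   one asks for an (almost constant) periodic Floquet solution near the resonance lambda = om k,
   and the solvability condition at the resonant Fourier mode determines the k-th coefficient
   of q; this changes p by arbitrarily little.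

   If all gaps with |k| > N are closed, pairing the periodic Killing fields
   B' = [B, alpha] with the squares of these Floquet solutions gives, for non-real lambda, almost
   orthogonality of the off-diagonal part of the canonical field F^-1 M F to all high modes.
   By Parseval, a linear combination of the off-diagonal parts at 4N + 3 values of lambda
   vanishes once its low modes do, and the corresponding Lagrange-type combination is a Killing
   field polynomial in lambda. It commutes with M(lambda), so (a - d, b, c) is an entire
   multiple p of a triple of coprime polynomials, p is the greatest common divisor, and
   (Delta^2 - 4) / p^2 is a nonzero polynomial. *)

(** * Complex-valued functions of a real variable *)

Section ComplexNorm.
Variable R : realType.
Local Notation C := R[i].
Implicit Types (z w : C) (x : R).

(** Closing one gap meets two resonances: mode 0 of the first component and mode [- k] of the
    second. The shift [e] of the spectral parameter absorbs the former and one Fourier coefficient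
    of [q] the latter, so unknowns and conditions match and all large [k] can be solved for
    simultaneously. Off resonance, division by [k + m] gains [1 / (1 + |k + m|)], and a convolution
    turns this into decay in [k]; this is the source of all smallness. The spectral problem is not
    self-adjoint, so its eigenvalues may be complex. Two energy identities compensate for this: a
    Floquet solution whose second component is the smaller one has a real spectral parameter, and
    high on the imaginary axis the trace is never 2 or -2. Sampling lambda there keeps the samples
    away from the resonances and makes the discriminant of the final Killing field nonzero. The
    number of samples is a dimension count: [2 N + 1] low modes of two off-diagonal entries are
    [4 N + 2] linear conditions, one less than [4 N + 3]. Entire functions enter only through
    holomorphy of the monodromy and a Bezout identity for polynomials. *)

Definition nm z : R := Normc.normc z.

Lemma nm_ge0 z : 0 <= nm z.
Proof. by case: z => a b /=; exact: sqrtr_ge0. Qed.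

Lemma nm0 : nm 0 = 0. Proof. exact: Normc.normc0. Qed.

Lemma nm_eq0 z : nm z = 0 -> z = 0. Proof. exact: Normc.eq0_normc. Qed.

Lemma nmM z w : nm (z * w) = nm z * nm w. Proof. exact: Normc.normcM. Qed.

Lemma nmD z w : nm (z + w) <= nm z + nm w. Proof. exact: le_normcD. Qed.

Lemma nmN z : nm (- z) = nm z. Proof. exact: normcN. Qed.

Lemma nm1 : nm 1 = 1. Proof. exact: Normc.normc1. Qed.

Lemma nmV z : nm z^-1 = (nm z)^-1. Proof. exact: Normc.normcV. Qed.

Lemma nmB z w : nm (z - w) = nm (w - z). Proof. by rewrite -nmN opprB. Qed.

Lemma nm_gt0 z : z != 0 -> 0 < nm z.
Proof.
move=> z0; rewrite lt_neqAle nm_ge0 andbT eq_sym.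
by apply: contra z0 => /eqP /nm_eq0 ->.
Qed.

Lemma nm_sqr z : nm z ^+ 2 = complex.Re z ^+ 2 + complex.Im z ^+ 2.
Proof. by case: z => a b; rewrite /nm /= sqr_sqrtr // addr_ge0 ?sqr_ge0. Qed.

Lemma nmJ z : nm (z^*%C) = nm z.
Proof. by case: z => a b; rewrite /nm /= sqrrN. Qed.

Lemma nm_real x : nm x%:C%C = `|x|.
Proof. by rewrite /nm /= expr0n addr0 sqrtr_sqr. Qed.

Lemma nm_i : nm 'i%C = 1.
Proof. by rewrite /nm /= expr0n add0r expr1n sqrtr1. Qed.

Lemma Re_le_nm z : `|complex.Re z| <= nm z.
Proof.
rewrite -[nm z]ger0_norm ?nm_ge0 // -ler_sqr ?nnegrE ?normr_ge0 //.
by rewrite !real_normK ?num_real // nm_sqr lerDl sqr_ge0.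
Qed.

Lemma Im_le_nm z : `|complex.Im z| <= nm z.
Proof.
rewrite -[nm z]ger0_norm ?nm_ge0 // -ler_sqr ?nnegrE ?normr_ge0 //.
by rewrite !real_normK ?num_real // nm_sqr lerDr sqr_ge0.
Qed.

Lemma nm_le z : nm z <= `|complex.Re z| + `|complex.Im z|.
Proof.
rewrite -[nm z]ger0_norm ?nm_ge0 // -[X in _ <= X]ger0_norm ?addr_ge0 //.
rewrite -ler_sqr ?nnegrE ?normr_ge0 //.
rewrite !real_normK ?num_real // nm_sqr sqrrD !real_normK ?num_real //.
by rewrite addrAC lerDl mulrn_wge0 // mulr_ge0.
Qed.

Lemma nm_sub_le z w : nm z - nm w <= nm (z - w).
Proof. by rewrite lerBlDr; have := nmD (z - w) w; rewrite subrK. Qed.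

Lemma mul_conj z : z * z^*%C = (nm z ^+ 2)%:C%C.
Proof.
by rewrite nm_sqr; case: z => a b; apply/eqP; rewrite eq_complex /=;
  apply/andP; split; apply/eqP; ring.
Qed.

Lemma ii2 : 'i%C * 'i%C = -1 :> C.
Proof. by rewrite -expr2 sqr_i. Qed.

Lemma conj_i : 'i^*%C = - 'i%C :> C.
Proof. by apply/eqP; rewrite eq_complex /= oppr0 !eqxx. Qed.

(** A unimodular factor that turns a complex number into its modulus lets real monotonicity
    arguments bound complex increments, as in [Df_bound]. *)
Lemma unit_rotation z : exists c : C, nm c = 1 /\ c * z = (nm z)%:C%C.
Proof.
have [->|z0] := eqVneq z 0; first by exists 1; rewrite nm1 mulr0 nm0.
have nz := nm_gt0 z0.
exists (z^*%C * ((nm z)^-1)%:C%C); split.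
  by rewrite nmM nmJ nm_real ger0_norm ?invr_ge0 ?nm_ge0 // divff // gt_eqF.
by rewrite mulrAC mulrC [z^*%C * z]mulrC mul_conj -rmorphM /= expr2 mulKf // gt_eqF.
Qed.

End ComplexNorm.

(** * Derivatives, monotonicity and primitives of real functions *)

Section RealCalculus.
Variable R : realType.
Implicit Types (f g : R -> R) (t : R).

Lemma isdD f g t a b : is_derive t 1 f a -> is_derive t 1 g b ->
  is_derive t 1 (fun s => f s + g s) (a + b).
Proof. by move=> ? ?; exact: is_deriveD. Qed.

Lemma isdB f g t a b : is_derive t 1 f a -> is_derive t 1 g b ->
  is_derive t 1 (fun s => f s - g s) (a - b).
Proof. by move=> ? ?; exact: is_deriveB. Qed.

Lemma isdM f g t a b : is_derive t 1 f a -> is_derive t 1 g b ->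
  is_derive t 1 (fun s => f s * g s) (a * g t + f t * b).
Proof.
move=> ? ?; apply: (@is_derive_eq _ _ _ (f * g) t 1 _ _ (is_deriveM _ _)).
by rewrite /GRing.scale /= addrC mulrC.
Qed.

Lemma isd_cont f f' : (forall t, is_derive t 1 f (f' t)) -> continuous f.
Proof. by move=> h t; apply/differentiable_continuous/derivable1_diffP; case: (h t). Qed.

Lemma isd_le f f' a b : (forall t, is_derive t 1 f (f' t)) ->
  (forall t, a <= t <= b -> 0 <= f' t) -> a <= b -> f a <= f b.
Proof.
move=> h p ab.
have [|c cab E] := @MVT_segment R f f' a b ab (fun x _ => h x).
  exact/continuous_subspaceT/isd_cont.
by rewrite -subr_ge0 E mulr_ge0 ?subr_ge0 // p // -[_ && _]/(c \in `[a, b]).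
Qed.

Lemma isd_lt f f' a b : (forall t, is_derive t 1 f (f' t)) ->
  (forall t, a <= t <= b -> 0 < f' t) -> a < b -> f a < f b.
Proof.
move=> h p ab.
have [|c cab E] := @MVT_segment R f f' a b (ltW ab) (fun x _ => h x).
  exact/continuous_subspaceT/isd_cont.
by rewrite -subr_gt0 E mulr_gt0 ?subr_gt0 // p // -[_ && _]/(c \in `[a, b]).
Qed.

Lemma continuous_integrable f a b : continuous f ->
  (@lebesgue_measure R).-integrable `[a, b] (EFin \o f).
Proof.
move=> cf; apply: continuous_compact_integrable; first exact: segment_compact.
exact: continuous_subspaceT.
Qed.

Lemma FTC2_cont f F a b : (forall t, is_derive t 1 F (f t)) -> continuous f ->
  a <= b -> Rintegral lebesgue_measure `[a, b] f = F b - F a.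
Proof.
move=> dF cf; rewrite le_eqVlt => /predU1P[->|ab].
  by rewrite set_itv1 Rintegral_set1 subrr.
have cF := isd_cont dF.
rewrite /Rintegral (@continuous_FTC2 R f F a b ab) //.
- exact: continuous_subspaceT.
- split; first by move=> x _; case: (dF x).
  + by apply: cvg_at_right_filter; exact: cF.
  + by apply: cvg_at_left_filter; exact: cF.
- by move=> x _; rewrite derive1E; case: (dF x).
Qed.

Lemma isd_near f g t a : (\forall s \near t, f s = g s) ->
  is_derive t 1 f a -> is_derive t 1 g a.
Proof. exact: near_eq_is_derive. Qed.

Lemma real_primitive f : continuous f ->
  exists P, (forall t, is_derive t 1 P (f t)) /\ P 0 = 0.
Proof.
move=> cf; pose I a b := Rintegral (@lebesgue_measure R) `[a, b] f.
have IB a b x : a <= x -> x <= b -> I a b - I a x = I x b.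
  move=> ax xb; rewrite /I Rintegral_itvB ?bnd_simp //; last exact: continuous_integrable.
  rewrite Rintegral_itv_obnd_cbnd //.
  apply: integrableS (continuous_integrable x b cf) => //.
  exact: subset_itv_oc_cc.
(* Integrals over segments carry no orientation, hence the two cases. Differentiability at [t] is
   read off from the integral with base point [- |t| - 1], which lies to the left of both [0] and
   [t]. *)
pose P x := if 0 <= x then I 0 x else - I x 0.
have PE a x : a < 0 -> a < x -> P x = I a x - I a 0.
  move=> a0 ax; rewrite /P; case: ifPn => [x0|]; last rewrite -ltNge => x0.
    by rewrite IB // ltW.
  by rewrite -(@IB a 0 x) ?ltW // opprB.
exists P; split; last by rewrite /P lexx /I set_itv1 Rintegral_set1.
move=> t; pose a := - `|t| - 1.
have a0 : a < 0 by rewrite /a; have := normr_ge0 t; lra.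
have at_ : a < t by rewrite /a; have := ler_norm (- t); rewrite normrN; lra.
apply: (@isd_near (fun x => I a x - I a 0)).
  near=> x; rewrite (@PE a) //; near: x; exact: lt_nbhsr.
have [dI I'] := @continuous_FTC1_closed R f a t (t + 1) ltac:(lra)
  (continuous_integrable _ _ cf) at_ (cf t).
rewrite -[f t]subr0; apply: isdB.
by apply: DeriveDef => //; rewrite -derive1E.
Unshelve. all: by end_near. Qed.

End RealCalculus.

(** * Componentwise calculus of complex-valued functions *)

Section ComplexCalculus.
Variable R : realType.
Local Notation C := R[i].
Local Notation Re := complex.Re.
Local Notation Im := complex.Im.
Implicit Types (f g r : R -> C) (t : R) (c : C).

(** This notion and [Df] are componentwise and global on the line, so that each fact about them is a
    pair of real ones; [contC_continuous] makes the link with the topology of [R[i]^o]. *)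
Definition contC f := continuous (fun t => Re (f t)) /\ continuous (fun t => Im (f t)).

Definition Df f f' := forall t,
  is_derive t 1 (fun s => Re (f s)) (Re (f' t)) /\
  is_derive t 1 (fun s => Im (f s)) (Im (f' t)).

Lemma cReD c d : Re (c + d) = Re c + Re d. Proof. by case: c; case: d. Qed.
Lemma cImD c d : Im (c + d) = Im c + Im d. Proof. by case: c; case: d. Qed.
Lemma cReB c d : Re (c - d) = Re c - Re d. Proof. by case: c; case: d. Qed.
Lemma cImB c d : Im (c - d) = Im c - Im d. Proof. by case: c; case: d. Qed.

Lemma cReM c d : Re (c * d) = Re c * Re d - Im c * Im d.
Proof. by case: c; case: d. Qed.

Lemma cImM c d : Im (c * d) = Re c * Im d + Im c * Re d.
Proof. by case: c => a b; case: d => u v /=; rewrite [b * u]mulrC. Qed.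

Lemma cReJ c : Re (c^*%C) = Re c. Proof. by case: c. Qed.
Lemma cImJ c : Im (c^*%C) = - Im c. Proof. by case: c. Qed.

Lemma complex_eq c d : Re c = Re d -> Im c = Im d -> c = d.
Proof. by case: c => a b; case: d => ? ? /= -> ->. Qed.

Lemma isd_eq (f g : R -> R) t a b : is_derive t 1 f a ->
  (forall s, f s = g s) -> a = b -> is_derive t 1 g b.
Proof. by move=> h /funext <- <-. Qed.

Lemma cont_ext (f g : R -> R) : continuous f -> (forall s, f s = g s) -> continuous g.
Proof. by move=> h /funext <-. Qed.

Lemma Df_eq f f' g' : Df f f' -> (forall t, f' t = g' t) -> Df f g'.
Proof. by move=> h e t; rewrite -e. Qed.

Lemma Df_ext f g f' : Df f f' -> (forall t, f t = g t) -> Df g f'.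
Proof. by move=> h /funext <-. Qed.

Lemma Df_cst c : Df (fun=> c) (fun=> 0).
Proof. by move=> t; split; exact: is_derive_cst. Qed.

Lemma DfD f g f' g' : Df f f' -> Df g g' ->
  Df (fun t => f t + g t) (fun t => f' t + g' t).
Proof.
move=> hf hg t; have [a b] := hf t; have [u v] := hg t.
by split; [apply: isd_eq (isdD a u) _ _|apply: isd_eq (isdD b v) _ _] => *;
  rewrite ?cReD ?cImD.
Qed.

Lemma DfM f g f' g' : Df f f' -> Df g g' ->
  Df (fun t => f t * g t) (fun t => f' t * g t + f t * g' t).
Proof.
move=> hf hg t; have [a b] := hf t; have [u v] := hg t; split.
- apply: isd_eq (isdB (isdM a u) (isdM b v)) _ _ => [s|]; first by rewrite cReM.
  by rewrite cReD !cReM; ring.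
- apply: isd_eq (isdD (isdM a v) (isdM b u)) _ _ => [s|]; first by rewrite cImM.
  by rewrite cImD !cImM; ring.
Qed.

Lemma DfZ c f f' : Df f f' -> Df (fun t => c * f t) (fun t => c * f' t).
Proof. by move=> h; apply: (Df_eq (DfM (Df_cst c) h)) => t; rewrite mul0r add0r. Qed.

Lemma DfN f f' : Df f f' -> Df (fun t => - f t) (fun t => - f' t).
Proof.
move=> /(DfZ (-1)) h; apply: Df_eq (Df_ext h _) _ => t; exact: mulN1r.
Qed.

Lemma DfB f g f' g' : Df f f' -> Df g g' ->
  Df (fun t => f t - g t) (fun t => f' t - g' t).
Proof. by move=> hf /DfN; exact: DfD. Qed.

Lemma DfJ f f' : Df f f' -> Df (fun t => (f t)^*%C) (fun t => (f' t)^*%C).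
Proof.
move=> h t; have [a b] := h t; split.
  by apply: isd_eq a _ _ => [s|]; rewrite cReJ.
by apply: isd_eq (isdB (is_derive_cst 0 _ _) b) _ _ => [s|]; rewrite cImJ ?sub0r.
Qed.

Lemma Df_sum (I : Type) (s : seq I) (P : pred I) (f f' : I -> R -> C) :
  (forall i, Df (f i) (f' i)) ->
  Df (fun t => \sum_(i <- s | P i) f i t) (fun t => \sum_(i <- s | P i) f' i t).
Proof.
move=> h; elim: s => [|i s IH].
  by apply: (Df_ext (Df_eq (Df_cst 0) _)) => t; rewrite big_nil.
case Pi : (P i); [apply: Df_ext (Df_eq (DfD (h i) IH) _) _|
  apply: Df_ext (Df_eq IH _) _] => t; by rewrite big_cons Pi.
Qed.

Lemma Df_contC f f' : Df f f' -> contC f.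
Proof. by move=> h; split; apply: isd_cont => t; case: (h t); eauto. Qed.

Lemma contC_ext f g : contC f -> (forall t, f t = g t) -> contC g.
Proof. by move=> h /funext <-. Qed.

Lemma contC_cst c : contC (fun=> c). Proof. exact: Df_contC (Df_cst c). Qed.

Lemma contCD f g : contC f -> contC g -> contC (fun t => f t + g t).
Proof.
move=> [a b] [u v]; split.
  apply: cont_ext (fun t => cvgD (a t) (u t)) _ => s; by rewrite cReD.
apply: cont_ext (fun t => cvgD (b t) (v t)) _ => s; by rewrite cImD.
Qed.

Lemma contCM f g : contC f -> contC g -> contC (fun t => f t * g t).
Proof.
move=> [a b] [u v]; split.
  apply: cont_ext (fun t => cvgB (cvgM (a t) (u t)) (cvgM (b t) (v t))) _ => s.
  by rewrite cReM.
apply: cont_ext (fun t => cvgD (cvgM (a t) (v t)) (cvgM (b t) (u t))) _ => s.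
by rewrite cImM.
Qed.

Lemma contCZ c f : contC f -> contC (fun t => c * f t).
Proof. exact/contCM/contC_cst. Qed.

Lemma contCN f : contC f -> contC (fun t => - f t).
Proof. by move=> /(contCZ (-1)) h; apply: contC_ext h _ => t; exact: mulN1r. Qed.

Lemma contCB f g : contC f -> contC g -> contC (fun t => f t - g t).
Proof. by move=> hf /contCN; exact: contCD. Qed.

Lemma contCJ f : contC f -> contC (fun t => (f t)^*%C).
Proof.
move=> [a b]; split; first by apply: cont_ext a _ => s; rewrite cReJ.
by apply: cont_ext (fun t => cvgN (b t)) _ => s; rewrite cImJ.
Qed.

Lemma contC_sum (I : Type) (s : seq I) (P : pred I) (f : I -> R -> C) :
  (forall i, contC (f i)) -> contC (fun t => \sum_(i <- s | P i) f i t).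
Proof.
move=> h; elim: s => [|i s IH].
  by apply: (contC_ext (contC_cst 0)) => t; rewrite big_nil.
case Pi : (P i); [apply: contC_ext (contCD (h i) IH) _|
  apply: contC_ext IH _] => t; by rewrite big_cons Pi.
Qed.

Lemma contC_comp f (h : R -> R) : contC f -> continuous h -> contC (fun t => f (h t)).
Proof.
move=> [a b] ch; split => t.
  exact: (@continuous_comp _ _ _ h (fun s => Re (f s)) t (ch t) (a (h t))).
exact: (@continuous_comp _ _ _ h (fun s => Im (f s)) t (ch t) (b (h t))).
Qed.

Lemma contC_nm f : contC f -> continuous (fun t => nm (f t)).
Proof.
move=> [a b]; apply: (@cont_ext (fun s => Num.sqrt (Re (f s) * Re (f s) + Im (f s) * Im (f s)))) => t.
  apply: (@continuous_comp _ _ _ (fun s => Re (f s) * Re (f s) + Im (f s) * Im (f s)) Num.sqrt).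
    exact: (cvgD (cvgM (a t) (a t)) (cvgM (b t) (b t))).
  exact: sqrt_continuous.
by case: (f t).
Qed.

Lemma contC_epsP f : contC f <-> forall t e, 0 < e ->
  exists2 d, 0 < d & forall s, `|s - t| < d -> nm (f s - f t) < e.
Proof.
split=> [[a b] t e e0|h].
  have /cvgrPdist_lt/(_ (e / 2)) := a t; have /cvgrPdist_lt/(_ (e / 2)) := b t.
  have e2 : 0 < e / 2 by lra.
  move=> /(_ e2) /nbhs_ballP [d1 /= d10 h1] /(_ e2) /nbhs_ballP [d2 /= d20 h2].
  exists (Num.min d1 d2); first by rewrite lt_min d10 d20.
  move=> s; rewrite lt_min => /andP[s1 s2].
  apply: (le_lt_trans (nm_le _)); rewrite cReB cImB.
  have := h1 s; rewrite /ball /= (distrC t) (distrC (Im _)) => /(_ s1).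
  by have := h2 s; rewrite /ball /= (distrC t) (distrC (Re _)) => /(_ s2); lra.
by split=> t; apply/cvgrPdist_lt => e e0; have [d d0 hd] := h t e e0;
  apply/nbhs_ballP; exists d => // s; rewrite /ball /= (distrC t) => /hd;
  apply: le_lt_trans; rewrite distrC -?cReB -?cImB ?Re_le_nm ?Im_le_nm.
Qed.

Lemma Df0_cst f s t : Df f (fun=> 0) -> f s = f t.
Proof.
by move=> h; apply: complex_eq;
  [apply: (is_derive_0_is_cst (f := fun s => Re (f s)))|
   apply: (is_derive_0_is_cst (f := fun s => Im (f s)))] => x; case: (h x).
Qed.

Lemma Df_inj f g r s t : Df f r -> Df g r -> f t - f s = g t - g s.
Proof.
move=> hf hg; have /(Df0_cst s t) E : Df (fun t => f t - g t) (fun=> 0).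
  by apply: (Df_eq (DfB hf hg)) => x; rewrite subrr.
by move: E => /eqP; rewrite subr_eq => /eqP ->; ring.
Qed.

(** With [c] rotating [f b - f a] onto the positive axis, [w - Re (c f)] is nondecreasing. This mean
    value inequality takes the place of bounding an integral by the integral of the modulus. *)
Lemma Df_bound f f' (w w' : R -> R) a b : Df f f' ->
  (forall t, is_derive t 1 w (w' t)) -> a <= b ->
  (forall t, a <= t <= b -> nm (f' t) <= w' t) -> nm (f b - f a) <= w b - w a.
Proof.
move=> hf hw ab h; have [c [c1 cE]] := unit_rotation (f b - f a).
have : w a - Re (c * f a) <= w b - Re (c * f b).
  apply: (@isd_le R (fun t => w t - Re (c * f t)) (fun t => w' t - Re (c * f' t))) => // t.
    by apply: isdB => //; case: (DfZ c hf t).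
  move=> /h ht; rewrite subr_ge0; apply: le_trans ht.
  by apply: le_trans (ler_norm _) _; apply: le_trans (Re_le_nm _) _; rewrite nmM c1 mul1r.
rewrite -[nm _]/(Re (nm (f b - f a))%:C%C) -cE mulrBr cReB; lra.
Qed.

Lemma Df_bound_cst f f' (M : R) a b : Df f f' -> a <= b ->
  (forall t, a <= t <= b -> nm (f' t) <= M) -> nm (f b - f a) <= M * (b - a).
Proof.
move=> hf ab h; have := @Df_bound f f' (fun t => t * M) (fun=> M) a b hf _ ab h.
rewrite mulrBr ![M * _]mulrC; apply => t.
by apply: isd_eq (isdM (is_derive_id _ _) (is_derive_cst M _ _)) _ _ => //;
  rewrite mul1r mulr0 addr0.
Qed.

Lemma primitive f : contC f -> exists P, Df P f /\ P 0 = 0.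
Proof.
move=> [/real_primitive[P [hP P0]] /real_primitive[Q [hQ Q0]]].
exists (fun t => (P t +i* Q t)%C); split=> [t|]; first by split; [exact: (hP t)|exact: (hQ t)].
by rewrite P0 Q0.
Qed.

(** Integrals of continuous complex functions are treated as primitives normalised at [0], so that
    linearity follows from uniqueness. The default, the zero function, is taken only when no
    primitive exists. *)
Definition prim f : R -> C := xget (fun=> 0) [set P | Df P f /\ P 0 = 0].

Lemma Df_prim f : contC f -> Df (prim f) f.
Proof. by move=> /primitive[P hP]; rewrite /prim; case: xgetP => [Q _ []|/(_ P)]. Qed.

Lemma prim0 f : contC f -> prim f 0 = 0.
Proof. by move=> /primitive[P hP]; rewrite /prim; case: xgetP => [Q _ []|/(_ P)]. Qed.

Lemma prim_unique P f t : Df P f -> prim f t = P t - P 0.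
Proof.
move=> h; rewrite /prim; case: xgetP => [Q _ [hQ Q0]|/(_ (fun t => P t - P 0))/= []].
  by rewrite -[Q t]subr0 -Q0; exact: Df_inj hQ h.
split; last by rewrite subrr.
by apply: (Df_eq (DfB h (Df_cst _))) => x; rewrite subr0.
Qed.

Lemma primD f g t : contC f -> contC g ->
  prim (fun t => f t + g t) t = prim f t + prim g t.
Proof.
move=> hf hg; rewrite (prim_unique t (DfD (Df_prim hf) (Df_prim hg))).
by rewrite !prim0 // addr0 subr0.
Qed.

Lemma primZ c f t : contC f -> prim (fun t => c * f t) t = c * prim f t.
Proof.
by move=> hf; rewrite (prim_unique t (DfZ c (Df_prim hf))) prim0 // mulr0 subr0.
Qed.

Lemma primJ f t : contC f -> prim (fun t => (f t)^*%C) t = (prim f t)^*%C.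
Proof.
by move=> hf; rewrite (prim_unique t (DfJ (Df_prim hf))) prim0 // conjc0 subr0.
Qed.

Lemma prim_sum (I : Type) (s : seq I) (P : pred I) (f : I -> R -> C) t :
  (forall i, contC (f i)) ->
  prim (fun t => \sum_(i <- s | P i) f i t) t = \sum_(i <- s | P i) prim (f i) t.
Proof.
move=> h; rewrite (prim_unique t (Df_sum s P (fun i => Df_prim (h i)))).
by rewrite [X in _ - X]big1 ?subr0 // => i _; rewrite prim0.
Qed.

Lemma prim_bound f (M t : R) : contC f -> 0 <= t ->
  (forall s, 0 <= s <= t -> nm (f s) <= M) -> nm (prim f t) <= M * t.
Proof.
move=> hf t0 h; have := Df_bound_cst (Df_prim hf) t0 h.
by rewrite prim0 // !subr0.
Qed.

Definition cis (x : R) : C := (cos x +i* sin x)%C.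

Lemma cisD x y : cis (x + y) = cis x * cis y.
Proof. by apply: complex_eq; rewrite ?cReM ?cImM /= ?cosD ?sinD //; ring. Qed.

Lemma cis0 : cis 0 = 1.
Proof. by rewrite /cis cos0 sin0. Qed.

Lemma cisN x : cis (- x) = (cis x)^*%C.
Proof. by rewrite /cis cosN sinN. Qed.

Lemma nm_cis x : nm (cis x) = 1.
Proof. by rewrite /nm /= cos2Dsin2 sqrtr1. Qed.

Lemma Df_cis (a : R) : Df (fun t => cis (a * t)) (fun t => 'i%C * a%:C%C * cis (a * t)).
Proof.
have lin t : is_derive t 1 (fun t => a * t) a.
  apply: isd_eq (isdM (is_derive_cst a _ _) (is_derive_id _ _)) _ _ => //.
  by rewrite mul0r add0r mulr1.
move=> t; split.
  apply: isd_eq (@is_derive1_comp _ cos (fun t => a * t) t _ _ (is_derive_cos _) (lin t)) _ _ => //.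
  by rewrite !(cReM, cImM) /=; ring.
apply: isd_eq (@is_derive1_comp _ sin (fun t => a * t) t _ _ (is_derive_sin _) (lin t)) _ _ => //.
by rewrite !(cReM, cImM) /=; ring.
Qed.

End ComplexCalculus.

(** * Fixed points and bilateral sums *)

Section Convergence.
Variable R : realType.
Local Notation C := R[i].

(** [u n - t n] is nondecreasing and [u n + t n] is nonincreasing, so the supremum of the former
    lies between them; [t n] is thus an explicit rate of convergence. *)
Lemma telescoping_limit_real (u t : nat -> R) : (forall n, 0 <= t n) ->
  (forall n, `|u n - u n.+1| <= t n - t n.+1) ->
  exists l, forall n, `|u n - l| <= t n.
Proof.
move=> t0 h.
have up n k : u n - t n <= u (n + k)%N - t (n + k)%N.
  elim: k => [|k IH]; first by rewrite addn0.
  rewrite addnS; have := h (n + k)%N; rewrite ler_norml => /andP[_ ?]; lra.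
have dn n k : u (n + k)%N + t (n + k)%N <= u n + t n.
  elim: k => [|k IH]; first by rewrite addn0.
  rewrite addnS; have := h (n + k)%N; rewrite ler_norml => /andP[? _]; lra.
have ub m n : u n - t n <= u m + t m.
  have [nm|/ltnW nm] := leqP n m.
    by have := up n (m - n)%N; rewrite subnKC // => H; have := t0 m; lra.
  by have := dn m (n - m)%N; rewrite subnKC // => H; have := t0 n; lra.
pose E := range (fun n => u n - t n).
have E0 : has_sup E.
  by split; [exists (u 0%N - t 0%N), 0%N|exists (u 0%N + t 0%N) => _ [n _ <-]].
exists (sup E) => n; rewrite ler_norml; apply/andP; split.
  have := @ge_sup R E (u n + t n) E0.1 _; rewrite lerBrDl => H.
  have : sup E <= u n + t n by apply: H => _ [m _ <-].
  lra.
have : u n - t n <= sup E by apply: sup_ubound; [case: E0|exists n].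
lra.
Qed.

Lemma telescoping_limit (u : nat -> C) (t : nat -> R) : (forall n, 0 <= t n) ->
  (forall n, nm (u n - u n.+1) <= t n - t n.+1) ->
  exists l : C, forall n, nm (u n - l) <= 2 * t n.
Proof.
move=> t0 h.
have [|x hx] := @telescoping_limit_real (fun n => complex.Re (u n)) t t0.
  by move=> n; apply: le_trans (h n); rewrite -cReB Re_le_nm.
have [|y hy] := @telescoping_limit_real (fun n => complex.Im (u n)) t t0.
  by move=> n; apply: le_trans (h n); rewrite -cImB Im_le_nm.
exists (x +i* y)%C => n; apply: le_trans (nm_le _) _.
by rewrite cReB cImB /=; have := hx n; have := hy n; lra.
Qed.

Lemma half_powS n : ((2 : R) ^+ n.+1)^-1 = (2 ^+ n)^-1 / 2.
Proof. by rewrite exprSr invfM mulrC. Qed.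

Lemma half_pow_gt0 n : 0 < ((2 : R) ^+ n)^-1.
Proof. by rewrite invr_gt0 exprn_gt0. Qed.

Lemma archi_gt (x : R) : exists n : nat, x < n%:R.
Proof. by exists (Num.bound `|x|); exact: le_lt_trans (ler_norm x) (archi_boundP (normr_ge0 x)). Qed.

Lemma half_pow_small (K e : R) : 0 < e -> exists n, K * (2 ^+ n)^-1 <= e.
Proof.
move=> e0; have [n hn] := archi_gt (K / e); exists n.
rewrite ler_pdivrMr ?exprn_gt0 // mulrC -ler_pdivrMr //.
apply: le_trans (ltW hn) _; rewrite -natrX ler_nat.
by rewrite ltnW // ltn_expl.
Qed.

(** Banach's theorem with contraction factor 1/2 in the supremum norm weighted by [w], phrased
    through bounds because this norm need not be finite on all of [S]. In the rate [4 * d0 / 2 ^+ n]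
    one factor 2 sums the geometric series and another treats real and imaginary parts separately;
    [S] has to be closed only along sequences converging at this rate. *)
Lemma fixed_point (I : Type) (w : I -> R) (S : set (I -> C))
    (Phi : (I -> C) -> I -> C) (x0 : I -> C) (d0 : R) :
  (forall i, 0 <= w i) -> 0 <= d0 -> S x0 -> (forall x, S x -> S (Phi x)) ->
  (forall x y (d : R), 0 <= d -> S x -> S y -> (forall i, nm (x i - y i) <= d * w i) ->
     forall i, nm (Phi x i - Phi y i) <= d / 2 * w i) ->
  (forall i, nm (x0 i - Phi x0 i) <= d0 * w i) ->
  (forall (s : nat -> I -> C) (z : I -> C), (forall n, S (s n)) ->
     (forall n i, nm (s n i - z i) <= 4 * d0 / 2 ^+ n * w i) -> S z) ->
  exists z, S z /\ forall i, Phi z i = z i.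
Proof.
move=> w0 d00 S0 SP lip h0 cl; pose s n := iter n Phi x0.
have Ss n : S (s n) by elim: n => //= n; exact: SP.
pose p n : R := (2 ^+ n)^-1.
have p0 n : 0 <= p n by exact/ltW/half_pow_gt0.
have step n i : nm (s n i - s n.+1 i) <= d0 * p n * w i.
  elim: n i => [|n IH] i; first by rewrite /p expr0 invr1 mulr1; exact: h0.
  rewrite /p half_powS mulrA.
  exact: (lip (s n) (s n.+1) (d0 * p n) (mulr_ge0 d00 (p0 n)) (Ss n) (Ss n.+1) IH).
have /choice [z hz] i : exists l : C, forall n, nm (s n i - l) <= 4 * d0 * p n * w i.
  have [n|n|l hl] := @telescoping_limit (fun n => s n i) (fun n => 2 * d0 * p n * w i).
  - by rewrite !mulr_ge0.
  - apply: le_trans (step n i) _; rewrite /p half_powS -/(p n); lra.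
  - by exists l => n; apply: le_trans (hl n) _; lra.
have Sz : S z := cl s z Ss (fun n i => hz i n).
exists z; split=> // i; apply/eqP; rewrite -subr_eq0; apply/eqP/nm_eq0/eqP.
rewrite eq_le nm_ge0 andbT; apply/ler_addgt0Pl => e e0; rewrite addr0.
have bnd n : nm (Phi z i - z i) <= 4 * d0 * w i * p n.
  have := lip (s n) z (4 * d0 * p n) _ (Ss n) Sz (hz^~ n) i.
  rewrite !mulr_ge0 // => /(_ isT) h1.
  have h2 := hz i n.+1; rewrite /p half_powS -/(p n) in h2.
  have -> : Phi z i - z i = (Phi z i - s n.+1 i) + (s n.+1 i - z i) by ring.
  apply: le_trans (nmD _ _) _; rewrite nmB in h1.
  apply: le_trans (lerD h1 h2) _; lra.
have [n hn] := half_pow_small (4 * d0 * w i) e0.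
exact: le_trans (bnd n) hn.
Qed.

End Convergence.

Section IntegerSums.
Variable R : realType.
Local Notation C := R[i].

Definition psum (V : zmodType) (a : int -> V) (n : nat) : V :=
  a 0 + \sum_(i < n) (a i.+1%:Z + a (- i.+1%:Z)).

Lemma psumS (V : zmodType) (a : int -> V) n :
  psum a n.+1 = psum a n + (a n.+1%:Z + a (- n.+1%:Z)).
Proof. by rewrite /psum big_ord_recr /= addrA. Qed.

Lemma psum0 (V : zmodType) (a : int -> V) : psum a 0 = a 0.
Proof. by rewrite /psum big_ord0 addr0. Qed.

Lemma eq_psum (V : zmodType) (a b : int -> V) n :
  (forall j, a j = b j) -> psum a n = psum b n.
Proof. by move=> /funext ->. Qed.

Lemma psumD (V : zmodType) (a b : int -> V) n :
  psum (fun j => a j + b j) n = psum a n + psum b n.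
Proof.
elim: n => [|n IH]; first by rewrite !psum0.
by rewrite !psumS IH [RHS]addrACA; congr (_ + _); rewrite addrACA.
Qed.

Lemma psumZ (V : nzRingType) (c : V) (a : int -> V) n :
  psum (fun j => c * a j) n = c * psum a n.
Proof.
elim: n => [|n IH]; first by rewrite !psum0.
by rewrite !psumS IH -!mulrDr.
Qed.

Lemma psumN (V : zmodType) (a : int -> V) n :
  psum (fun j => a (- j)) n = psum a n.
Proof.
elim: n => [|n IH]; first by rewrite !psum0.
by rewrite !psumS IH opprK [a (- _) + _]addrC.
Qed.

Lemma le_psum (a b : int -> R) n : (forall j, a j <= b j) -> psum a n <= psum b n.
Proof.
by move=> h; rewrite /psum lerD // ler_sum // => i _; rewrite lerD.
Qed.

Lemma psum_ge0 (a : int -> R) n : (forall j, 0 <= a j) -> 0 <= psum a n.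
Proof. by move=> h; rewrite /psum addr_ge0 // sumr_ge0 // => i _; rewrite addr_ge0. Qed.

Lemma psum_nd (a : int -> R) n m : (forall j, 0 <= a j) -> (n <= m)%N ->
  psum a n <= psum a m.
Proof.
move=> h /subnKC <-; elim: (m - n)%N => [|k IH]; first by rewrite addn0.
by rewrite addnS psumS; apply: le_trans IH _; rewrite lerDl addr_ge0.
Qed.

Lemma nm_psum (a : int -> C) n : nm (psum a n) <= psum (fun j => nm (a j)) n.
Proof.
elim: n => [|n IH]; first by rewrite !psum0.
rewrite !psumS; apply: le_trans (nmD _ _) _.
by rewrite lerD //; exact: nmD.
Qed.

Lemma nm_psum_sub (a : int -> C) n m : (n <= m)%N ->
  nm (psum a n - psum a m) <=
  psum (fun j => nm (a j)) m - psum (fun j => nm (a j)) n.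
Proof.
move=> /subnKC <-; elim: (m - n)%N => [|k IH]; first by rewrite addn0 !subrr nm0.
rewrite addnS !psumS.
have -> : psum a n - (psum a (n + k) + (a (n + k).+1 + a (- (n + k).+1%:Z))) =
  psum a n - psum a (n + k) - (a (n + k).+1 + a (- (n + k).+1%:Z)) by ring.
apply: le_trans (nmD _ _) _; rewrite nmN.
have := nmD (a (n + k).+1) (a (- (n + k).+1%:Z)); lra.
Qed.

(* The sum over all integers of the absolutely summable family [a]
   (an arbitrary value if the symmetric partial sums diverge). *)
Definition zsum (a : int -> C) : C :=
  xget 0 [set l : C | forall e : R, 0 < e -> exists N, forall n, (N <= n)%N ->
                  nm (psum a n - l) <= e].

Lemma limit_unique (s : nat -> C) (l l' : C) :
  (forall e : R, 0 < e -> exists N, forall n, (N <= n)%N -> nm (s n - l) <= e) ->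
  (forall e : R, 0 < e -> exists N, forall n, (N <= n)%N -> nm (s n - l') <= e) ->
  l = l'.
Proof.
move=> h h'; apply/eqP; rewrite -subr_eq0; apply/eqP/nm_eq0/eqP.
rewrite eq_le nm_ge0 andbT; apply/ler_addgt0Pl => e e0; rewrite addr0.
have e2 : 0 < e / 2 by lra.
have [N hN] := h _ e2; have [N' hN'] := h' _ e2.
have := hN _ (leq_maxl N N'); have := hN' _ (leq_maxr N N') => h1 h2.
have -> : l - l' = (l - s (maxn N N')) + (s (maxn N N') - l') by ring.
by apply: le_trans (nmD _ _) _; rewrite nmB; lra.
Qed.

(** The Weierstrass test: [N] depends on the majorant [A] only and not on [a]. The interchanges of
    limits with bilateral sums below rest on this uniformity. *)
Lemma zsum_unif (A : int -> R) (B : R) : (forall j, 0 <= A j) ->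
  (forall n, psum A n <= B) -> forall e, 0 < e -> exists N, forall n a, (N <= n)%N ->
  (forall j, nm (a j) <= A j) -> nm (psum a n - zsum a) <= e.
Proof.
move=> A0 AB; pose E := range (psum A).
have E0 : has_sup E by split; [exists (psum A 0), 0%N|exists B => _ [n _ <-]].
have supE n : psum A n <= sup E by apply: sup_ubound; [case: E0|exists n].
have lim a : (forall j, nm (a j) <= A j) ->
    exists l : C, forall n, nm (psum a n - l) <= 2 * (sup E - psum A n).
  move=> aA; apply: telescoping_limit => n; first by rewrite subr_ge0.
  apply: le_trans (nm_psum_sub a (leqnSn n)) _.
  rewrite !psumS; have := aA n.+1; have := aA (- n.+1%:Z); lra.
have small e : 0 < e -> exists N, forall n, (N <= n)%N -> 2 * (sup E - psum A n) <= e.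
  move=> e0; have e2 : 0 < e / 2 by lra.
  have [_ [N _ <-] hN] := sup_adherent e2 E0; exists N => n Nn.
  by have := psum_nd A0 Nn; lra.
move=> e e0; have [N hN] := small e e0; exists N => n a Nn aA.
have [l hl] := lim a aA.
have ll d : 0 < d -> exists N, forall n, (N <= n)%N -> nm (psum a n - l) <= d.
  move=> d0; have [N' hN'] := small d d0; exists N' => m mN.
  exact: le_trans (hl m) (hN' m mN).
suff -> : zsum a = l by apply: le_trans (hl n) (hN n Nn).
rewrite /zsum; case: xgetP => [l' _ hl'|/(_ l)//].
exact: limit_unique hl' ll.
Qed.

Lemma zsum_cvg (a : int -> C) (B : R) : (forall n, psum (fun j => nm (a j)) n <= B) ->
  forall e : R, 0 < e -> exists N, forall n, (N <= n)%N -> nm (psum a n - zsum a) <= e.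
Proof.
move=> aB e e0; have [N hN] := zsum_unif (fun j => nm_ge0 (a j)) aB e0.
by exists N => n Nn; exact: hN.
Qed.

Lemma zsum_eq (a : int -> C) (l : C) :
  (forall e : R, 0 < e -> exists N, forall n, (N <= n)%N -> nm (psum a n - l) <= e) ->
  zsum a = l.
Proof.
move=> h; rewrite /zsum; case: xgetP => [l' _ hl'|/(_ l)//].
exact: limit_unique hl' h.
Qed.

Lemma limit_le (s : nat -> C) (l : C) (B : R) : (forall n, nm (s n) <= B) ->
  (forall e : R, 0 < e -> exists N, forall n, (N <= n)%N -> nm (s n - l) <= e) ->
  nm l <= B.
Proof.
move=> sB h; apply/ler_addgt0Pl => e e0; have [N /(_ N (leqnn N)) hN] := h e e0.
have -> : l = (l - s N) + s N by ring.
by apply: le_trans (nmD _ _) _; rewrite nmB lerD.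
Qed.

Lemma zsum_le (a : int -> C) (B : R) : (forall n, psum (fun j => nm (a j)) n <= B) ->
  nm (zsum a) <= B.
Proof.
move=> aB; apply: limit_le (zsum_cvg aB) => n.
exact: le_trans (nm_psum _ _) (aB n).
Qed.

Lemma eq_zsum (a b : int -> C) : (forall j, a j = b j) -> zsum a = zsum b.
Proof. by move=> /funext ->. Qed.

Lemma zsumD (a b : int -> C) (A B : R) :
  (forall n, psum (fun j => nm (a j)) n <= A) ->
  (forall n, psum (fun j => nm (b j)) n <= B) ->
  zsum (fun j => a j + b j) = zsum a + zsum b.
Proof.
move=> /zsum_cvg ha /zsum_cvg hb; apply: zsum_eq => e e0; have e2 : 0 < e / 2 by lra.
have [N hN] := ha _ e2; have [N' hN'] := hb _ e2.
exists (maxn N N') => n; rewrite geq_max => /andP[n1 n2]; rewrite psumD.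
have -> : psum a n + psum b n - (zsum a + zsum b) =
  (psum a n - zsum a) + (psum b n - zsum b) by ring.
by apply: le_trans (nmD _ _) _; have := hN n n1; have := hN' n n2; lra.
Qed.

Lemma zsumZ (c : C) (a : int -> C) (A : R) :
  (forall n, psum (fun j => nm (a j)) n <= A) ->
  zsum (fun j => c * a j) = c * zsum a.
Proof.
move=> /zsum_cvg ha; apply: zsum_eq => e e0; have c0 := nm_ge0 c.
have e2 : 0 < e / (1 + nm c) by rewrite divr_gt0 //; lra.
have [N hN] := ha _ e2; exists N => n Nn; rewrite psumZ -mulrBr nmM.
apply: le_trans (ler_wpM2l c0 (hN n Nn)) _.
by rewrite mulrA ler_pdivrMr; [rewrite mulrC ler_pM2l //; lra|lra].
Qed.

Lemma zsumJ (a : int -> C) (A : R) : (forall n, psum (fun j => nm (a j)) n <= A) ->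
  zsum (fun j => (a j)^*%C) = (zsum a)^*%C.
Proof.
move=> /zsum_cvg ha; apply: zsum_eq => e e0; have [N hN] := ha _ e0.
exists N => n Nn; have -> : psum (fun j => (a j)^*%C) n = (psum a n)^*%C.
  by elim: {Nn} n => [|n IH]; rewrite ?psum0 // !psumS IH !rmorphD.
by rewrite -rmorphB /= nmJ; exact: hN.
Qed.

Lemma psum_supp (V : zmodType) (a : int -> V) (N n : nat) :
  (forall j : int, (N < `|j|)%N -> a j = 0) -> (N <= n)%N -> psum a n = psum a N.
Proof.
move=> h /subnKC <-; elim: (n - N)%N => [|k IH]; first by rewrite addn0.
by rewrite addnS psumS IH !h ?addr0 // ?abszN !absz_nat ltnS leq_addr.
Qed.

Lemma zsum_supp (a : int -> C) (N : nat) :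
  (forall j : int, (N < `|j|)%N -> a j = 0) -> zsum a = psum a N.
Proof.
move=> h; apply: zsum_eq => e e0; exists N => n Nn.
by rewrite (psum_supp h Nn) subrr nm0 ltW.
Qed.

End IntegerSums.

(** * Weighted convolutions *)

Section Weights.
Variable R : realType.
Local Notation C := R[i].
Implicit Types (i j k m : int) (A B : R).

Definition br j : R := 1 + `|j%:~R|.
(** The exponent 2 makes the weight summable and, up to a constant, closed under convolution; it
    also leaves one power to trade for decay in [k] in [psum_conv_br]. *)
Definition wt j : R := (br j ^+ 2)^-1.

Lemma br_ge1 j : 1 <= br j. Proof. by rewrite lerDl. Qed.
Lemma br_gt0 j : 0 < br j. Proof. exact: lt_le_trans ltr01 (br_ge1 j). Qed.
Lemma br_ge0 j : 0 <= br j. Proof. exact/ltW/br_gt0. Qed.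
Lemma brN j : br (- j) = br j. Proof. by rewrite /br intrN normrN. Qed.

Lemma brD i j : br (i + j) <= br i + br j.
Proof. rewrite /br intrD; have := ler_normD (i%:~R : R) j%:~R; lra. Qed.

Lemma br_sub j k : br j <= br k + br (j - k).
Proof. by have := brD k (j - k); rewrite subrKC. Qed.

Lemma wt_gt0 j : 0 < wt j. Proof. by rewrite invr_gt0 exprn_gt0 // br_gt0. Qed.
Lemma wt_ge0 j : 0 <= wt j. Proof. exact/ltW/wt_gt0. Qed.
Lemma wtN j : wt (- j) = wt j. Proof. by rewrite /wt brN. Qed.

Lemma br_neq0 j : j != 0 -> (br j) / 2 <= `|j%:~R|.
Proof.
move=> j0; have : (1 : R) <= `|j%:~R|.
  by rewrite -intr_norm -[1]/(1%:~R) ler_int -gtz0_ge1 normr_gt0.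
rewrite /br; lra.
Qed.

(* [2 x / (1 + |x|)] has increments at least [wt], so any block of [wt] telescopes. *)
Let tau j : R := 2 * (j%:~R / br j).

Let tau_step j : wt j <= tau j - tau (j - 1).
Proof.
rewrite /wt /tau /br intrB mulr1z; set x : R := j%:~R.
have [j0|j0] := leP 1 j.
  have x1 : 1 <= x by rewrite -[1]/(1%:~R) ler_int.
  rewrite !ger0_norm; [|lra|lra].
  have -> : 2 * (x / (1 + x)) - 2 * ((x - 1) / (1 + (x - 1))) =
    (1 + x) ^- 2 * (2 * (1 + x) / x) by field; rewrite !gt_eqF //; lra.
  rewrite ler_peMr ?invr_ge0 ?exprn_ge0 //; [lra|].
  by rewrite ler_pdivlMr; lra.
have x1 : x <= 0 by rewrite -[0]/(0%:~R) ler_int -ltzD1.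
rewrite !ler0_norm; [|lra|lra].
have -> : 2 * (x / (1 - x)) - 2 * ((x - 1) / (1 - (x - 1))) =
    (1 - x) ^- 2 * (2 * (1 - x) / (2 - x)) by field; rewrite !gt_eqF //; lra.
rewrite ler_peMr ?invr_ge0 ?exprn_ge0 //; [lra|].
by rewrite ler_pdivlMr; lra.
Qed.

Let tau_le2 j : `|tau j| <= 2.
Proof.
rewrite /tau normrM ger0_norm // normrM normfV (ger0_norm (br_ge0 _)).
rewrite ger_pMr // ler_pdivrMr ?br_gt0 // mul1r /br; lra.
Qed.

Lemma psum_wt k n : psum (fun j => wt (j + k)) n <= 4.
Proof.
have E : psum (fun j => tau (j + k) - tau (j - 1 + k)) n =
    tau (n%:Z + k) - tau (- n%:Z - 1 + k).
  elim: n => [|n IH]; first by rewrite psum0 oppr0.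
  rewrite psumS IH.
  have -> : n.+1%:Z - 1 = n by rewrite -addn1 PoszD addrK.
  have -> : - n.+1%:Z = - n%:Z - 1 by rewrite -addn1 PoszD opprD.
  by ring.
apply: (@le_trans _ _ (psum (fun j => tau (j + k) - tau (j - 1 + k)) n)).
  by apply: le_psum => j; rewrite (addrAC j); exact: tau_step.
rewrite E; have := tau_le2 (n%:Z + k); have := tau_le2 (- n%:Z - 1 + k).
by rewrite !ler_norml; lra.
Qed.

Lemma psum_wt0 n : psum wt n <= 4.
Proof. by have := psum_wt 0 n; rewrite (eq_psum _ (b := wt)) // => j; rewrite addr0. Qed.

Lemma psum_wtB m n : psum (fun j => wt (m - j)) n <= 4.
Proof.
have := psum_wt (- m) n; rewrite (eq_psum _ (b := fun j => wt (m - j))) // => j.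
by rewrite -wtN opprB.
Qed.

(** The three estimates below reduce to a pointwise bound by two translates of [wt], each of mass at
    most 4. *)
Lemma psum_le_comb (F : int -> R) (c : R) k m n : 0 <= c ->
  (forall j, F j <= c * (wt (j + k) + wt (m - j))) -> psum F n <= 8 * c.
Proof.
move=> c0 h; apply: le_trans (le_psum n h) _; rewrite psumZ psumD.
rewrite mulrC ler_wpM2r //; have := psum_wt k n; have := psum_wtB m n; lra.
Qed.

(** Squaring [br m <= br j + br (m - j)] and dividing by all three squares bounds
    [wt j * wt (m - j)] by [3 * wt m] times the sum of the two weights. *)
Lemma psum_conv m n : psum (fun j => wt j * wt (m - j)) n <= 24 * wt m.
Proof.
have -> : 24 * wt m = 8 * (3 * wt m) by ring.
apply: (@psum_le_comb _ _ 0 m); first by rewrite mulr_ge0 ?wt_ge0.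
move=> j; rewrite addr0 /wt; set x := br j; set y := br (m - j); set z := br m.
have x0 : 0 < x := br_gt0 _; have y0 : 0 < y := br_gt0 _; have z0 : 0 < z := br_gt0 _.
have zxy : z <= x + y := br_sub m j.
have -> : (x ^+ 2)^-1 * (y ^+ 2)^-1 = (z ^+ 2)^-1 * (x ^+ 2)^-1 * (y ^+ 2)^-1 * z ^+ 2.
  by field; rewrite !gt_eqF.
have -> : 3 / z ^+ 2 * ((x ^+ 2)^-1 + (y ^+ 2)^-1) =
  (z ^+ 2)^-1 * (x ^+ 2)^-1 * (y ^+ 2)^-1 * (3 * (x ^+ 2 + y ^+ 2)).
  by field; rewrite !gt_eqF.
apply: ler_wpM2l; first by rewrite !mulr_ge0 ?invr_ge0 ?exprn_ge0 ?ltW.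
apply: (@le_trans _ _ ((x + y) ^+ 2)); first by rewrite ler_sqr ?nnegrE; lra.
have := sqr_ge0 (x - y); nra.
Qed.

(** The denominator [br (k + j)] of a nonresonant mode becomes decay in [k], since
    [br k <= 2 * br (k + j) * br j]; the additional [br j] costs one of the two powers of [br m]. *)
Lemma psum_conv_br k m n :
  psum (fun j => wt j / br (k + j) * wt (m - j)) n <= 24 * (br k * br m)^-1.
Proof.
have -> : 24 * (br k * br m)^-1 = 8 * (3 * (br k * br m)^-1) by ring.
apply: (@psum_le_comb _ _ 0 m); first by rewrite mulr_ge0 ?invr_ge0 ?mulr_ge0 ?br_ge0.
move=> j; rewrite addr0 /wt; set x := br j; set y := br (m - j); set z := br m.
set u := br k; set v := br (k + j).
have x0 : 1 <= x := br_ge1 _; have y0 : 1 <= y := br_ge1 _.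
have z0 : 1 <= z := br_ge1 _.
have u0 : 1 <= u := br_ge1 _; have v0 : 1 <= v := br_ge1 _.
have zxy : z <= x + y := br_sub m j.
have uvx : u <= 2 * v * x.
  have : u <= v + x by have := brD (k + j) (- j); rewrite addrK brN.
  nra.
have -> : (x ^+ 2)^-1 / v * (y ^+ 2)^-1 =
  (u * z)^-1 * (x ^+ 2)^-1 * (y ^+ 2)^-1 * v^-1 * (u * z).
  by field; rewrite !gt_eqF //; lra.
have -> : 3 * (u * z)^-1 * ((x ^+ 2)^-1 + (y ^+ 2)^-1) =
  (u * z)^-1 * (x ^+ 2)^-1 * (y ^+ 2)^-1 * v^-1 * (3 * v * (x ^+ 2 + y ^+ 2)).
  by field; rewrite !gt_eqF //; lra.
apply: ler_wpM2l; first by rewrite !mulr_ge0 ?invr_ge0 ?exprn_ge0 ?mulr_ge0 //; lra.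
apply: (@le_trans _ _ (2 * v * x * (x + y))); first by apply: ler_pM; lra.
have -> : 2 * v * x * (x + y) = v * (2 * x * (x + y)) by ring.
have -> : 3 * v * (x ^+ 2 + y ^+ 2) = v * (3 * (x ^+ 2 + y ^+ 2)) by ring.
by rewrite ler_wpM2l //; [lra|have := sqr_ge0 (x - y); nra].
Qed.

Lemma psum_br k n : psum (fun j => wt j / br (k + j)) n <= 24 * (br k)^-1.
Proof.
have -> : 24 * (br k)^-1 = 8 * (3 * (br k)^-1) by ring.
apply: (@psum_le_comb _ _ 0 (- k)); first by rewrite mulr_ge0 ?invr_ge0 ?br_ge0.
move=> j; rewrite addr0 -[wt (- k - j)]wtN opprB opprK addrC (addrC (wt j)) (addrC j) /wt.
set x := br j; set u := br k; set v := br (k + j).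
have x0 : 1 <= x := br_ge1 _.
have u0 : 1 <= u := br_ge1 _; have v0 : 1 <= v := br_ge1 _.
have uvx : u <= v + x by have := brD (k + j) (- j); rewrite addrK brN.
have -> : (x ^+ 2)^-1 / v = u^-1 * (x ^+ 2)^-1 * (v ^+ 2)^-1 * (u * v).
  by field; rewrite !gt_eqF //; lra.
have -> : 3 / u * ((v ^+ 2)^-1 + (x ^+ 2)^-1) =
  u^-1 * (x ^+ 2)^-1 * (v ^+ 2)^-1 * (3 * (x ^+ 2 + v ^+ 2)).
  by field; rewrite !gt_eqF //; lra.
apply: ler_wpM2l; first by rewrite !mulr_ge0 ?invr_ge0 ?exprn_ge0 ?mulr_ge0 //; lra.
apply: (@le_trans _ _ ((v + x) * v)); first by rewrite ler_wpM2r; lra.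
have := sqr_ge0 (x - v); nra.
Qed.

End Weights.
Arguments br {R} j.
Arguments wt {R} j.

(** * The convolution algebra of sequences with quadratic decay *)

Section FourierSeries.
Variable R : realType.
Local Notation C := R[i].
Implicit Types (i j k m : int) (a b c : int -> C) (A B : R).

Definition dec A a := forall j, nm (a j) <= A * wt j.

Lemma dec_ge0 A a : dec A a -> 0 <= A.
Proof.
move=> /(_ 0) h; have := le_trans (nm_ge0 _) h.
by rewrite pmulr_lge0 // wt_gt0.
Qed.

Lemma decW A B a : A <= B -> dec A a -> dec B a.
Proof. by move=> AB h j; apply: le_trans (h j) _; rewrite ler_wpM2r ?wt_ge0. Qed.

Lemma decD A B a b : dec A a -> dec B b -> dec (A + B) (fun j => a j + b j).
Proof. by move=> ha hb j; apply: le_trans (nmD _ _) _; rewrite mulrDl lerD. Qed.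

Lemma decN A a : dec A a -> dec A (fun j => - a j).
Proof. by move=> ha j; rewrite nmN. Qed.

Lemma decB A B a b : dec A a -> dec B b -> dec (A + B) (fun j => a j - b j).
Proof. by move=> ha /decN; exact: decD. Qed.

Lemma decZ A a (x : C) : dec A a -> dec (nm x * A) (fun j => x * a j).
Proof. by move=> ha j; rewrite nmM -mulrA ler_wpM2l ?nm_ge0. Qed.

Lemma decJN A a : dec A a -> dec A (fun j => (a (- j))^*%C).
Proof. by move=> h j; rewrite nmJ -[wt j]wtN. Qed.

Lemma dec_psum A a n : dec A a -> psum (fun j => nm (a j)) n <= 4 * A.
Proof.
move=> h; apply: le_trans (le_psum n h) _; rewrite psumZ mulrC.
by rewrite ler_wpM2r ?(dec_ge0 h) ?psum_wt0.
Qed.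

Lemma dec_psumM A a b (M : R) n : dec A a -> (forall j, nm (b j) <= M) ->
  psum (fun j => nm (a j * b j)) n <= 4 * (A * M).
Proof.
move=> h hb; apply: (@dec_psum (A * M)) => j; rewrite nmM mulrAC.
by apply: ler_pM => //; exact: nm_ge0.
Qed.

Lemma dec_bounded A a j : dec A a -> nm (a j) <= A.
Proof.
move=> h; apply: le_trans (h j) _; rewrite ler_piMr ?(dec_ge0 h) //.
by rewrite invf_le1 ?exprn_gt0 ?br_gt0 // exprn_ege1 // br_ge1.
Qed.

Lemma zsumN b : zsum (fun j => b (- j)) = zsum b.
Proof.
congr (xget 0); apply/funext => l; apply/propext.
by split=> h d /h[M hM]; exists M => x /hM; rewrite psumN.
Qed.

(** Symmetric partial sums are not translation invariant: moving the window by one exchanges two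
    boundary terms, which vanish in the limit by the decay of [b]. Negative translations are
    reflected to positive ones. *)
Lemma psum_shift_cvg A b k : dec A b -> forall e : R, 0 < e ->
  exists N, forall n, (N <= n)%N -> nm (psum (fun j => b (j + k)) n - zsum b) <= e.
Proof.
have wt_small (e : R) : 0 < e -> exists N, forall n : int, (N <= `|n|)%N -> wt n <= e.
  move=> e0; have [N hN] := archi_gt e^-1; exists N => n nN.
  rewrite -[e]invrK lef_pV2 ?posrE ?exprn_gt0 ?br_gt0 ?invr_gt0 //.
  apply: le_trans (ltW hN) _.
  have : (N%:R : R) <= br n.
    by rewrite /br -intr_norm -abszE; apply: ler_wpDl => //; rewrite -pmulrn ler_nat.
  by have := br_ge1 R n; nra.
have fwd (p : nat) a : dec A a -> forall e : R, 0 < e ->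
  exists N, forall n, (N <= n)%N -> nm (psum (fun j => a (j + p)) n - zsum a) <= e.
  move=> ha; elim: p => [|p IH] e e0.
    have [N hN] := zsum_cvg (fun n => dec_psum n ha) e0; exists N => n Nn.
    by rewrite (eq_psum _ (b := a)) ?hN // => j; rewrite addr0.
  have e2 : 0 < e / 2 by lra.
  have [N hN] := IH _ e2.
  have A0 := dec_ge0 ha.
  have e3 : 0 < e / (4 * (A + 1)) by rewrite divr_gt0 //; lra.
  have [N' hN'] := wt_small _ e3.
  exists (N + N' + p.+1)%N => n Nn.
  have step l : psum (fun j => a (j + p.+1)) l - psum (fun j => a (j + p)) l =
      a (l%:Z + p.+1) - a (- l%:Z + p).
    elim: l => [|l IHl]; first by rewrite !psum0 oppr0 !add0r.
    rewrite !psumS.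
    have -> : l.+1%:Z + p = l%:Z + p.+1 by lia.
    have -> : - l.+1%:Z + p.+1 = - l%:Z + p by lia.
    have -> : psum (fun j => a (j + p.+1)) l = a (l%:Z + p.+1) - a (- l%:Z + p) +
      psum (fun j => a (j + p)) l by rewrite -IHl subrK.
    by ring.
  have -> : psum (fun j => a (j + p.+1)) n - zsum a =
     a (n%:Z + p.+1) - a (- n%:Z + p) + (psum (fun j => a (j + p)) n - zsum a).
    by rewrite -step; ring.
  apply: le_trans (nmD _ _) _.
  have h1 := hN n ltac:(lia).
  have sm j : (N' <= `|j|)%N -> nm (a j) <= e / 4.
    move=> /hN' hw; apply: le_trans (ha j) _.
    apply: le_trans (ler_wpM2l A0 hw) _; rewrite mulrA ler_pdivrMr; nra.
  have h2 := sm (n%:Z + p.+1) ltac:(lia).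
  have h3 := sm (- n%:Z + p) ltac:(lia).
  have := nmD (a (n%:Z + p.+1)) (- a (- n%:Z + p)); rewrite nmN; lra.
move=> hb e e0; case: k => k; first exact: fwd.
have hbN : dec A (fun j => b (- j)) by move=> j; rewrite -[wt j]wtN.
have [N hN] := fwd k.+1 _ hbN e e0; exists N => n /hN.
rewrite zsumN -(psumN (fun j => b (j + Negz k))).
rewrite (eq_psum _ (b := fun j => b (- j + Negz k))) // => j.
by rewrite opprD NegzE.
Qed.

Definition fconv a b m : C := zsum (fun j => a j * b (m - j)).

Section ConvBound.
Variables (A B : R) (a b : int -> C).
Hypothesis ha : dec A a.
Hypothesis hb : dec B b.

Lemma conv_psum m n : psum (fun j => nm (a j * b (m - j))) n <= 24 * (A * B) * wt m.
Proof.
rewrite -mulrA mulrCA; apply: le_trans (ler_wpM2l _ (psum_conv R m n)); last first.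
  by rewrite mulr_ge0 ?(dec_ge0 ha) ?(dec_ge0 hb).
rewrite -psumZ; apply: le_psum => j; rewrite nmM mulrACA.
by apply: ler_pM; rewrite ?nm_ge0.
Qed.

Lemma conv_dec : dec (24 * (A * B)) (fconv a b).
Proof. by move=> m; apply: zsum_le => n; exact: conv_psum. Qed.

End ConvBound.

Lemma conv_bound_br k A B a b m : 0 <= A -> 0 <= B ->
  (forall j, nm (a j) <= A * (wt j / br (k + j))) -> dec B b ->
  nm (fconv a b m) <= 24 * (A * B) * (br k * br m)^-1.
Proof.
move=> A0 B0 ha hb; apply: zsum_le => n.
rewrite -mulrA mulrCA; apply: le_trans (ler_wpM2l _ (psum_conv_br R k m n)); last first.
  by rewrite mulr_ge0.
rewrite -psumZ; apply: le_psum => j; rewrite nmM mulrACA.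
by apply: ler_pM; rewrite ?nm_ge0.
Qed.

Lemma convBl A A' B a a' b m : dec A a -> dec A' a' -> dec B b ->
  fconv (fun j => a j - a' j) b m = fconv a b m - fconv a' b m.
Proof.
move=> ha ha' hb; rewrite -mulN1r -(zsumZ _ (fun n => conv_psum ha' hb m n)).
rewrite -(zsumD (fun n => conv_psum ha hb m n) (B := 24 * (A' * B) * wt m)).
  by apply: eq_zsum => j; ring.
move=> n; rewrite (eq_psum _ (b := fun j => nm (a' j * b (m - j)))) ?conv_psum //.
by move=> j; rewrite mulN1r nmN.
Qed.

Lemma convBr A B B' a b b' m : dec A a -> dec B b -> dec B' b' ->
  fconv a (fun j => b j - b' j) m = fconv a b m - fconv a b' m.
Proof.
move=> ha hb hb'; rewrite -mulN1r -(zsumZ _ (fun n => conv_psum ha hb' m n)).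
rewrite -(zsumD (fun n => conv_psum ha hb m n) (B := 24 * (A * B') * wt m)).
  by apply: eq_zsum => j; ring.
move=> n; rewrite (eq_psum _ (b := fun j => nm (a j * b' (m - j)))) ?conv_psum //.
by move=> j; rewrite mulN1r nmN.
Qed.

(** Fubini's theorem for the double series. Partial sums in [m] move inside the sum over [j]; the
    terms with large [j] are small uniformly in [n], and for each remaining [j] the window sum
    [c n j] tends to [zsum b] by [psum_shift_cvg]. *)
Lemma zsum_conv A B a b : dec A a -> dec B b ->
  zsum (fconv a b) = zsum a * zsum b.
Proof.
move=> ha hb; have A0 := dec_ge0 ha; have B0 := dec_ge0 hb.
apply: limit_unique (zsum_cvg (fun n => dec_psum n (conv_dec ha hb))) _ => e e0.
pose c n j := psum (fun m => b (m - j)) n.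
have cb n j : nm (c n j) <= 4 * B.
  apply: le_trans (nm_psum _ _) _.
  apply: le_trans (le_psum n (fun m => hb (m - j))) _.
  by rewrite psumZ mulrC ler_wpM2r // psum_wt.
have E n : psum (fconv a b) n = zsum (fun j => a j * c n j).
  elim: n => [|n IH].
    by rewrite psum0; apply: eq_zsum => j; rewrite /c psum0.
  rewrite psumS IH /fconv.
  have P1 m := fun l => conv_psum ha hb m l.
  rewrite -(zsumD (P1 _) (P1 _)) -(zsumD (fun l => dec_psumM l ha (cb n)) (B := 24 * (A * B) * wt n.+1%:Z + 24 * (A * B) * wt (- n.+1%:Z))).
    by apply: eq_zsum => j; rewrite /c psumS; ring.
  move=> l; apply: le_trans (lerD (P1 _ l) (P1 _ l)).
  by rewrite -psumD; apply: le_psum => j; exact: nmD.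
(* The constant [8 * B] bounds [c n j - zsum b], both terms being at most [4 * B]. *)
have [|n|N hN] := @zsum_unif R (fun j => A * (8 * B) * wt j) (4 * (A * (8 * B))) _ _ (e / 2) ltac:(lra).
- by move=> j; rewrite !mulr_ge0 ?wt_ge0.
- by rewrite psumZ mulrC ler_wpM2r ?psum_wt0 // !mulr_ge0.
have zb : nm (zsum b) <= 4 * B by apply: zsum_le => n; exact: dec_psum.
have fin l d : 0 < d -> exists N', forall n, (N' <= n)%N ->
    psum (fun j => nm (a j * (c n j - zsum b))) l <= d.
  have pt j d' : 0 < d' -> exists N', forall n, (N' <= n)%N -> nm (a j * (c n j - zsum b)) <= d'.
    move=> d0; have A1 : 0 < A + 1 by lra.
    have [N' hN'] := psum_shift_cvg (- j) hb (divr_gt0 d0 A1); exists N' => n /hN' hn.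
    rewrite nmM; apply: (@le_trans _ _ ((A + 1) * (d' / (A + 1)))); last first.
      by rewrite mulrC divfK // gt_eqF.
    apply: ler_pM; rewrite ?nm_ge0 //.
    by have := dec_bounded j ha; lra.
  elim: l d => [|l IH] d d0.
    by have [N' hN'] := pt 0 d d0; exists N' => n /hN'; rewrite psum0.
  have d3 : 0 < d / 3 by lra.
  have [N1 h1] := IH _ d3; have [N2 h2] := pt l.+1%:Z _ d3.
  have [N3 h3] := pt (- l.+1%:Z) _ d3.
  exists (N1 + N2 + N3)%N => n Nn; rewrite psumS.
  have := h1 n ltac:(lia); have := h2 n ltac:(lia); have := h3 n ltac:(lia); lra.
have e2 : 0 < e / 2 by lra.
have [N' hN'] := fin N _ e2; exists N' => n Nn; rewrite E.
have -> : zsum (fun j => a j * c n j) - zsum a * zsum b =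
    zsum (fun j => a j * (c n j - zsum b)).
  rewrite [zsum a * _]mulrC -mulNr -(zsumZ _ (fun l => dec_psum l ha)).
  rewrite -(zsumD (fun l => dec_psumM l ha (cb n)) (B := 4 * (A * (4 * B)))).
    by apply: eq_zsum => j; ring.
  move=> l; apply: le_trans (dec_psumM l ha (fun=> zb)).
  by apply: le_psum => j; rewrite nmM nmN -nmM mulrC.
set F := (fun j => a j * (c n j - zsum b)).
have hF j : nm (F j) <= A * (8 * B) * wt j.
  rewrite nmM mulrAC; apply: ler_pM; rewrite ?nm_ge0 //.
  by apply: le_trans (nmD _ _) _; rewrite nmN; have := cb n j; lra.
have h1 := hN N F (leqnn N) hF.
have -> : zsum F = - (psum F N - zsum F) + psum F N by ring.
apply: le_trans (nmD _ _) _; rewrite nmN.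
have := nm_psum F N; have := hN' n Nn; rewrite -/F; lra.
Qed.

End FourierSeries.

(** * Absolutely convergent Fourier series *)

Section Evaluation.
Variables (R : realType) (om : R).
Local Notation C := R[i].
Implicit Types (i j k m : int) (a b c : int -> C) (A B t : R).

Definition ee j t : C := cis (om * j%:~R * t).

Lemma nm_ee j t : nm (ee j t) = 1. Proof. exact: nm_cis. Qed.

Lemma eeD i j t : ee (i + j) t = ee i t * ee j t.
Proof. by rewrite /ee -cisD; congr cis; rewrite intrD; ring. Qed.

Lemma ee0 t : ee 0 t = 1. Proof. by rewrite /ee mulr0z mulr0 mul0r cis0. Qed.

Lemma ee_0 j : ee j 0 = 1. Proof. by rewrite /ee mulr0 cis0. Qed.

Lemma eeN j t : ee (- j) t = (ee j t)^*%C.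
Proof. by rewrite /ee -cisN; congr cis; rewrite intrN; ring. Qed.

Definition iom j : C := 'i%C * (om * j%:~R)%:C%C.

Lemma Df_ee j : Df (ee j) (fun t => iom j * ee j t).
Proof. exact: Df_cis. Qed.

Lemma contC_ee j : contC (ee j). Proof. exact: Df_contC (Df_ee j). Qed.

Definition evl a t : C := zsum (fun j => a j * ee j t).

Lemma dec_ee A a t : dec A a -> dec A (fun j => a j * ee j t).
Proof. by move=> h j; rewrite nmM nm_ee mulr1. Qed.

Lemma evl_le A a t : dec A a -> nm (evl a t) <= 4 * A.
Proof. by move=> h; apply: zsum_le => n; exact/dec_psum/dec_ee. Qed.

Lemma evl_le_psum (B : R) a t : (forall n, psum (fun j => nm (a j)) n <= B) -> nm (evl a t) <= B.
Proof.
move=> h; apply: zsum_le => n; rewrite (eq_psum _ (b := fun j => nm (a j))) // => j.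
by rewrite nmM nm_ee mulr1.
Qed.

Lemma evlD A B a b t : dec A a -> dec B b ->
  evl (fun j => a j + b j) t = evl a t + evl b t.
Proof.
move=> ha hb; rewrite /evl -(zsumD (fun n => dec_psum n (dec_ee t ha)) (fun n => dec_psum n (dec_ee t hb))).
by apply: eq_zsum => j; rewrite mulrDl.
Qed.

Lemma evlZ A a (x : C) t : dec A a -> evl (fun j => x * a j) t = x * evl a t.
Proof.
move=> ha; rewrite /evl -(zsumZ _ (fun n => dec_psum n (dec_ee t ha))).
by apply: eq_zsum => j; rewrite mulrA.
Qed.

Lemma evlB A B a b t : dec A a -> dec B b ->
  evl (fun j => a j - b j) t = evl a t - evl b t.
Proof.
move=> ha hb; rewrite -mulN1r -(evlZ _ _ hb) -(evlD t ha (decZ (-1) hb)).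
by congr (evl _ t); apply/funext => j; rewrite mulN1r.
Qed.

Lemma evlJ A a t : dec A a -> evl (fun j => (a (- j))^*%C) t = (evl a t)^*%C.
Proof.
move=> ha; rewrite /evl -(zsumJ (fun n => dec_psum n (dec_ee t ha))) -zsumN.
by apply: eq_zsum => j; rewrite opprK eeN rmorphM.
Qed.

(** The characters multiply, [ee m = ee j * ee (m - j)], so at fixed [t] they can be absorbed into
    the coefficients and [zsum_conv] applies. *)
Lemma evl_conv A B a b t : dec A a -> dec B b -> evl (fconv a b) t = evl a t * evl b t.
Proof.
move=> ha hb; rewrite /evl -(zsum_conv (dec_ee t ha) (dec_ee t hb)).
apply: eq_zsum => m; rewrite /fconv mulrC -(zsumZ _ (fun n => conv_psum ha hb m n)).
apply: eq_zsum => j; have -> : ee m t = ee j t * ee (m - j) t by rewrite -eeD subrKC.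
by ring.
Qed.

Lemma evl_delta (x : C) k t : evl (fun j => if j == k then x else 0) t = x * ee k t.
Proof.
rewrite /evl (@zsum_supp _ _ `|k|%N) => [|j hj]; last by case: eqP hj => [->|]; rewrite ?ltnn // mul0r.
have E n : psum (fun j => (if j == k then x else 0) * ee j t) n =
    if (`|k| <= n)%N then x * ee k t else 0.
  elim: n => [|n IH].
    by rewrite psum0 leqn0 absz_eq0 eq_sym; case: eqP => [->|]; rewrite ?mul0r.
  rewrite psumS IH; case: (ltngtP `|k|%N n.+1) => h.
  - by rewrite -ltnS h !ifN ?mul0r ?addr0 //; apply/eqP; lia.
  - by rewrite leqNgt ltnW //= !ifN ?mul0r ?addr0 //; apply/eqP; lia.
  - rewrite leqNgt h ltnSn /= add0r; have [kE|kE] : k = n.+1 \/ k = - n.+1%:Z by lia.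
      by rewrite -kE eqxx ifN ?mul0r ?addr0 //; apply/eqP; lia.
    by rewrite -kE eqxx ifN ?mul0r ?add0r //; apply/eqP; lia.
by rewrite E leqnn.
Qed.

Lemma psum_contC (f : int -> R -> C) n : (forall j, contC (f j)) -> contC (fun t => psum (f^~ t) n).
Proof.
move=> h; elim: n => [|n IH]; first by apply: contC_ext (h 0) _ => t; rewrite psum0.
by apply: contC_ext (contCD IH (contCD (h n.+1) (h (- n.+1%:Z)))) _ => t; rewrite psumS.
Qed.

Lemma psum_Df (f f' : int -> R -> C) n : (forall j, Df (f j) (f' j)) ->
  Df (fun t => psum (f^~ t) n) (fun t => psum (f'^~ t) n).
Proof.
move=> h; elim: n => [|n IH].
  by apply: (Df_ext (Df_eq (h 0) _)) => t; rewrite psum0.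
by apply: (Df_ext (Df_eq (DfD IH (DfD (h n.+1) (h (- n.+1%:Z)))) _)) => t; rewrite psumS.
Qed.

Lemma evl_unif A a (e : R) : dec A a -> 0 < e ->
  exists n, forall t, nm (psum (fun j => a j * ee j t) n - evl a t) <= e.
Proof.
move=> ha e0; have A0 := dec_ge0 ha.
have [|n|N hN] := @zsum_unif R (fun j => A * wt j) (4 * A) _ _ e e0.
- by move=> j; rewrite mulr_ge0 ?wt_ge0.
- by rewrite psumZ mulrC ler_wpM2r ?psum_wt0.
by exists N => t; apply: hN => //; exact: dec_ee.
Qed.

Lemma contC_evl A a : dec A a -> contC (evl a).
Proof.
move=> ha; apply/contC_epsP => t e e0; have e3 : 0 < e / 3 by lra.
have [n hn] := evl_unif ha e3.
have /contC_epsP/(_ t _ e3)[d d0 hd] : contC (fun t => psum (fun j => a j * ee j t) n).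
  by apply: (@psum_contC (fun j t => a j * ee j t)) => j; exact/contCZ/contC_ee.
exists d => // s /hd /= h3; have h1 := hn t; have h2 := hn s; rewrite nmB in h2.
move: h1 h2 h3; set x := evl a s; set y := evl a t.
set u := psum (fun j => a j * ee j s) n; set v := psum _ n => h1 h2 h3.
have -> : x - y = (x - u) + (u - v) + (v - y) by ring.
by have := nmD (x - u + (u - v)) (v - y); have := nmD (x - u) (u - v); lra.
Qed.

Lemma prim_bound_abs (f : R -> C) (M t : R) : contC f ->
  (forall s, nm (f s) <= M) -> nm (prim f t) <= M * `|t|.
Proof.
move=> hf h; have [t0|t0] := leP 0 t.
  by rewrite ger0_norm //; apply: prim_bound.
have := Df_bound_cst (Df_prim hf) (ltW t0) (fun s _ => h s).
by rewrite ltr0_norm // prim0 // sub0r nmN sub0r.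
Qed.

(** Termwise differentiation by comparison of the primitive of [evl r] with the partial sums.
    Quadratic decay of the derived series is a separate assumption; in the application it is
    inherited from the right-hand side of the differential equation. *)
Lemma Df_evl A B a r : dec A a -> dec B r -> (forall j, r j = iom j * a j) ->
  Df (evl a) (evl r).
Proof.
move=> ha hr E; have cr := contC_evl hr.
suff P t : prim (evl r) t = evl a t - evl a 0.
  apply: (Df_ext (Df_eq (DfD (Df_prim cr) (Df_cst (evl a 0))) _)) => t.
    by rewrite addr0.
  by rewrite P subrK.
apply/eqP; rewrite -subr_eq0; apply/eqP/nm_eq0/eqP.
rewrite eq_le nm_ge0 andbT; apply/ler_addgt0Pl => e e0; rewrite addr0.
have t1 : 0 < 1 + `|t| by have := normr_ge0 t; lra.
pose s n t := psum (fun j => a j * ee j t) n; pose s' n t := psum (fun j => r j * ee j t) n.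
have hs n : Df (s n) (s' n).
  apply: (@psum_Df (fun j t => a j * ee j t) (fun j t => r j * ee j t)) => j.
  by apply: (Df_eq (DfZ (a j) (Df_ee j))) => x; rewrite E; ring.
have d0 : 0 < e / 3 / (1 + `|t|) by rewrite divr_gt0 //; lra.
have e3 : 0 < e / 3 by lra.
have [n|N hN] := @zsum_unif R (fun j => (A + B) * wt j) (4 * (A + B))
   (fun j => mulr_ge0 (addr_ge0 (dec_ge0 ha) (dec_ge0 hr)) (wt_ge0 R j))
   _ _ d0.
  rewrite psumZ mulrC ler_wpM2r ?psum_wt0 //.
  by rewrite addr_ge0 ?(dec_ge0 ha) ?(dec_ge0 hr).
have haAB : dec (A + B) a by apply: decW ha; rewrite lerDl (dec_ge0 hr).
have hrAB : dec (A + B) r by apply: decW hr; rewrite lerDr (dec_ge0 ha).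
have ba x : nm (s N x - evl a x) <= e / 3.
  have := hN N _ (leqnn N) (dec_ee x haAB); rewrite -/(s N x) => h.
  apply: le_trans h _; rewrite ler_pdivrMr //.
  by have := normr_ge0 t; nra.
have br_ x : nm (evl r x - s' N x) <= e / 3 / (1 + `|t|).
  by rewrite nmB; exact: hN N _ (leqnn N) (dec_ee x hrAB).
have cs : contC (s' N).
  by apply: (@psum_contC (fun j t => r j * ee j t)) => j; exact/contCZ/contC_ee.
have := prim_bound_abs t (contCB cr cs) br_.
rewrite (prim_unique t (DfB (Df_prim cr) (hs N))) prim0 // => h.
have h' : nm (prim (evl r) t - s N t - (0 - s N 0)) <= e / 3.
  apply: le_trans h _; rewrite mulrAC ler_pdivrMr // ler_wpM2l; lra.
have -> : prim (evl r) t - (evl a t - evl a 0) =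
  (prim (evl r) t - s N t - (0 - s N 0)) + (s N t - evl a t) - (s N 0 - evl a 0) by ring.
apply: le_trans (nmD _ _) _; rewrite nmN.
have := nmD (prim (evl r) t - s N t - (0 - s N 0)) (s N t - evl a t).
have := ba t; have := ba 0; lra.
Qed.

End Evaluation.

(** * Closing the gaps by a fixed point *)

Section Ball.
Variable R : realType.
Local Notation C := R[i].

(** Radii [r] and weights [w] are kept apart: invariance is an a priori bound, while contraction may
    require another relative scaling of the components. *)
Lemma fixed_point_ball (I : Type) (w r : I -> R) (Phi : (I -> C) -> I -> C) (d0 : R) :
  0 <= d0 -> (forall i, 0 <= w i) -> (forall i, 0 <= r i <= d0 * w i) ->
  (forall x, (forall i, nm (x i) <= r i) -> forall i, nm (Phi x i) <= r i) ->
  (forall x y (d : R), 0 <= d -> (forall i, nm (x i) <= r i) -> (forall i, nm (y i) <= r i) ->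
     (forall i, nm (x i - y i) <= d * w i) -> forall i, nm (Phi x i - Phi y i) <= d / 2 * w i) ->
  exists z, (forall i, nm (z i) <= r i) /\ forall i, Phi z i = z i.
Proof.
move=> d00 w0 rw SP lip.
have S0 i : nm ((fun=> 0 : C) i) <= r i by rewrite nm0; case/andP: (rw i).
apply: (@fixed_point R I w (fun x => forall i, nm (x i) <= r i) Phi (fun=> 0) d0) => //.
  move=> i; rewrite sub0r nmN; apply: le_trans (SP _ S0 i) _.
  by case/andP: (rw i).
move=> s z hs hz i; apply/ler_addgt0Pr => e e0.
have [n hn] := half_pow_small (4 * d0 * w i) e0.
have -> : z i = s n i - (s n i - z i) by ring.
apply: le_trans (nmD _ _) _; rewrite nmN; apply: lerD (hs n i) _.
by apply: le_trans (hz n i) _; rewrite mulrAC.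
Qed.

Lemma nm_nat n : nm (n%:R : C) = n%:R.
Proof.
have -> : (n%:R : C) = (n%:R : R)%:C%C by rewrite rmorph_nat.
by rewrite nm_real normr_nat.
Qed.

Lemma nm_diffM (x x' y y' : C) :
  nm (x * y - x' * y') <= nm (x - x') * nm y + nm x' * nm (y - y').
Proof.
have -> : x * y - x' * y' = (x - x') * y + x' * (y - y') by ring.
by rewrite -!nmM; exact: nmD.
Qed.

End Ball.

(** All unknowns, for all [k] at once, form a single family: the Floquet solutions for different [k]
    are coupled through the coefficients of [q] which they determine. *)
Variant gap_index := IU of int | IF of int & int | IG of int & int | IE of int.

Section GapMap.
Variables (R : realType) (om : R) (N : nat) (p : int -> R[i]).
Local Notation C := R[i].
Implicit Types (x y : gap_index -> C) (j k m : int).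

Definition qof x j : C := p j + (if (N < `|j|)%N then x (IU j) else 0).
Definition qbar x j : C := (qof x (- j))^*%C.

(* A fixed point closes the gaps: for [|k| > N], with [f = IF k], [g = IG k], [e = IE k]
   and [q = qof], the functions [h = 1 + f], [g] solve [h' = (i e h - q^* g) / 2] and
   [g' + i om k g = (q h - i e g) / 2]; the solvability conditions at the resonant modes
   determine [e] and the Fourier coefficient [IU (- k)] of [q]. *)
Definition gap_map x (i : gap_index) : C :=
  match i with
  | IU j => if (N < `|j|)%N then - fconv (fun m => x (IF (- j) m)) (qof x) j else 0
  | IE k => if (N < `|k|)%N then - 'i%C * fconv (fun m => x (IG k m)) (qbar x) 0 else 0
  | IF k m => if (N < `|k|)%N && (m != 0) then
      ('i%C * x (IE k) * x (IF k m) - fconv (fun m => x (IG k m)) (qbar x) m) / (2 * iom om m)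
      else 0
  | IG k m => if (N < `|k|)%N && (k + m != 0) then
      (qof x m + fconv (fun m => x (IF k m)) (qof x) m - 'i%C * x (IE k) * x (IG k m))
        / (2 * iom om (k + m))
      else 0
  end.

Variables (A delta E F G L : R).
Local Notation Q := (A + 1).
Hypotheses (om0 : 0 < om) (hp : dec A p) (d0 : 0 < delta) (d1 : delta <= 1).
Hypotheses (E0 : 0 <= E) (F0 : 0 <= F) (G0 : 0 <= G) (L1 : 1 <= L).
(** [EE], [FE] and [GE] fix the radii from the leading terms; the summand 1 in [FE] and [GE] is
    reserved for terms that become small for large [k]. [LE], [LE'] and [LE''] choose [L] against
    the terms that stay comparable with the radii. Of the smallness conditions, [N1], [N2], [N3]
    serve the invariance of the ball and [N4], [N5], [N6] the contraction. *)
Hypothesis EE : 24 * (G * Q) = E.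
Hypothesis FE : (24 * (G * Q) + 1) / om = F.
Hypothesis GE : (Q + 1) / om = G.
Hypothesis LE : 24 * (L * Q + G) <= L ^+ 2 / 2.
Hypothesis LE' : 24 * (L * Q + G) / om <= L ^+ 2 / 4.
Hypothesis LE'' : 1 / om <= L / 4.
Hypothesis N1 : forall k, (N < `|k|)%N -> E * F * (br k)^-1 <= 1.
Hypothesis N2 : forall k, (N < `|k|)%N -> (24 * (F * Q) + E * G) * (br k)^-1 <= 1.
Hypothesis N3 : forall k, (N < `|k|)%N -> 24 * (F * Q) * (br k)^-1 <= delta.
Hypothesis N4 : forall k, (N < `|k|)%N -> (F + E) * (br k)^-1 <= om / 4.
Hypothesis N5 : forall k, (N < `|k|)%N ->
  (24 * (L ^+ 2 * Q + F) + L ^+ 2 * G + E * L) * (br k)^-1 <= om / 4.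
Hypothesis N6 : forall k, (N < `|k|)%N -> 24 * (L ^+ 2 * Q + F) * (br k)^-1 <= 1 / 2.

(** Division by [iom (k + m)] gives [IG] the factor [1 / br (k + m)]. By [psum_conv_br], convolution
    with [qbar] turns it into the factor [1 / br k] of [IE] and [IF], which in turn makes the
    feedback on [IU] small. *)
Definition gap_radius i : R :=
  match i with
  | IU j => delta * wt j
  | IF k m => F * (br k)^-1 * wt m
  | IG k m => G * (wt m / br (k + m))
  | IE k => E * (br k)^-1
  end.

(* [IG] depends on [IU] through a factor that does not decay in [k]; the powers of [L]
   turn this dependence into a contraction. *)
Definition gap_weight i : R :=
  match i with
  | IU j => wt j
  | IF k m => L ^+ 2 * (br k)^-1 * wt m
  | IG k m => L * (wt m / br (k + m))
  | IE k => L ^+ 2 * (br k)^-1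
  end.

Let S x := forall i, nm (x i) <= gap_radius i.

Let A0 : 0 <= A. Proof. exact: dec_ge0 hp. Qed.
Let br0 k : 0 <= (br k)^-1 :> R. Proof. by rewrite invr_ge0 br_ge0. Qed.
Let br1 k : (br k)^-1 <= 1 :> R.
Proof. by rewrite invf_le1 ?br_gt0 // br_ge1. Qed.

(** For nonzero [m] the modulus of [m] is at least half of [br m]; the 2 in the denominator makes up
    for this loss. *)
Lemma nm_div_iom (z : C) (B : R) m : m != 0 -> 0 <= B -> nm z <= om * B ->
  nm (z / (2 * iom om m)) <= B * (br m)^-1.
Proof.
move=> m0 B0 hz; rewrite nmM nmV nmM /iom nmM nm_i mul1r nm_real.
rewrite nm_nat normrM (ger0_norm (ltW om0)).
have h := br_neq0 R m0; have b0 := br_gt0 R m.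
rewrite ler_pdivrMr; last by rewrite !mulr_gt0 //; lra.
apply: le_trans hz _.
have -> : B / br m * (2 * (om * `|m%:~R|)) = om * B * (`|m%:~R| / (br m / 2)).
  by field; rewrite gt_eqF.
by rewrite ler_peMr ?mulr_ge0 // ?(ltW om0) // ler_pdivlMr ?mul1r //; lra.
Qed.

Lemma qof_dec x : S x -> dec Q (qof x).
Proof.
move=> hx j; apply: le_trans (nmD _ _) _; rewrite mulrDl mul1r; apply: lerD => //.
case: ifP => _; last by rewrite nm0 wt_ge0.
by apply: le_trans (hx (IU j)) _ => /=; rewrite ler_piMl ?wt_ge0.
Qed.

Lemma qbar_dec x : S x -> dec Q (qbar x).
Proof. by move=> /qof_dec /decJN. Qed.

Lemma xf_dec x k : S x -> dec (F * (br k)^-1) (fun m => x (IF k m)).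
Proof. by move=> hx m; exact: hx (IF k m). Qed.

Lemma xg_bnd x k j : S x -> nm (x (IG k j)) <= G * (wt j / br (k + j)).
Proof. by move=> hx; exact: hx (IG k j). Qed.

Lemma br_weak k j (a : R) : 0 <= a -> a * (wt j / br (k + j)) <= a * wt j.
Proof.
by move=> a0; rewrite ler_wpM2l // ler_piMr ?wt_ge0.
Qed.

Lemma xg_dec x k : S x -> dec G (fun m => x (IG k m)).
Proof. by move=> hx m; apply: le_trans (xg_bnd k m hx) _; exact: br_weak. Qed.

Let Q0 : 0 <= Q. Proof. by rewrite addr_ge0. Qed.

Lemma gap_map_ball x : S x -> S (gap_map x).
Proof.
move=> hx; have hq := qof_dec hx; have hqb := qbar_dec hx.
have fq k m : nm (fconv (fun m => x (IF k m)) (qof x) m) <= 24 * (F * (br k)^-1 * Q) * wt m.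
  exact: conv_dec (xf_dec k hx) hq m.
have gq k m : nm (fconv (fun m => x (IG k m)) (qbar x) m) <= 24 * (G * Q) * (br k * br m)^-1.
  by apply: conv_bound_br => //; move=> j; exact: xg_bnd.
move=> [j|k m|k m|k] /=; case: ifP => [|_].
- move=> hj; rewrite nmN; apply: le_trans (fq (- j) j) _; rewrite brN.
  rewrite ler_wpM2r ?wt_ge0 //; apply: le_trans _ (N3 hj).
  by rewrite le_eqVlt; apply/orP; left; apply/eqP; ring.
- by rewrite nm0 mulr_ge0 ?wt_ge0 // ltW.
- move=> /andP[hk m0].
  have -> : F / br k * wt m = F / br k / br m * (br m)^-1.
    by rewrite /wt; field; rewrite !gt_eqF ?br_gt0.
  apply: nm_div_iom => //; first by rewrite !mulr_ge0.
  apply: le_trans (nmD _ _) _; rewrite nmN !nmM nm_i mul1r.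
  apply: (@le_trans _ _ (E * (br k)^-1 * (F * (br k)^-1 * wt m) + 24 * (G * Q) * (br k * br m)^-1)).
    apply: lerD (gq k m); apply: ler_pM; rewrite ?nm_ge0 //.
  have -> : om * (F / br k / br m) =
      (br k)^-1 * (br m)^-1 + 24 * (G * Q) * (br k * br m)^-1.
    by rewrite -FE; field; rewrite !gt_eqF ?br_gt0.
  apply: lerD => //.
  have -> : E / br k * (F / br k * wt m) = (E * F * (br k)^-1) * ((br k)^-1 * wt m) by ring.
  apply: (@le_trans _ _ (1 * ((br k)^-1 * (br m)^-1))); last by rewrite mul1r.
  apply: ler_pM; rewrite ?mulr_ge0 ?wt_ge0 //; first exact: N1.
  rewrite ler_wpM2l // /wt expr2 invfM ler_piMr //.
- by rewrite nm0 !mulr_ge0 ?wt_ge0.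
- move=> /andP[hk m0].
  have -> : G * (wt m / br (k + m)) = G * wt m * (br (k + m))^-1 by rewrite mulrA.
  apply: nm_div_iom => //; first by rewrite mulr_ge0 ?wt_ge0.
  apply: le_trans (nmD _ _) _; rewrite nmN !nmM nm_i mul1r.
  apply: (@le_trans _ _ (Q * wt m + 24 * (F * (br k)^-1 * Q) * wt m + E * (br k)^-1 * (G * wt m))).
    apply: lerD; first by apply: le_trans (nmD _ _) _; apply: lerD.
    by apply: ler_pM; rewrite ?nm_ge0 //; exact: xg_dec.
  have -> : om * (G * wt m) = (Q + 1) * wt m by rewrite -GE; field; rewrite gt_eqF.
  have -> : Q * wt m + 24 * (F / br k * Q) * wt m + E / br k * (G * wt m) =
    (Q + (24 * (F * Q) + E * G) / br k) * wt m by ring.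
  by rewrite ler_wpM2r ?wt_ge0 // lerD2l; exact: N2.
- by rewrite nm0 !mulr_ge0 ?wt_ge0.
- move=> hk; rewrite nmM nmN nm_i mul1r; apply: le_trans (gq k 0) _.
  by rewrite {2}/br mulr0z normr0 addr0 mulr1 EE.
- by rewrite nm0 mulr_ge0.
Qed.

(** Only the chain from [IU] through [IG] to [IF] and [IE] has no factor that is small for large [k]
    relative to the radii; with the weights [1], [L], [L ^+ 2] each link of it gains [1 / L]. The
    remaining terms are controlled by [N4], [N5] and [N6]. *)
Lemma gap_map_lip x y (d : R) : 0 <= d -> S x -> S y ->
  (forall i, nm (x i - y i) <= d * gap_weight i) ->
  forall i, nm (gap_map x i - gap_map y i) <= d / 2 * gap_weight i.
Proof.
move=> dd hx hy hd; have hqx := qof_dec hx; have hqy := qof_dec hy.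
have hbx := qbar_dec hx; have hby := qbar_dec hy.
have dq : dec d (fun j => qof x j - qof y j).
  move=> j; rewrite /qof opprD addrACA subrr add0r; case: ifP => _; first exact: hd (IU j).
  by rewrite subrr nm0 mulr_ge0 ?wt_ge0.
have dqb : dec d (fun j => qbar x j - qbar y j).
  by move=> j; have := decJN dq j; rewrite rmorphB.
have df k : dec (d * (L ^+ 2 * (br k)^-1)) (fun m => x (IF k m) - y (IF k m)).
  by move=> m; have := hd (IF k m); rewrite /= !mulrA.
have dg k m : nm (x (IG k m) - y (IG k m)) <= d * L * (wt m / br (k + m)).
  by have := hd (IG k m); rewrite /= !mulrA.
have L0 : 0 <= L by apply: le_trans L1.
have L20 : 0 <= L ^+ 2 by rewrite exprn_ge0.
have fq k m : nm (fconv (fun m => x (IF k m)) (qof x) m - fconv (fun m => y (IF k m)) (qof y) m)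
    <= d * (24 * (L ^+ 2 * Q + F) * (br k)^-1) * wt m.
  have -> : fconv (fun m => x (IF k m)) (qof x) m - fconv (fun m => y (IF k m)) (qof y) m =
    fconv (fun m => x (IF k m) - y (IF k m)) (qof x) m +
    fconv (fun m => y (IF k m)) (fun j => qof x j - qof y j) m.
    rewrite (convBl _ (xf_dec k hx) (xf_dec k hy) hqx).
    by rewrite (convBr _ (xf_dec k hy) hqx hqy); ring.
  apply: le_trans (nmD _ _) _.
  apply: le_trans (lerD (conv_dec (df k) hqx m) (conv_dec (xf_dec k hy) dq m)) _.
  by rewrite le_eqVlt; apply/orP; left; apply/eqP; ring.
have gq k m : nm (fconv (fun m => x (IG k m)) (qbar x) m - fconv (fun m => y (IG k m)) (qbar y) m)
    <= d * (24 * (L * Q + G)) * ((br k)^-1 * (br m)^-1).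
  have -> : fconv (fun m => x (IG k m)) (qbar x) m - fconv (fun m => y (IG k m)) (qbar y) m =
    fconv (fun m => x (IG k m) - y (IG k m)) (qbar x) m +
    fconv (fun m => y (IG k m)) (fun j => qbar x j - qbar y j) m.
    rewrite (convBl _ (xg_dec k hx) (xg_dec k hy) hbx).
    by rewrite (convBr _ (xg_dec k hy) hbx hby); ring.
  apply: le_trans (nmD _ _) _.
  apply: le_trans (lerD (conv_bound_br m _ Q0 (dg k) hbx) (conv_bound_br m G0 dd _ dqb)) _.
  - by rewrite mulr_ge0.
  - by move=> j; exact: xg_bnd.
  - by rewrite le_eqVlt; apply/orP; left; apply/eqP; rewrite invfM; ring.
have ide (z z' w w' : C) : nm ('i%C * z * w - 'i%C * z' * w') <= nm (z - z') * nm w + nm z' * nm (w - w').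
  by rewrite -!mulrA -mulrBr nmM nm_i mul1r nm_diffM.
have cancel_om (X Y : R) k m : X * om / om * Y = X * Y by rewrite mulfK // gt_eqF.
move=> [j|k m|k m|k] /=; case: ifP => [|_]; rewrite ?subrr ?nm0.
- move=> hj; rewrite -opprD nmN; apply: le_trans (fq (- j) j) _; rewrite brN.
  by rewrite ler_wpM2r ?wt_ge0 // ler_wpM2l // -[2^-1]mul1r; exact: N6.
- by rewrite !mulr_ge0 ?wt_ge0.
- move=> /andP[hk m0]; rewrite -mulrBl.
  have -> : d / 2 * (L ^+ 2 / br k * wt m) = d / 2 * (L ^+ 2 / br k / br m) * (br m)^-1.
    by rewrite /wt; field; rewrite !gt_eqF ?br_gt0.
  apply: nm_div_iom => //; first by rewrite !mulr_ge0.
  set fx := fconv _ _ _; set fy := fconv _ _ _.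
  have -> : 'i%C * x (IE k) * x (IF k m) - fx - ('i%C * y (IE k) * y (IF k m) - fy) =
    ('i%C * x (IE k) * x (IF k m) - 'i%C * y (IE k) * y (IF k m)) - (fx - fy) by ring.
  apply: le_trans (nmD _ _) _; rewrite nmN.
  apply: le_trans (lerD (ide _ _ _ _) (gq k m)) _.
  apply: (@le_trans _ _ (d * L ^+ 2 * ((F + E) / br k) * (br k)^-1 * wt m +
     d * (24 * (L * Q + G)) * ((br k)^-1 * (br m)^-1))).
    rewrite lerD2r.
    have -> : d * L ^+ 2 * ((F + E) / br k) / br k * wt m =
      d * (L ^+ 2 * (br k)^-1) * (F * (br k)^-1 * wt m) +
      E * (br k)^-1 * (d * (L ^+ 2 * (br k)^-1 * wt m)) by ring.
    apply: lerD; apply: ler_pM; rewrite ?nm_ge0 //.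
  have -> : om * (d / 2 * (L ^+ 2 / br k / br m)) =
    d * L ^+ 2 * (om / 4) * ((br k)^-1 * (br m)^-1) +
    d * (om * (L ^+ 2 / 4)) * ((br k)^-1 * (br m)^-1) by field; rewrite !gt_eqF ?br_gt0.
  apply: lerD; last first.
    apply: ler_wpM2r; first by rewrite mulr_ge0.
    by rewrite ler_wpM2l // [leRHS]mulrC -ler_pdivrMr.
  have -> : d * L ^+ 2 * ((F + E) / br k) / br k * wt m =
    d * L ^+ 2 * ((F + E) / br k * ((br k)^-1 * wt m)) by ring.
  rewrite -[leRHS]mulrA; apply: ler_wpM2l; first by rewrite mulr_ge0.
  apply: ler_pM.
  + by rewrite mulr_ge0 ?addr_ge0.
  + by rewrite mulr_ge0 ?wt_ge0.
  + exact: N4.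
  + by rewrite ler_wpM2l // /wt expr2 invfM ler_piMr.
- by rewrite !mulr_ge0 ?wt_ge0.
- move=> /andP[hk m0]; rewrite -mulrBl.
  have -> : d / 2 * (L * (wt m / br (k + m))) = d / 2 * L * wt m * (br (k + m))^-1 by ring.
  apply: nm_div_iom => //; first by rewrite !mulr_ge0 ?wt_ge0.
  set fx := fconv _ _ _; set fy := fconv _ _ _.
  have -> : qof x m + fx - 'i%C * x (IE k) * x (IG k m) -
      (qof y m + fy - 'i%C * y (IE k) * y (IG k m)) =
    (qof x m - qof y m) + (fx - fy) -
    ('i%C * x (IE k) * x (IG k m) - 'i%C * y (IE k) * y (IG k m)) by ring.
  apply: le_trans (nmD _ _) _; rewrite nmN.
  apply: le_trans (lerD (le_trans (nmD _ _) (lerD (dq m) (fq k m))) (ide _ _ _ _)) _.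
  apply: (@le_trans _ _ (d * wt m + d * wt m *
    ((24 * (L ^+ 2 * Q + F) + L ^+ 2 * G + E * L) * (br k)^-1))).
    have -> : d * wt m + d * wt m * ((24 * (L ^+ 2 * Q + F) + L ^+ 2 * G + E * L) / br k) =
      d * wt m + d * (24 * (L ^+ 2 * Q + F) / br k) * wt m +
      (d * (L ^+ 2 * (br k)^-1) * (G * wt m) + E * (br k)^-1 * (d * L * wt m)) by ring.
    rewrite lerD2l; apply: lerD; apply: ler_pM; rewrite ?nm_ge0 //.
    + exact: xg_dec hx m.
    + by apply: le_trans (dg k m) _; apply: br_weak; rewrite mulr_ge0.
  have -> : om * (d / 2 * L * wt m) = d * wt m * (om * (L / 4)) + d * wt m * (om * (L / 4)).
    by field.
  have omL : 1 <= om * (L / 4) by rewrite [leRHS]mulrC -ler_pdivrMr.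
  apply: lerD; first by rewrite ler_peMr // mulr_ge0 ?wt_ge0.
  apply: ler_wpM2l; first by rewrite mulr_ge0 ?wt_ge0.
  by apply: le_trans (N5 hk) _; rewrite ler_wpM2l ?(ltW om0) // ler_peMl ?invr_ge0.
- by rewrite !mulr_ge0 ?wt_ge0.
- move=> hk; rewrite -mulrBr nmM nmN nm_i mul1r; apply: le_trans (gq k 0) _.
  rewrite [br 0]/br mulr0z normr0 addr0 invr1 mulr1.
  have -> : d / 2 * (L ^+ 2 / br k) = d * (L ^+ 2 / 2) * (br k)^-1 by ring.
  by rewrite ler_wpM2r // ler_wpM2l.
- by rewrite !mulr_ge0.
Qed.

End GapMap.

Ltac ge0 := repeat first [done | exact: wt_ge0 | exact: br_ge0 | exact: nm_ge0 |
  exact: ler0n | rewrite invr_ge0 | apply: exprn_ge0 | apply: mulr_ge0 | apply: addr_ge0].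

Section GapClosing.
Variables (R : realType) (om : R).
Local Notation C := R[i].
Hypothesis om0 : 0 < om.

Lemma br_large (X Y : R) (N : nat) (k : int) : 0 < Y -> X / Y <= N%:R -> (N < `|k|)%N ->
  X * (br k)^-1 <= Y.
Proof.
move=> Y0 XY Nk; rewrite ler_pdivrMr ?br_gt0 // mulrC -ler_pdivrMr //.
apply: le_trans XY _; rewrite /br; apply: ler_wpDl => //.
by rewrite -intr_norm -abszE -pmulrn ler_nat ltnW.
Qed.

Lemma mem_le_sum (X : seq R) x : (forall y, y \in X -> 0 <= y) -> x \in X ->
  x <= \sum_(y <- X) y.
Proof.
move=> X0 xX; rewrite (big_rem x) //= lerDl big_seq sumr_ge0 // => y yX.
exact: X0 (mem_rem yX).
Qed.

(** The order of the quantifiers matters: the radii depend only on [A] and [om], and [delta] enters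
    only the choice of [N1]. *)
Lemma gap_map_fixed (A : R) : 0 <= A -> exists E F G : R, [/\ 0 <= E, 0 <= F, 0 <= G &
  forall delta : R, 0 < delta -> delta <= 1 -> exists N1 : nat, forall (N : nat) (p : int -> C),
    (N1 <= N)%N -> dec A p -> exists x,
     (forall i, nm (x i) <= gap_radius delta E F G i) /\ forall i, gap_map om N p x i = x i].
Proof.
move=> A0; have [Q QE] : {Q | Q = A + 1} by eexists.
have [G GE] : {G | (Q + 1) / om = G} by eexists.
have [E EE] : {E | 24 * (G * Q) = E} by eexists.
have [F FE] : {F | (24 * (G * Q) + 1) / om = F} by eexists.
(* The term [4 / om] provides [LE'']. The last term gives [L ^+ 2 >= 96 * L * (Q + G) * (1 + 1 /
   om)], where 96 = 24 * 4 covers both [LE] and [LE']. *)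
have [L LD] : {L | L = 1 + 4 / om + 96 * (Q + G) * (1 + 1 / om)} by eexists.
have Q1 : 1 <= Q by rewrite QE lerDr.
have Q0 : 0 <= Q by apply: le_trans Q1.
have oi : 0 <= om^-1 by rewrite invr_ge0 ltW.
have G0 : 0 <= G by rewrite -GE mulr_ge0 // addr_ge0.
have E0 : 0 <= E by rewrite -EE !mulr_ge0.
have F0 : 0 <= F by rewrite -FE mulr_ge0 // addr_ge0 // !mulr_ge0.
have H1 : 0 <= 96 * (Q + G) * (1 + 1 / om).
  by rewrite mulr_ge0 ?mulr_ge0 ?addr_ge0 // mul1r.
have H2 : 0 <= 4 / om by exact: mulr_ge0.
have L1 : 1 <= L by rewrite LD; lra.
have LQG : L * (96 * (Q + G) * (1 + 1 / om)) <= L ^+ 2.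
  by rewrite expr2 ler_wpM2l //; [lra|rewrite LD; lra].
have QL : L * Q + G <= L * (Q + G) by rewrite mulrDr lerD2l ler_peMl.
have LE : 24 * (L * Q + G) <= L ^+ 2 / 2.
  apply: (@le_trans _ _ (24 * (L * (Q + G)))); first by rewrite ler_wpM2l.
  have : 0 <= L * (Q + G) * om^-1 by rewrite !mulr_ge0 ?addr_ge0 //; lra.
  have : 0 <= L * (Q + G) by rewrite !mulr_ge0 ?addr_ge0 //; lra.
  move: LQG; have -> : L * (96 * (Q + G) * (1 + 1 / om)) =
    96 * (L * (Q + G)) + 96 * (L * (Q + G) * om^-1) by ring.
  by lra.
have LE' : 24 * (L * Q + G) / om <= L ^+ 2 / 4.
  apply: (@le_trans _ _ (24 * (L * (Q + G)) / om)).
    by rewrite ler_wpM2r // ler_wpM2l.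
  have : 0 <= L * (Q + G) by rewrite !mulr_ge0 ?addr_ge0 //; lra.
  move: LQG; have -> : L * (96 * (Q + G) * (1 + 1 / om)) =
    96 * (L * (Q + G)) + 4 * (24 * (L * (Q + G)) / om) by ring.
  by lra.
have LE'' : 1 / om <= L / 4 by rewrite LD; lra.
exists E, F, G; split=> // delta d0 d1.
(* One quotient for each of the six smallness conditions of the contraction; all are nonnegative, so
   their sum bounds each of them. *)
pose X := [:: E * F / 1; (24 * (F * Q) + E * G) / 1; 24 * (F * Q) / delta; (F + E) / (om / 4);
  (24 * (L ^+ 2 * Q + F) + L ^+ 2 * G + E * L) / (om / 4);
  24 * (L ^+ 2 * Q + F) / (1 / 2)].
have L0 : 0 <= L by apply: le_trans L1.
have X0 x : x \in X -> 0 <= x.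
  rewrite !inE => /or4P[/eqP->|/eqP->|/eqP->|/or3P[/eqP->|/eqP->|/eqP->]];
  rewrite ?mulr_ge0 ?invr_ge0 ?addr_ge0 ?mulr_ge0 ?exprn_ge0 ?addr_ge0 ?mulr_ge0 ?exprn_ge0 ?(ltW d0) ?(ltW om0) //.
have [N1 hN1] := archi_gt (\sum_(x <- X) x); exists N1 => N p NN hp.
have XN x : x \in X -> x <= N%:R.
  move=> xX; apply: (@le_trans _ _ N1%:R); last by rewrite ler_nat.
  exact: le_trans (mem_le_sum X0 xX) (ltW hN1).
have om4 : 0 < om / 4 by rewrite divr_gt0.
have D : 0 <= 1 + E + F + G by rewrite !addr_ge0.
subst Q.
(* Since [L >= 1], every radius is at most [1 + E + F + G] times the corresponding weight. *)
apply: (@fixed_point_ball R gap_index (gap_weight L) (gap_radius delta E F G) _ (1 + E + F + G)) => //.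
- by case=> * /=; ge0.
- have LL : 1 <= L ^+ 2 by rewrite exprn_ege1.
  case=> [j|k m|k m|k] /=; apply/andP; split.
  + by rewrite mulr_ge0 ?wt_ge0 // ltW.
  + by rewrite ler_wpM2r ?wt_ge0 //; lra.
  + by rewrite !mulr_ge0 ?wt_ge0 ?invr_ge0 ?br_ge0.
  + rewrite !mulrA ler_wpM2r ?wt_ge0 // ler_wpM2r ?invr_ge0 ?br_ge0 //; nra.
  + by rewrite !mulr_ge0 ?wt_ge0 ?invr_ge0 ?br_ge0.
  + rewrite [leRHS]mulrA ler_wpM2r ?mulr_ge0 ?wt_ge0 ?invr_ge0 ?br_ge0 //; nra.
  + by rewrite !mulr_ge0 ?wt_ge0 ?invr_ge0 ?br_ge0.
  + rewrite !mulrA ler_wpM2r ?invr_ge0 ?br_ge0 //; nra.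
- apply: (@gap_map_ball R om N p A delta E F G) => // k hk; apply: br_large hk => //; apply: XN;
    by rewrite !inE eqxx ?orbT.
- apply: (@gap_map_lip R om N p A delta E F G L) => // k hk; apply: br_large hk => //; apply: XN;
    by rewrite !inE eqxx ?orbT.
Qed.

(** [K] depends neither on [delta] nor on [N], because [N] is later taken large in terms of [K]. Its
    summands bound the values of the two series: [4 * F] by [evl_le] and [24 * G] by [psum_br]. *)
Lemma gap_closing (A : R) : 0 <= A -> exists K : R, forall (delta : R), 0 < delta -> delta <= 1 ->
  exists N1 : nat, forall (N : nat) (p : int -> C), (N1 <= N)%N -> dec A p ->
   (forall j, (N < `|j|)%N -> p j = 0) ->
   exists q : int -> C, [/\ dec (A + 1) q, dec delta (fun j => q j - p j) &
    forall k, (N < `|k|)%N -> exists (e : C) (f g : int -> C),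
    [/\ dec K f, dec K g,
      forall t, nm (evl om f t) <= K / br k /\ nm (evl om g t) <= K / br k,
      Df (fun t => 1 + evl om f t) (fun t => 2^-1 * ('i%C * e * (1 + evl om f t) -
         (evl om q t)^*%C * evl om g t)) &
      Df (evl om g) (fun t => 2^-1 * (evl om q t * (1 + evl om f t) - 'i%C * e * evl om g t) -
         iom om k * evl om g t)]].
Proof.
move=> A0; have [E [F [G [E0 F0 G0 H]]]] := gap_map_fixed A0.
exists (4 * F + 24 * G) => delta d0 d1; have [N1 hN1] := H delta d0 d1.
exists N1 => N p NN hp psupp; have [x [xS xE]] := hN1 N p NN hp.
pose q := qof N p x.
have hq : dec (A + 1) q by exact: (@qof_dec R N p A delta E F G hp d1 x xS).
exists q; split => // [j|k hk].
  rewrite /q /qof addrC addKr; case: ifP => _; first exact: xS (IU j).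
  by rewrite nm0 mulr_ge0 ?wt_ge0 // ltW.
pose f m := x (IF k m); pose g m := x (IG k m); pose e := x (IE k).
have hf : dec (F * (br k)^-1) f by move=> m; exact: xS (IF k m).
have gb m : nm (g m) <= G * (wt m / br (k + m)) by exact: xS (IG k m).
have hg : dec G g.
  move=> m; apply: le_trans (gb m) _; rewrite ler_wpM2l // ler_piMr ?wt_ge0 //.
  by rewrite invf_le1 ?br_gt0 // br_ge1.
have b1 : (br k)^-1 <= 1 :> R by rewrite invf_le1 ?br_gt0 // br_ge1.
have b0 : 0 <= (br k)^-1 :> R by rewrite invr_ge0 br_ge0.
have hqb : dec (A + 1) (qbar N p x) by exact: decJN hq.
have qbE t : evl om (qbar N p x) t = (evl om q t)^*%C by exact: evlJ hq.
have iom0 m : m != 0 -> iom om m != 0.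
  move=> m0; rewrite /iom mulf_neq0 //.
    by rewrite eq_complex /= eqxx oner_eq0.
  by rewrite (inj_eq (@complexI R)) mulf_neq0 ?intr_eq0 // gt_eqF.
have i2 : iom om 0 = 0 by rewrite /iom mulr0z mulr0 mulr0.
have two0 : (2 : C) != 0 by rewrite pnatr_eq0.
(* At [m = 0] there is no denominator: [f 0] vanishes, and the equation for [IE k] is exactly the
   vanishing of the right-hand side. *)
have fE m : iom om m * f m = 2^-1 * ('i%C * e * ((if m == 0 then 1 else 0) + f m) - fconv g (qbar N p x) m).
  have := xE (IF k m); rewrite /= hk -/(f m) -/(e) /=; case: eqVneq => [->|m0] /= fm.
    rewrite -fm; have := xE (IE k); rewrite /= hk -/e => <-.
    have -> : 'i%C * (- 'i%C * fconv (fun m0 => x (IG k m0)) (qbar N p x) 0) * (1 + 0) =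
      - ('i%C * 'i%C) * fconv (fun m0 => x (IG k m0)) (qbar N p x) 0 by ring.
    by rewrite ii2 opprK mul1r subrr mulr0 mulr0.
  by rewrite add0r -[in LHS]fm; field; rewrite iom0.
(* At the resonance [m = - k] both [g m] and [p m] vanish, and the fixed point equation for
   [IU (- k)] reads [q m = - fconv f q m], which is the solvability condition. *)
have gE m : iom om m * g m = 2^-1 * (q m + fconv f q m - 'i%C * e * g m) - iom om k * g m.
  apply/eqP; rewrite eq_sym subr_eq -mulrDl.
  have -> : iom om m + iom om k = iom om (k + m) by rewrite /iom -mulrDr -rmorphD -mulrDr -intrD addrC.
  have := xE (IG k m); rewrite /= hk -/(g m) -/(e) /=; case: eqVneq => [km|m0] /= gm.
    rewrite -gm km i2 mulr0 mulr0 subr0.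
    have -> : q m = - fconv f q m; last by rewrite addNr mulr0.
    have mk : m = - k by apply/eqP; rewrite -addr_eq0 addrC km.
    have := xE (IU m); rewrite /= mk abszN hk opprK => ->.
    by rewrite /q /qof abszN hk psupp ?abszN // add0r.
  have gm' : (q m + fconv f q m - 'i%C * e * g m) / (2 * iom om (k + m)) = g m := gm.
  by apply/eqP; rewrite -[in RHS]gm'; field; rewrite iom0.
have hfq := conv_dec hf hq; have hgq := conv_dec hg hqb.
exists e, f, g; split.
- apply: decW hf; apply: (@le_trans _ _ F); first by rewrite ler_piMr.
  by rewrite -[leLHS]addr0 lerD // ?mulr_ge0 // ler_peMl // ler1n.
- by apply: decW hg; rewrite -[leLHS]add0r lerD ?mulr_ge0 // ler_peMl // ler1n.
- move=> t; split.
    apply: le_trans (evl_le om t hf) _; rewrite mulrA ler_wpM2r // lerDl mulr_ge0 //.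
  apply: (@le_trans _ _ (24 * G * (br k)^-1)); last by rewrite ler_wpM2r // lerDr mulr_ge0.
  apply: evl_le_psum => n; apply: le_trans (le_psum n gb) _.
  by rewrite psumZ mulrAC [leRHS]mulrC ler_wpM2l // psum_br.
- have dd : dec 1 (fun m => if m == 0 then 1 else 0 : C).
    by move=> m; case: eqVneq => [->|_]; rewrite ?nm1 ?nm0 mul1r ?wt_ge0 // /wt /br mulr0z normr0 addr0 expr1n invr1.
  have hdf := decD dd hf.
  have hie := decZ ('i%C * e) hdf.
  have hr := decZ 2^-1 (decB hie hgq).
  have D := Df_evl hf hr (fun m => esym (fE m)).
  apply: (Df_eq (DfD (Df_cst 1) D)) => t; rewrite add0r.
  rewrite (evlZ _ _ _ (decB hie hgq)) (evlB _ _ hie hgq) (evlZ _ _ _ hdf) (evlD _ _ dd hf).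
  by rewrite evl_delta ee0 mulr1 (evl_conv _ _ hg hqb) qbE [evl om g t * _]mulrC.
- have hs := decB (decD hq hfq) (decZ ('i%C * e) hg).
  have hr := decB (decZ 2^-1 hs) (decZ (iom om k) hg).
  have D := Df_evl hg hr (fun m => esym (gE m)).
  apply: (Df_eq D) => t.
  rewrite (evlB _ _ (decZ 2^-1 hs) (decZ (iom om k) hg)) (evlZ _ _ _ hs) (evlZ _ _ _ hg).
  rewrite (evlB _ _ (decD hq hfq) (decZ ('i%C * e) hg)) (evlD _ _ hq hfq) (evlZ _ _ _ hg).
  by rewrite (evl_conv _ _ hf hq); ring.
Qed.

End GapClosing.

(** * The linear system and its monodromy *)

Section LinearODE.
Variable R : realType.
Local Notation C := R[i].
Implicit Types (q x y : R -> C) (lam : C) (t : R).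

(* [(x, y)] is a row of a solution of [F' = F alpha]. *)
Definition row_sol q lam x y :=
  Df x (fun t => 2^-1 * ('i%C * lam * x t - (q t)^*%C * y t)) /\
  Df y (fun t => 2^-1 * (q t * x t - 'i%C * lam * y t)).

Lemma isd_exp (L : R) t : is_derive t 1 (fun s => expR (L * s)) (L * expR (L * t)).
Proof.
have lin : is_derive t 1 (fun t => L * t) L.
  by apply: isd_eq (isdM (is_derive_cst L _ _) (is_derive_id _ _)) _ _ => //; rewrite mul0r add0r mulr1.
by apply: isd_eq (@is_derive1_comp _ (@expR R) (fun t => L * t) t _ _ (is_derive_expR _) lin) _ _ => //;
  rewrite mulrC.
Qed.

(** In the exponentially weighted norm integration gains [1 / L] on both half-lines, without
    restriction to short times. *)
Lemma prim_exp_bound (f : R -> C) (K L t : R) : contC f -> 0 <= K -> 0 < L ->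
  (forall s, nm (f s) <= K * expR (L * `|s|)) -> nm (prim f t) <= K / L * expR (L * `|t|).
Proof.
move=> cf K0 L0 h; have KL : 0 <= K / L by rewrite divr_ge0 // ltW.
have [t0|t0] := leP 0 t.
  have := @Df_bound R (prim f) f (fun s => K / L * expR (L * s)) (fun s => K * expR (L * s)) 0 t
    (Df_prim cf) _ t0 _.
  rewrite prim0 // subr0 mulr0 expR0 mulr1 ger0_norm // => H.
  apply: le_trans (H _ _) _; last by rewrite gerBl.
    move=> s; apply: isd_eq (isdM (is_derive_cst (K / L) _ _) (isd_exp L s)) _ _ => //.
    by rewrite mul0r add0r /cst; field; rewrite gt_eqF.
  by move=> s /andP[s0 _]; have := h s; rewrite (ger0_norm s0).
have := @Df_bound R (prim f) f (fun s => - (K / L) * expR (- L * s)) (fun s => K * expR (- L * s)) t 0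
    (Df_prim cf) _ (ltW t0) _.
rewrite prim0 // sub0r nmN mulr0 expR0 mulr1 ltr0_norm // => H.
apply: le_trans (H _ _) _; last by rewrite mulNr opprK mulNr -mulrN gerDr oppr_le0.
  move=> s; apply: isd_eq (isdM (is_derive_cst (- (K / L)) _ _) (isd_exp (- L) s)) _ _ => //.
  by rewrite mul0r add0r /cst; field; rewrite gt_eqF.
by move=> s /andP[_ s0]; have := h s; rewrite (ler0_norm s0) mulrN -mulNr.
Qed.

Section Existence.
Variables (q : R -> C) (lam x0 y0 : C) (Q : R).
Hypotheses (cq : contC q) (qQ : forall t, nm (q t) <= Q).

Let ff (b : bool) (z : bool * R -> C) s : C := if b
  then 2^-1 * ('i%C * lam * z (true, s) - (q s)^*%C * z (false, s))
  else 2^-1 * (q s * z (true, s) - 'i%C * lam * z (false, s)).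

Let S (z : bool * R -> C) := forall b, contC (fun t => z (b, t)).

Let ff_cont b z : S z -> contC (ff b z).
Proof.
move=> hz; case: b; apply: contCZ.
  by apply: contCB; [exact/contCZ/hz|apply: contCM; [exact: contCJ|exact: hz]].
by apply: contCB; [apply: contCM => //; exact: hz|exact/contCZ/hz].
Qed.

(** Picard iteration in the weight [expR (L * |t|)]: as [M] bounds the coefficients, [L = 2 * M + 1]
    makes the integral operator contract by 1/2 on the whole line. *)
Lemma row_sol_exists : exists x y, [/\ row_sol q lam x y, x 0 = x0 & y 0 = y0].
Proof.
have Q0 : 0 <= Q by apply: le_trans (qQ 0); exact: nm_ge0.
pose M := nm lam + Q; have M0 : 0 <= M by rewrite addr_ge0 ?nm_ge0.
pose L := 2 * M + 1; have L0 : 0 < L by rewrite /L; lra.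
pose w (i : bool * R) := expR (L * `|i.2|).
pose Phi z (i : bool * R) := (if i.1 then x0 else y0) + prim (ff i.1 z) i.2.
pose d0 := nm x0 + nm y0.
have w0 i : 0 <= w i by rewrite /w expR_ge0.
have w1 i : 1 <= w i by rewrite /w -expR0 ler_expR mulr_ge0 // ltW.
have d00 : 0 <= d0 by rewrite addr_ge0 ?nm_ge0.
have [|z|x y d d0' hx hy hd i|i|s z hs hz|z [zS zE]] := @fixed_point R _ w S Phi (fun=> 0) d0 w0 d00.
- by move=> b; exact: contC_cst.
- move=> hz b; apply: contCD; first exact: contC_cst.
  exact/Df_contC/Df_prim/ff_cont.
- case: i => b t; rewrite /Phi /= opprD addrACA subrr add0r.
  have -> : prim (ff b x) t - prim (ff b y) t = prim (fun s => ff b x s - ff b y s) t.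
    rewrite (primD _ (ff_cont b hx) (contCN (ff_cont b hy))); congr (_ + _).
    rewrite -mulN1r -(primZ _ _ (ff_cont b hy)); congr (prim _ t).
    by apply/funext => s; rewrite mulN1r.
  apply: le_trans (@prim_exp_bound _ (M * d) L t _ _ L0 _) _.
  + by apply: contCB; exact: ff_cont.
  + exact: mulr_ge0.
  + move=> s; have n2 : nm (2^-1 : C) <= 1.
      by rewrite nmV nm_nat invf_le1 ?ler1n ?ltr0n.
    have bnd (a c u v : C) (A B X : R) : nm a <= A -> nm c <= B -> nm u <= X -> nm v <= X ->
        nm (2^-1 * (a * u - c * v)) <= (A + B) * X.
      move=> aA cB uX vX; rewrite nmM; apply: (@le_trans _ _ (1 * (A * X + B * X))).
        apply: ler_pM; rewrite ?nm_ge0 //; apply: le_trans (nmD _ _) _; rewrite nmN !nmM.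
        by apply: lerD; apply: ler_pM; rewrite ?nm_ge0.
      by rewrite mul1r mulrDl.
    have hw b' : nm (x (b', s) - y (b', s)) <= d * expR (L * `|s|) := hd (b', s).
    have hl : nm ('i%C * lam) <= nm lam by rewrite nmM nm_i mul1r.
    rewrite -mulrA; case: b => /=.
      have -> : ff true x s - ff true y s = 2^-1 * ('i%C * lam * (x (true, s) - y (true, s)) -
        (q s)^*%C * (x (false, s) - y (false, s))) by rewrite /ff; ring.
      by apply: bnd => //; rewrite nmJ.
    have -> : ff false x s - ff false y s = 2^-1 * (q s * (x (true, s) - y (true, s)) -
        'i%C * lam * (x (false, s) - y (false, s))) by rewrite /ff; ring.
    by rewrite /M [nm lam + Q]addrC; apply: bnd.
  + rewrite /w /= ler_wpM2r ?expR_ge0 // ler_pdivrMr // /L; nra.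
- rewrite sub0r nmN /Phi.
  have -> : prim (ff i.1 (fun=> 0)) i.2 = 0.
    rewrite (@prim_unique R (fun=> 0)) ?subrr //; apply: (Df_eq (Df_cst 0)) => t.
    by rewrite /ff; case: i.1; rewrite !mulr0 subr0 mulr0.
  rewrite addr0; apply: (@le_trans _ _ (d0 * 1)); last by rewrite ler_wpM2l.
  by rewrite mulr1 /d0; case: i.1; have := nm_ge0 x0; have := nm_ge0 y0; lra.
(* Closedness: the weight is bounded on [|r| <= |t| + 1], so the convergence is uniform there and
   continuity passes to the limit. *)
- move=> b; apply/contC_epsP => t e e0; have e3 : 0 < e / 3 by lra.
  have [n hn] := half_pow_small (4 * d0 * expR (L * (`|t| + 1))) e3.
  have hb r : `|r| <= `|t| + 1 -> nm (s n (b, r) - z (b, r)) <= e / 3.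
    move=> hr; apply: le_trans (hz n (b, r)) _; apply: le_trans hn.
    rewrite mulrAC; apply: ler_wpM2r; first exact/ltW/half_pow_gt0.
    by apply: ler_wpM2l; [exact: mulr_ge0|rewrite /w ler_expR ler_wpM2l // ltW].
  have /contC_epsP/(_ t _ e3)[d dp hd] := hs n b.
  exists (Num.min d 1); first by rewrite lt_min dp ltr01.
  move=> r; rewrite lt_min => /andP[/hd h2 r1].
  have hr : `|r| <= `|t| + 1.
    by have := ler_normD (r - t) t; rewrite subrK; lra.
  have h1 := hb r hr; have h3 : nm (s n (b, t) - z (b, t)) <= e / 3.
    by apply: hb; rewrite lerDl.
  rewrite nmB in h1.
  have -> : z (b, r) - z (b, t) = (z (b, r) - s n (b, r)) + (s n (b, r) - s n (b, t)) +
    (s n (b, t) - z (b, t)) by ring.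
  have := nmD (z (b, r) - s n (b, r) + (s n (b, r) - s n (b, t))) (s n (b, t) - z (b, t)).
  have := nmD (z (b, r) - s n (b, r)) (s n (b, r) - s n (b, t)); lra.
exists (fun t => z (true, t)), (fun t => z (false, t)); split.
- split.
    apply: (Df_ext (Df_eq (DfD (Df_cst x0) (Df_prim (ff_cont true zS))) _)) => t.
      by rewrite add0r.
    by rewrite -zE.
  apply: (Df_ext (Df_eq (DfD (Df_cst y0) (Df_prim (ff_cont false zS))) _)) => t.
    by rewrite add0r.
  by rewrite -zE.
- by rewrite -zE /Phi /= (prim0 (ff_cont true zS)) addr0.
- by rewrite -zE /Phi /= (prim0 (ff_cont false zS)) addr0.
Qed.

End Existence.

(** For [lam = mu] this is the constancy of the determinant; for different parameters, its integral
    is the variation of constants formula behind [row_quadratic]. *)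
Lemma Df_wronskian q lam mu x y x' y' : row_sol q lam x y -> row_sol q mu x' y' ->
  Df (fun t => x t * y' t - y t * x' t)
     (fun t => 2^-1 * 'i%C * (lam - mu) * (x t * y' t + y t * x' t)).
Proof.
move=> [hx hy] [hx' hy']; apply: (Df_eq (DfB (DfM hx hy') (DfM hy hx'))) => t.
by ring.
Qed.

Lemma row_sol_lin q lam x y x' y' (a b : C) : row_sol q lam x y -> row_sol q lam x' y' ->
  row_sol q lam (fun t => a * x t + b * x' t) (fun t => a * y t + b * y' t).
Proof.
move=> [hx hy] [hx' hy']; split.
  by apply: (Df_eq (DfD (DfZ a hx) (DfZ b hx'))) => t; ring.
by apply: (Df_eq (DfD (DfZ a hy) (DfZ b hy'))) => t; ring.
Qed.

Lemma row_sol_cont q lam x y : row_sol q lam x y -> contC x /\ contC y.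
Proof. by move=> [/Df_contC hx /Df_contC hy]. Qed.

End LinearODE.

(** * Energy identities, the trace on the imaginary axis, holomorphy in the spectral parameter *)

Section Monodromy.
Variables (R : realType) (q : R -> R[i]) (Q : R).
Local Notation C := R[i].
Local Notation Re := complex.Re.
Local Notation Im := complex.Im.
Hypotheses (cq : contC q) (qQ : forall t, nm (q t) <= Q).
Implicit Types (lam mu : C) (x y : R -> C) (t T : R).

Lemma Re_mul_conj (z : C) : Re (z * z^*%C) = nm z ^+ 2.
Proof. by rewrite mul_conj. Qed.

Lemma isd_Df_Re (f f' : R -> C) t : Df f f' -> is_derive t 1 (fun s => Re (f s)) (Re (f' t)).
Proof. by move=> h; case: (h t). Qed.

(** The part of [alpha] containing [q] is skew-Hermitian and cancels, so only [Im lam] changes the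
    energy. *)
Lemma isd_energy lam x y t : row_sol q lam x y ->
  is_derive t 1 (fun s => nm (x s) ^+ 2 + nm (y s) ^+ 2)
    (- Im lam * (nm (x t) ^+ 2 - nm (y t) ^+ 2)).
Proof.
move=> [hx hy]; have := isd_Df_Re t (DfD (DfM hx (DfJ hx)) (DfM hy (DfJ hy))).
move=> h; apply: (isd_eq h) => [s|]; first by rewrite cReD !Re_mul_conj.
rewrite !nm_sqr; case: (x t) (y t) (q t) lam {hx hy h} => [a b] [c d] [u v] [k l].
by simpc => /=; field.
Qed.

(** Gronwall's argument; the bound is uniform in [q] and locally uniform in [lam]. *)
Lemma energy_bound lam x y t : row_sol q lam x y -> 0 <= t ->
  nm (x t) ^+ 2 + nm (y t) ^+ 2 <= (nm (x 0) ^+ 2 + nm (y 0) ^+ 2) * expR (nm lam * t).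
Proof.
move=> h t0; pose D s := nm (x s) ^+ 2 + nm (y s) ^+ 2.
have D0 s : 0 <= D s by rewrite addr_ge0 ?exprn_ge0 ?nm_ge0.
have dD s := isdM (isd_energy s h) (isd_exp (- nm lam) s).
have : - (D 0 * expR (- nm lam * 0)) <= - (D t * expR (- nm lam * t)).
  apply: (@isd_le R (fun s => - (D s * expR (- nm lam * s))) (fun s =>
    expR (- nm lam * s) * (Im lam * (nm (x s) ^+ 2 - nm (y s) ^+ 2) + nm lam * D s))) => // [s|s _].
    by apply: isd_eq (isdB (is_derive_cst 0 _ _) (dD s)) _ _ => [r|]; rewrite sub0r // /D; ring.
  apply: mulr_ge0; first exact: expR_ge0.
  have := Im_le_nm lam; rewrite ler_norml => /andP[l1 l2].
  have u0 : 0 <= nm (x s) ^+ 2 by rewrite exprn_ge0 ?nm_ge0.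
  have v0 : 0 <= nm (y s) ^+ 2 by rewrite exprn_ge0 ?nm_ge0.
  by rewrite /D; nra.
rewrite mulr0 expR0 mulr1 lerN2 mulNr expRN => H.
by move: H; rewrite ler_pdivrMr ?expR_gt0.
Qed.

Lemma row_bound lam x y t (B : R) : row_sol q lam x y -> 0 <= t ->
  (nm (x 0) ^+ 2 + nm (y 0) ^+ 2) * expR (nm lam * t) <= B ^+ 2 -> 0 <= B ->
  nm (x t) <= B /\ nm (y t) <= B.
Proof.
move=> h t0 hB B0; have := le_trans (energy_bound h t0) hB => H.
have u0 : 0 <= nm (x t) ^+ 2 by rewrite exprn_ge0 ?nm_ge0.
have v0 : 0 <= nm (y t) ^+ 2 by rewrite exprn_ge0 ?nm_ge0.
by split; rewrite -ler_sqr ?nnegrE ?nm_ge0 //; lra.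
Qed.

Definition basis_rows lam x1 y1 x2 y2 := [/\ row_sol q lam x1 y1, row_sol q lam x2 y2,
  x1 0 = 1 /\ y1 0 = 0 & x2 0 = 0 /\ y2 0 = 1].

Lemma basis_det lam x1 y1 x2 y2 t : basis_rows lam x1 y1 x2 y2 ->
  x1 t * y2 t - y1 t * x2 t = 1.
Proof.
move=> [h1 h2 [a b] [c d]]; have W := Df_wronskian h1 h2.
have := @Df0_cst R (fun t => x1 t * y2 t - y1 t * x2 t) t 0 _.
rewrite a b c d mulr1 mulr0 subr0; apply.
by apply: (Df_eq W) => s; rewrite subrr mulr0 mul0r.
Qed.

Lemma basis_energy_gt0 lam x1 y1 x2 y2 t (a b : C) : basis_rows lam x1 y1 x2 y2 ->
  (a != 0) || (b != 0) ->
  0 < nm (a * x1 t + b * x2 t) ^+ 2 + nm (a * y1 t + b * y2 t) ^+ 2.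
Proof.
move=> hb ab; have det := basis_det t hb.
rewrite lt_neqAle addr_ge0 ?exprn_ge0 ?nm_ge0 // andbT eq_sym paddr_eq0 ?exprn_ge0 ?nm_ge0 //.
rewrite !expf_eq0 /=; apply/negP => /andP[/eqP /nm_eq0 e1 /eqP /nm_eq0 e2].
have a0 : a = 0.
  have : a * (x1 t * y2 t - y1 t * x2 t) = 0; last by rewrite det mulr1.
  have -> : a * (x1 t * y2 t - y1 t * x2 t) =
    (a * x1 t + b * x2 t) * y2 t - (a * y1 t + b * y2 t) * x2 t by ring.
  by rewrite e1 e2 !mul0r subrr.
have b0 : b = 0.
  have : b * (x1 t * y2 t - y1 t * x2 t) = 0; last by rewrite det mulr1.
  have -> : b * (x1 t * y2 t - y1 t * x2 t) =
    (a * y1 t + b * y2 t) * x1 t - (a * x1 t + b * x2 t) * y1 t by ring.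
  by rewrite e1 e2 !mul0r subrr.
by move: ab; rewrite a0 b0 eqxx.
Qed.

Lemma isd_indefinite (kap : R) x y t : row_sol q ('i%C * kap%:C%C) x y ->
  is_derive t 1 (fun s => nm (y s) ^+ 2 - nm (x s) ^+ 2)
   (kap * (nm (x t) ^+ 2 + nm (y t) ^+ 2) + 2 * Re (q t * x t * (y t)^*%C)).
Proof.
move=> [hx hy]; have := isd_Df_Re t (DfB (DfM hy (DfJ hy)) (DfM hx (DfJ hx))).
move=> h; apply: (isd_eq h) => [s|]; first by rewrite cReB !Re_mul_conj.
rewrite !nm_sqr; case: (x t) (y t) (q t) {hx hy h} => [a b] [c d] [u v].
by simpc => /=; field.
Qed.

(** For [kap] above the bound of [q], [isd_indefinite] makes [|y|^2 - |x|^2] strictly increasing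
    along every nonzero solution, whereas an eigenvector for the eigenvalue 1 or -1 would return
    with the same value. This yields points where [Delta^2 - 4] does not vanish. *)
Lemma trace_off_axis (kap T : R) x1 y1 x2 y2 : 0 < T -> Q < kap ->
  basis_rows ('i%C * kap%:C%C) x1 y1 x2 y2 -> (x1 T + y2 T) ^+ 2 != 4.
Proof.
move=> T0 Qk hb; have det := basis_det T hb; move: hb (hb) => [h1 h2 [i1 j1] [i2 j2]] hb.
have key (a b : C) : (a != 0) || (b != 0) ->
    nm b ^+ 2 - nm a ^+ 2 < nm (a * y1 T + b * y2 T) ^+ 2 - nm (a * x1 T + b * x2 T) ^+ 2.
  move=> ab; have := @isd_lt R (fun s => nm (a * y1 s + b * y2 s) ^+ 2 - nm (a * x1 s + b * x2 s) ^+ 2) _ 0 T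
    (fun s => isd_indefinite s (row_sol_lin a b h1 h2)) _ T0.
  rewrite i1 i2 j1 j2 !mulr0 !mulr1 addr0 add0r; apply => t _.
  have E := basis_energy_gt0 t hb ab.
  set X := a * x1 t + b * x2 t in E *; set Y := a * y1 t + b * y2 t in E *.
  have : - (Q * (nm X ^+ 2 + nm Y ^+ 2)) <= 2 * Re (q t * X * Y^*%C).
    have h := Re_le_nm (q t * X * Y^*%C); rewrite !nmM nmJ ler_norml in h.
    case/andP: h => h _; apply: le_trans (_ : 2 * (- (nm (q t) * nm X * nm Y)) <= _); last by rewrite ler_wpM2l.
    rewrite mulrN lerN2.
    have := sqr_ge0 (nm X - nm Y); have := nm_ge0 X; have := nm_ge0 Y; have := nm_ge0 (q t).
    have := qQ t; nra.
  nra.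
apply/negP => /eqP E.
have [s [ss tr]] : exists s : C, s * s = 1 /\ x1 T + y2 T = s + s.
  have : (x1 T + y2 T - 2) * (x1 T + y2 T + 2) = 0.
    have -> : (x1 T + y2 T - 2) * (x1 T + y2 T + 2) = (x1 T + y2 T) ^+ 2 - 4 by ring.
    by rewrite E subrr.
  move=> /eqP; rewrite mulf_eq0 => /orP[]; rewrite ?subr_eq0 ?addr_eq0 => /eqP e.
    by exists 1; rewrite e mulr1.
  by exists (-1); rewrite e mulrNN mulr1; split=> //; ring.
have ns : nm s = 1.
  have : nm s ^+ 2 = 1 by rewrite expr2 -nmM ss nm1.
  by move=> /eqP; rewrite sqrp_eq1 ?nm_ge0 // => /eqP.
have noev (a b : C) : (a != 0) || (b != 0) ->
    a * x1 T + b * x2 T = s * a -> a * y1 T + b * y2 T = s * b -> False.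
  by move=> ab e1 e2; have := key a b ab; rewrite e1 e2 !nmM ns !mul1r ltxx.
have y2E : y2 T = s + s - x1 T by rewrite -tr addrC addKr.
have detE : y1 T * x2 T = x1 T * (s + s - x1 T) - 1.
  by rewrite -det y2E; ring.
(* [(x2 T, s - x1 T)] is a left eigenvector for [s] if it is nonzero; otherwise a coordinate vector
   is one. *)
case: (boolP ((x2 T != 0) || (s - x1 T != 0))) => [ab|].
  apply: (noev _ _ ab); first by ring.
  rewrite y2E mulrC detE -ss; ring.
rewrite negb_or !negbK => /andP[/eqP x20]; rewrite subr_eq0 => /eqP xs.
have y2s : y2 T = s by rewrite y2E -xs addrK.
case: (boolP (y1 T != 0)) => [y1n|].
  apply: (@noev 0 1); rewrite ?oner_eq0 ?orbT //; rewrite ?x20 ?y2s; ring.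
rewrite negbK => /eqP y10.
apply: (@noev 1 0); rewrite ?oner_eq0 //; rewrite ?x20 ?y2s ?y10 -?xs; ring.
Qed.

Section Entire.
Variables (X Y : C -> R -> C) (a0 b0 : C) (T : R).
Hypothesis hXY : forall lam, [/\ row_sol q lam (X lam) (Y lam), X lam 0 = a0 & Y lam 0 = b0].
Hypothesis T0 : 0 < T.

(** Expanded in the basis rows at [lam], the row at [mu] differs from that at [lam] by [mu - lam]
    times an integral of itself against these rows. Used once, this gives a Lipschitz bound; used
    again, it gives the derivative with a quadratic error. *)
Lemma row_quadratic lam : exists lx ly : C, exists K : R, forall mu, nm (mu - lam) <= 1 ->
  nm (X mu T - X lam T - (mu - lam) * lx) <= K * nm (mu - lam) ^+ 2 /\
  nm (Y mu T - Y lam T - (mu - lam) * ly) <= K * nm (mu - lam) ^+ 2.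
Proof.
have [x1 [y1 [h1 i1 j1]]] := row_sol_exists lam 1 0 cq qQ.
have [x2 [y2 [h2 i2 j2]]] := row_sol_exists lam 0 1 cq qQ.
have hb : basis_rows lam x1 y1 x2 y2 by [].
pose c := nm a0 ^+ 2 + nm b0 ^+ 2 + 1.
have c0 : 0 <= nm a0 ^+ 2 + nm b0 ^+ 2 by rewrite addr_ge0 ?exprn_ge0 ?nm_ge0.
have [B BE] : {B | B = c * expR ((nm lam + 1) * T)} by eexists.
have e1 : 1 <= expR ((nm lam + 1) * T).
  by rewrite -expR0 ler_expR mulr_ge0 ?addr_ge0 ?nm_ge0 // ltW.
have B1 : 1 <= B by rewrite BE /c; nra.
have B0 : 0 <= B by lra.
have bnd mu x y t : nm mu <= nm lam + 1 -> row_sol q mu x y ->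
    nm (x 0) ^+ 2 + nm (y 0) ^+ 2 <= c -> 0 <= t <= T -> nm (x t) <= B /\ nm (y t) <= B.
  move=> hm h hc /andP[t0 tT]; apply: (row_bound h t0) => //.
  apply: (@le_trans _ _ B); last by rewrite expr2 ler_peMl.
  rewrite BE; apply: ler_pM; rewrite ?addr_ge0 ?exprn_ge0 ?nm_ge0 ?expR_ge0 //.
  by rewrite ler_expR; apply: ler_pM; rewrite ?nm_ge0.
have b1 t : 0 <= t <= T -> nm (x1 t) <= B /\ nm (y1 t) <= B.
  by apply: (bnd lam x1 y1 t _ h1); rewrite ?lerDl // i1 j1 nm1 nm0 expr1n expr0n /= addr0 /c; lra.
have b2 t : 0 <= t <= T -> nm (x2 t) <= B /\ nm (y2 t) <= B.
  by apply: (bnd lam x2 y2 t _ h2); rewrite ?lerDl // i2 j2 nm1 nm0 expr1n expr0n /= add0r /c; lra.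
have nmu mu : nm (mu - lam) <= 1 -> nm mu <= nm lam + 1.
  by move=> h; have := nmD (mu - lam) lam; rewrite subrK; lra.
have bX mu t : nm (mu - lam) <= 1 -> 0 <= t <= T -> nm (X mu t) <= B /\ nm (Y mu t) <= B.
  move=> /nmu hm; have [h i j] := hXY mu; apply: (bnd mu) => //.
  by rewrite i j /c; lra.
(* These occur in the derivatives of the Wronskians of the row at [mu] with the two basis rows;
   [inv] recovers a row from its Wronskians, as the determinant is 1. *)
pose G1 mu t := X mu t * y1 t + Y mu t * x1 t.
pose G2 mu t := X mu t * y2 t + Y mu t * x2 t.
have cX mu : contC (X mu) /\ contC (Y mu) by have [/row_sol_cont] := hXY mu.
have [cx1 cy1] := row_sol_cont h1; have [cx2 cy2] := row_sol_cont h2.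
have cG1 mu : contC (G1 mu) by have [? ?] := cX mu; apply: contCD; exact: contCM.
have cG2 mu : contC (G2 mu) by have [? ?] := cX mu; apply: contCD; exact: contCM.
have inv (u v : C) t : (u * y2 t - v * x2 t) * x1 t - (u * y1 t - v * x1 t) * x2 t = u /\
    (u * y2 t - v * x2 t) * y1 t - (u * y1 t - v * x1 t) * y2 t = v.
  have det := basis_det t hb; split.
    rewrite -[RHS]mulr1 -det; ring.
  rewrite -[RHS]mulr1 -det; ring.
have W1 mu t : X mu t * y1 t - Y mu t * x1 t = - b0 + 2^-1 * 'i%C * (mu - lam) * prim (G1 mu) t.
  have [h i j] := hXY mu.
  have := Df_inj 0 t (Df_wronskian h h1) (DfZ (2^-1 * 'i%C * (mu - lam)) (Df_prim (cG1 mu))).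
  rewrite (prim0 (cG1 mu)) i j i1 j1 !mulr0 mulr1 sub0r subr0 opprK => <-; ring.
have W2 mu t : X mu t * y2 t - Y mu t * x2 t = a0 + 2^-1 * 'i%C * (mu - lam) * prim (G2 mu) t.
  have [h i j] := hXY mu.
  have := Df_inj 0 t (Df_wronskian h h2) (DfZ (2^-1 * 'i%C * (mu - lam)) (Df_prim (cG2 mu))).
  rewrite (prim0 (cG2 mu)) i j i2 j2 !mulr0 mulr1 !subr0 => <-; ring.
have XE mu t : X mu t = a0 * x1 t + b0 * x2 t + 2^-1 * 'i%C * (mu - lam) *
    (prim (G2 mu) t * x1 t - prim (G1 mu) t * x2 t).
  by have [<- _] := inv (X mu t) (Y mu t) t; rewrite W1 W2; ring.
have YE mu t : Y mu t = a0 * y1 t + b0 * y2 t + 2^-1 * 'i%C * (mu - lam) *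
    (prim (G2 mu) t * y1 t - prim (G1 mu) t * y2 t).
  by have [_ <-] := inv (X mu t) (Y mu t) t; rewrite W1 W2; ring.
have half (u : C) : nm (2^-1 * 'i%C * u) <= nm u.
  rewrite !nmM nmV nm_nat nm_i mulr1; have := nm_ge0 u; lra.
have two (u v u' v' : C) (b b' : R) : nm u <= b -> nm v <= b -> nm u' <= b' -> nm v' <= b' ->
    nm (u * u' + v * v') <= 2 * (b * b').
  move=> ub vb ub' vb'; apply: le_trans (nmD _ _) _; rewrite !nmM.
  have := ler_pM (nm_ge0 u) (nm_ge0 u') ub ub'.
  have := ler_pM (nm_ge0 v) (nm_ge0 v') vb vb'; lra.
have two' (u v u' v' : C) (b b' : R) : nm u <= b -> nm v <= b -> nm u' <= b' -> nm v' <= b' ->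
    nm (u * u' - v * v') <= 2 * (b * b').
  by move=> ub vb ub' vb'; rewrite -mulNr; apply: two; rewrite ?nmN.
have [K1 K1E] : {K1 | K1 = 2 * (2 * (B * B) * T * B)} by eexists.
have K10 : 0 <= K1 by rewrite K1E !mulr_ge0 // ltW.
have lip mu t : nm (mu - lam) <= 1 -> 0 <= t <= T ->
    nm (X mu t - X lam t) <= K1 * nm (mu - lam) /\ nm (Y mu t - Y lam t) <= K1 * nm (mu - lam).
  move=> hm ht; have [t0 tT] := andP ht.
  have p1 : nm (prim (G1 mu) t) <= 2 * (B * B) * T.
    apply: le_trans (prim_bound (cG1 mu) t0 (M := 2 * (B * B)) _) _.
      move=> s /andP[s0 st]; have hs : 0 <= s <= T by rewrite s0 (le_trans st).
      by have [? ?] := bX mu s hm hs; have [? ?] := b1 s hs; exact: two.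
    by rewrite ler_wpM2l // !mulr_ge0.
  have p2 : nm (prim (G2 mu) t) <= 2 * (B * B) * T.
    apply: le_trans (prim_bound (cG2 mu) t0 (M := 2 * (B * B)) _) _.
      move=> s /andP[s0 st]; have hs : 0 <= s <= T by rewrite s0 (le_trans st).
      by have [? ?] := bX mu s hm hs; have [? ?] := b2 s hs; exact: two.
    by rewrite ler_wpM2l // !mulr_ge0.
  have [u1 v1] := b1 t ht; have [u2 v2] := b2 t ht.
  have dX : X mu t - X lam t = 2^-1 * 'i%C * ((mu - lam) *
      (prim (G2 mu) t * x1 t - prim (G1 mu) t * x2 t)).
    by rewrite [X mu t]XE [X lam t]XE subrr; ring.
  have dY : Y mu t - Y lam t = 2^-1 * 'i%C * ((mu - lam) *
      (prim (G2 mu) t * y1 t - prim (G1 mu) t * y2 t)).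
    by rewrite [Y mu t]YE [Y lam t]YE subrr; ring.
  rewrite dX dY ![K1 * _]mulrC; split; apply: le_trans (half _) _; rewrite nmM;
    apply: ler_wpM2l; rewrite ?nm_ge0 // K1E; exact: two'.
pose Z := 2 * (2 * (K1 * B) * T * B).
exists (2^-1 * 'i%C * (prim (G2 lam) T * x1 T - prim (G1 lam) T * x2 T)),
  (2^-1 * 'i%C * (prim (G2 lam) T * y1 T - prim (G1 lam) T * y2 T)), Z => mu hm.
have TT : 0 <= T <= T by rewrite lexx ltW.
have T00 := ltW T0.
(* Second use of the expansion: the bound [lip], put under the integral, makes the remainder
   quadratic in [mu - lam]. *)
have Gd (G : C -> R -> C) (x y : R -> C) : contC x -> contC y -> (forall mu t, G mu t = X mu t * y t + Y mu t * x t) ->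
   (forall mu, contC (G mu)) -> (forall t, 0 <= t <= T -> nm (x t) <= B /\ nm (y t) <= B) ->
   nm (prim (G mu) T - prim (G lam) T) <= 2 * (K1 * B) * T * nm (mu - lam).
  move=> cx cy GE cG bxy.
  have D : Df (fun t => prim (G mu) t - prim (G lam) t) (fun t => G mu t - G lam t).
    by apply: DfB; exact: Df_prim.
  have H := @Df_bound_cst R _ _ (2 * (K1 * B) * nm (mu - lam)) 0 T D T00.
  rewrite !prim0 // !subr0 in H; rewrite mulrAC; apply: H => t ht; rewrite !GE.
  have [? ?] := lip mu t hm ht; have [? ?] := bxy t ht.
  have -> : X mu t * y t + Y mu t * x t - (X lam t * y t + Y lam t * x t) =
    (X mu t - X lam t) * y t + (Y mu t - Y lam t) * x t by ring.
  have -> : 2 * (K1 * B) * nm (mu - lam) = 2 * (K1 * nm (mu - lam) * B) by ring.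
  exact: two.
have d1 := Gd G1 x1 y1 cx1 cy1 (fun _ _ => erefl) cG1 b1.
have d2 := Gd G2 x2 y2 cx2 cy2 (fun _ _ => erefl) cG2 b2.
have [u1 v1] := b1 T TT; have [u2 v2] := b2 T TT.
have fin (w1 w2 : C) : nm w1 <= B -> nm w2 <= B ->
   nm (2^-1 * 'i%C * ((mu - lam) * ((prim (G2 mu) T - prim (G2 lam) T) * w1 -
      (prim (G1 mu) T - prim (G1 lam) T) * w2))) <= Z * nm (mu - lam) ^+ 2.
  move=> hw1 hw2; apply: le_trans (half _) _; rewrite nmM.
  have -> : Z * nm (mu - lam) ^+ 2 = nm (mu - lam) * (2 * (2 * (K1 * B) * T * nm (mu - lam) * B)).
    by rewrite /Z; ring.
  by rewrite ler_wpM2l ?nm_ge0 //; exact: two'.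
split.
  apply: le_trans (fin _ _ u1 u2); rewrite le_eqVlt; apply/orP; left; apply/eqP; congr nm.
  by rewrite [X mu T]XE [X lam T]XE subrr; ring.
apply: le_trans (fin _ _ v1 v2); rewrite le_eqVlt; apply/orP; left; apply/eqP; congr nm.
by rewrite [Y mu T]YE [Y lam T]YE subrr; ring.
Qed.

End Entire.
End Monodromy.

(** * Trigonometric approximation and Parseval *)

Section TrigDensity.
Variables (R : realType) (T : R).
Local Notation C := R[i].
Local Notation Re := complex.Re.
Local Notation Im := complex.Im.
Hypothesis T0 : 0 < T.
Let om : R := 2 * pi / T.
Implicit Types (f g : R -> C) (t s : R) (j : int).

Definition periodicC f := forall t, f (t + T) = f t.

Lemma periodic_int f (m : int) t : periodicC f -> f (t + m%:~R * T) = f t.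
Proof.
move=> h; have nat_ (n : nat) s : f (s + n%:R * T) = f s.
  elim: n => [|n IH]; first by rewrite mul0r addr0.
  by rewrite -natr1 mulrDl mul1r addrA h.
case: m => n; first by rewrite -pmulrn nat_.
by rewrite NegzE intrN -pmulrn mulNr -[LHS](nat_ n.+1) subrK.
Qed.

(** Only [t] is confined to the segment while [s] may leave it; this allows translations by periods
    and the crossing of an end point in [periodize]. *)
Lemma heine f (a b e : R) : contC f -> 0 < e ->
  exists2 d, 0 < d & forall t s, a <= t <= b -> `|s - t| < d -> nm (f s - f t) < e.
Proof.
move=> /contC_epsP cf e0.
have := @segment_compact R a b; rewrite compact_near_coveringP.
move=> /(_ R (0^'+) (fun d t => forall s, `|s - t| < d -> nm (f s - f t) < e) _) H.
have /H : forall x, [set` `[a, b]] x ->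
  \forall x' \near x & d \near 0^'+, forall s, `|s - x'| < d -> nm (f s - f x') < e.
  move=> x _; have e2 : 0 < e / 2 by lra.
  have [d d0 hd] := cf x _ e2.
  have d2 : 0 < d / 2 by lra.
  exists (ball x (d / 2), [set r | r < d / 2]) => /=.
    split; first exact: nbhsx_ballx.
    exact: nbhs_right_lt.
  move=> [x' r] /= [xx' rd] s sx'.
  rewrite /ball /= distrC in xx'.
  have h1 : nm (f x' - f x) < e / 2 by apply: hd; lra.
  have h2 : nm (f s - f x) < e / 2.
    by apply: hd; have := ler_normD (s - x') (x' - x); rewrite subrKA; lra.
  have -> : f s - f x' = (f s - f x) - (f x' - f x) by ring.
  by apply: le_lt_trans (nmD _ _) _; rewrite nmN; lra.
move=> hn; have [d [d0 hd]] : exists d, 0 < d /\ [set` `[a, b]] `<=` (fun t => forall s, `|s - t| < d -> nm (f s - f t) < e).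
  near (0 : R)^'+ => d; exists d; split; near: d; [exact: nbhs_right_gt|exact: hn].
by exists d => // t s tab; apply: hd; rewrite /= in_itv.
Unshelve. all: by end_near. Qed.

Lemma heine_periodic f (e : R) : contC f -> periodicC f -> 0 < e ->
  exists2 d, 0 < d & forall t s, `|s - t| < d -> nm (f s - f t) < e.
Proof.
move=> cf pf e0; have [d d0 hd] := heine 0 T cf e0; exists d => // t s st.
pose m := - Num.floor (t / T).
rewrite -(periodic_int m t pf) -(periodic_int m s pf); apply: hd; last first.
  by rewrite opprD addrACA subrr addr0.
rewrite /m intrN mulNr.
have := ge_floor (t / T); rewrite ler_pdivlMr // => h1.
have := ltW (floorD1_gt (t / T)); rewrite ler_pdivrMr // intrD mulrDl mul1r => h2.
by apply/andP; split; lra.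
Qed.

Lemma contC_bounded f (a b : R) : contC f -> exists2 B : R, 0 <= B & forall t, a <= t <= b -> nm (f t) <= B.
Proof.
move=> cf; have [ab|ab] := leP a b; last first.
  by exists 0 => // t /andP[h1 h2]; have := le_trans h1 h2; rewrite leNgt ab.
have [c _ hc] := @EVT_max R (fun t => nm (f t)) a b ab (continuous_subspaceT (contC_nm cf)).
by exists (nm (f c)); rewrite ?nm_ge0 // => t tab; apply: hc; rewrite in_itv.
Qed.

Lemma periodic_bounded f : contC f -> periodicC f -> exists2 B : R, 0 <= B & forall t, nm (f t) <= B.
Proof.
move=> cf pf; have [B B0 hB] := contC_bounded 0 T cf; exists B => // t.
rewrite -(periodic_int (- Num.floor (t / T)) t pf); apply: hB.
rewrite intrN mulNr.
have := ge_floor (t / T); rewrite ler_pdivlMr // => h1.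
have := ltW (floorD1_gt (t / T)); rewrite ler_pdivrMr // intrD mulrDl mul1r => h2.
by apply/andP; split; lra.
Qed.

Lemma omT : om * T = 2 * pi.
Proof. by rewrite /om divfK // gt_eqF. Qed.

Lemma om_gt0 : 0 < om.
Proof. by rewrite /om divr_gt0 // mulr_gt0 // pi_gt0. Qed.

Lemma ee_T j : ee om j T = 1.
Proof.
rewrite /ee mulrAC omT.
have nat_ (n : nat) : cis (2 * pi * n%:R : R) = 1.
  elim: n => [|n IH]; first by rewrite mulr0 cis0.
  have -> : 2 * pi * n.+1%:R = 2 * pi * n%:R + pi *+ 2 :> R.
    by rewrite -natr1 -mulr_natl; ring.
  by rewrite cisD IH mul1r /cis cos2pi sin2pi.
case: j => n; first by rewrite -pmulrn.
by rewrite NegzE intrN -pmulrn mulrN cisN nat_ conjc1.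
Qed.

Lemma ee_periodic j : periodicC (ee om j).
Proof.
move=> t; rewrite -[RHS]mulr1 -(ee_T j) /ee -cisD; congr cis; ring.
Qed.

Definition mean f : C := (T^-1)%:C%C * prim f T.

Lemma meanD f g : contC f -> contC g -> mean (fun t => f t + g t) = mean f + mean g.
Proof. by move=> hf hg; rewrite /mean primD // mulrDr. Qed.

Lemma meanZ c f : contC f -> mean (fun t => c * f t) = c * mean f.
Proof. by move=> hf; rewrite /mean primZ // mulrCA. Qed.

Lemma mean_sum (I : Type) (r : seq I) (F : I -> R -> C) : (forall i, contC (F i)) ->
  mean (fun t => \sum_(i <- r) F i t) = \sum_(i <- r) mean (F i).
Proof. by move=> h; rewrite /mean prim_sum // mulr_sumr. Qed.

Lemma nm_mean f (B : R) : contC f -> (forall t, nm (f t) <= B) -> nm (mean f) <= B.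
Proof.
move=> cf h; rewrite /mean nmM nm_real ger0_norm ?invr_ge0 ?(ltW T0) // mulrC ler_pdivrMr //.
exact: prim_bound (ltW T0) _.
Qed.

Lemma mean_Df f f' : Df f f' -> contC f' -> f T = f 0 -> mean f' = 0.
Proof. by move=> hf cf E; rewrite /mean (prim_unique _ hf) E subrr mulr0. Qed.

Lemma mean_ee j : mean (ee om j) = if j == 0 then 1 else 0.
Proof.
case: eqVneq => [->|j0].
  have D : Df (fun t => t%:C%C) (ee om 0).
    move=> t; split; first by apply: isd_eq (is_derive_id _ _) _ _ => //; rewrite ee0.
    by apply: isd_eq (is_derive_cst 0 _ _) _ _ => //; rewrite ee0.
  by rewrite /mean (prim_unique _ D) subr0 -rmorphM mulVf // gt_eqF.
have i0 : iom om j != 0.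
  rewrite /iom mulf_neq0 //; first by rewrite eq_complex /= eqxx oner_eq0.
  by rewrite (inj_eq (@complexI R)) mulf_neq0 ?intr_eq0 // gt_eqF // om_gt0.
have := mean_Df (DfZ (iom om j)^-1 (Df_ee om j)) _ _.
rewrite ee_T ee_0 => <- //; last by do 2 apply: contCZ; exact: contC_ee.
by congr mean; apply/funext => t; rewrite mulKf.
Qed.

Definition trig (F : seq (int * C)) t : C := \sum_(x <- F) x.2 * ee om x.1 t.

Lemma contC_trig F : contC (trig F).
Proof. by apply: (@contC_sum R _ F xpredT (fun x t => x.2 * ee om x.1 t)) => x; exact/contCZ/contC_ee. Qed.

(** [k0 t] is the square of [cos (om * t / 2)]. Its normalised powers are the de la Vallee Poussin
    kernels: nonnegative trigonometric polynomials concentrating at the multiples of [T]. *)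
Let k0 t : R := (1 + cos (om * t)) / 2.

Let k0_ge0 t : 0 <= k0 t.
Proof. by rewrite /k0; have := cos_geN1 (om * t); lra. Qed.

Lemma kernel_trig n : exists F, forall t, (k0 t ^+ n)%:C%C = trig F t.
Proof.
elim: n => [|n [F hF]].
  by exists [:: (0, 1)] => t; rewrite /trig big_seq1 /= ee0 mul1r expr0.
exists ([seq (x.1, 2^-1 * x.2) | x <- F] ++ [seq (x.1 + 1, 4^-1 * x.2) | x <- F] ++
  [seq (x.1 - 1, 4^-1 * x.2) | x <- F]) => t.
rewrite exprS rmorphM /= hF /trig !big_cat /= !big_map /=.
have -> : (k0 t)%:C%C = 2^-1 + 4^-1 * ee om 1 t + 4^-1 * ee om (- 1) t.
  by apply: complex_eq; rewrite /k0 eeN /ee mulr1 /cis; simpc => /=; field.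
rewrite !mulrDl !mulr_sumr -addrA; congr (_ + _); [|congr (_ + _)];
  apply: eq_bigr => x _; rewrite ?eeD; ring.
Qed.

Theorem trig_density f (e : R) : contC f -> periodicC f -> 0 < e ->
  exists F, forall t, nm (f t - trig F t) <= e.
Proof.
move=> cf pf e0; have e2 : 0 < e / 2 by lra.
have [d' d'0 hd'] := heine_periodic cf pf e2.
have [B B0 hB] := periodic_bounded cf pf.
pose d := Num.min d' (T / 2).
have d0 : 0 < d by rewrite lt_min d'0 divr_gt0.
have dT : d <= T / 2 by rewrite ge_min lexx orbT.
have o0 := om_gt0.
have in_pi x : 0 <= x -> x <= T / 2 -> om * x \in `[0, pi].
  move=> x0 xT; rewrite in_itv /= mulr_ge0 ?(ltW o0) //=.
  have := omT; have : om * x <= om * (T / 2) by rewrite ler_wpM2l // ltW.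
  lra.
(* [r1] bounds [k0] from above at distance at least [d] from the multiples of [T], and [r2] from
   below at distance at most [d / 2]. As [r1 < r2], high powers make the outer mass negligible
   against the mean [kap]. *)
pose r1 := k0 d; pose r2 := k0 (d / 2).
have r12 : r1 < r2.
  rewrite /r1 /r2 /k0 ltr_pM2r ?invr_gt0 // ltrD2l ltr_cos ?in_pi //; try lra.
  by rewrite ltr_pM2l //; lra.
have r10 : 0 <= r1 by exact: k0_ge0.
have r20 : 0 < r2 by lra.
have rr : `|r1 / r2| < 1 by rewrite ger0_norm ?divr_ge0 ?(ltW r20) // ltr_pdivrMr ?mul1r.
have [n hn] : exists n, (2 * B * T / (d / 2)) * (r1 / r2) ^+ n <= e / 2.
  have : (fun n => (2 * B * T / (d / 2)) * (r1 / r2) ^+ n) @ \oo --> (2 * B * T / (d / 2)) * 0.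
    by apply: cvgMr; exact: cvg_expr.
  rewrite mulr0 => /cvgrPdist_le /(_ _ e2) [n _ /(_ n (leqnn n))] /=.
  rewrite sub0r normrN => h; exists n; exact: le_trans (ler_norm _) h.
have [F hF] := kernel_trig n.
have K0 t : 0 <= k0 t ^+ n by rewrite exprn_ge0.
pose kap := Re (mean (trig F)).
have flipE t s : trig F (t - s) = \sum_(x <- F) x.2 * ee om x.1 t * ee om (- x.1) s.
  apply: eq_bigr => x _; rewrite -mulrA; congr (_ * _).
  by rewrite /ee -cisD intrN; congr cis; ring.
have cflip t : contC (fun s => trig F (t - s)).
  apply: contC_comp (contC_trig F) _ => s; apply: cvgB; [exact: cvg_cst|exact: cvg_id].
have mflip t : mean (fun s => trig F (t - s)) = mean (trig F).
  have -> : (fun s => trig F (t - s)) = (fun s => \sum_(x <- F) x.2 * ee om x.1 t * ee om (- x.1) s).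
    by apply/funext => s; rewrite flipE.
  rewrite mean_sum => [|x]; last exact/contCZ/contC_ee.
  rewrite (@mean_sum _ F (fun x t => x.2 * ee om x.1 t)) => [|x]; last exact/contCZ/contC_ee.
  apply: eq_bigr => x _; rewrite !meanZ ?mean_ee; [|exact: contC_ee|exact: contC_ee].
  by rewrite oppr_eq0; case: eqVneq => [->|_]; rewrite ?mulr0 // ee0 mulr1.
have W t : is_derive t 1 (fun s => Re (prim (trig F) s)) (k0 t ^+ n).
  by have [h _] := Df_prim (contC_trig F) t; rewrite -hF in h.
have kapE : kap = Re (prim (trig F) T) / T.
  by rewrite /kap /mean cReM /= mul0r subr0 mulrC.
have kap_ge : (d / 2) * r2 ^+ n / T <= kap.
  rewrite kapE ler_wpM2r ?invr_ge0 ?(ltW T0) //.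
  have h1 : Re (prim (trig F) (d / 2)) <= Re (prim (trig F) T) by apply: (isd_le W) => //; lra.
  apply: le_trans h1.
  have : (fun s => Re (prim (trig F) s) - s * r2 ^+ n) 0 <= (fun s => Re (prim (trig F) s) - s * r2 ^+ n) (d / 2).
    apply: (@isd_le R (fun s => Re (prim (trig F) s) - s * r2 ^+ n) (fun s => k0 s ^+ n - r2 ^+ n)); last by lra.
      move=> s; apply: isd_eq (isdB (W s) (isdM (is_derive_id _ _) (is_derive_cst (r2 ^+ n) _ _))) _ _ => //.
      by rewrite mul1r mulr0 addr0.
    move=> s /andP[s0 sd]; rewrite subr_ge0; apply: lerXn2r; rewrite ?nnegrE ?(ltW r20) //.
    have hs : s <= T / 2 by lra.
    rewrite /r2 /k0 ler_pM2r ?invr_gt0 // lerD2l leNgt ltr_cos ?in_pi // -?leNgt; try lra.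
    by rewrite ler_pM2l.
  by rewrite prim0 ?mul0r ?subr0 //=; [lra|exact: contC_trig].
have kap0 : 0 < kap by apply: lt_le_trans kap_ge; rewrite !mulr_gt0 ?invr_gt0 ?exprn_gt0.
(* Coefficients of the convolution of [f] with the kernel divided by its mean [kap]. *)
pose G := [seq (x.1, kap^-1%:C%C * (x.2 * mean (fun s => f s * ee om (- x.1) s))) | x <- F].
exists G => t.
have GE : trig G t = kap^-1%:C%C * mean (fun s => f s * trig F (t - s)).
  have -> : (fun s => f s * trig F (t - s)) = (fun s => \sum_(x <- F) (x.2 * ee om x.1 t) * (f s * ee om (- x.1) s)).
    by apply/funext => s; rewrite flipE mulr_sumr; apply: eq_bigr => x _; ring.
  have ch (x : int * C) : contC (fun s => f s * ee om (- x.1) s) by apply: contCM => //; exact: contC_ee.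
  rewrite mean_sum => [|x]; last exact/contCZ.
  rewrite /trig big_map mulr_sumr; apply: eq_bigr => x _ /=; rewrite meanZ //; ring.
have mreal : mean (trig F) = kap%:C%C.
  rewrite /kap; apply: complex_eq => //=.
  suff : Im (prim (trig F) T) = 0 by rewrite /mean cImM /= => ->; rewrite mulr0 mul0r addr0.
  have D0 s : is_derive s 1 (fun s => Im (prim (trig F) s)) 0.
    by have [_ h] := Df_prim (contC_trig F) s; rewrite -hF in h.
  have := @is_derive_0_is_cst R (fun s => Im (prim (trig F) s)) T 0 D0.
  by rewrite prim0 //; exact: contC_trig.
have cft : contC (fun s => (f t - f s) * trig F (t - s)).
  by apply: contCM => //; apply: contCB => //; exact: contC_cst.
have -> : f t - trig G t = kap^-1%:C%C * mean (fun s => (f t - f s) * trig F (t - s)).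
  have -> : mean (fun s => (f t - f s) * trig F (t - s)) = f t * kap%:C%C - mean (fun s => f s * trig F (t - s)).
    rewrite -mreal -(mflip t) -meanZ // -mulN1r -meanZ; last exact: contCM.
    rewrite -meanD; [|exact: contCZ|by apply: contCZ; exact: contCM].
    by congr mean; apply/funext => s; ring.
  have kk : kap^-1%:C%C * kap%:C%C = 1 :> C by rewrite -rmorphM mulVf ?gt_eqF.
  by rewrite GE mulrBr [_ * (f t * _)]mulrCA kk mulr1.
(* For [t - s] near a multiple of [T] the oscillation of [f] is small, elsewhere the kernel is. The
   sum of both bounds is a majorant in [s] with an explicit primitive, as [Df_bound] requires. The
   integer [m] brings [t - s] into [[- T / 2, T / 2]]. *)
have bnd s : nm ((f t - f s) * trig F (t - s)) <= e / 2 * k0 (t - s) ^+ n + 2 * B * r1 ^+ n.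
  rewrite -hF nmM nm_real ger0_norm //.
  pose m := Num.floor ((t - s) / T + 2^-1).
  have h1 : - (T / 2) <= t - s - m%:~R * T <= T / 2.
    have := ge_floor ((t - s) / T + 2^-1); rewrite -/m -lerBlDr ler_pdivlMr // mulrBl => h1.
    have := ltW (floorD1_gt ((t - s) / T + 2^-1)); rewrite -/m -lerBrDr ler_pdivrMr // intrD mulrBl mulrDl => h2.
    by apply/andP; split; lra.
  have fE : f s = f (s + m%:~R * T) by rewrite periodic_int.
  have kE : k0 (t - s) = k0 `|t - s - m%:~R * T|.
    rewrite /k0; congr ((1 + _) / 2).
    have -> : om * `|t - s - m%:~R * T| = `|om * (t - s - m%:~R * T)|.
      by rewrite normrM (gtr0_norm o0).
    rewrite cos_norm; have := @periodic_int (ee om 1) (- m) (t - s) (ee_periodic 1).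
    rewrite /ee /cis mulr1z !mulr1 => -[<- _]; rewrite intrN mulNr; congr cos; ring.
  set x := `|t - s - m%:~R * T| in kE *.
  have xT : x <= T / 2 by rewrite ler_norml.
  have x0 : 0 <= x by rewrite normr_ge0.
  have [xd|xd] := ltP x d.
    have : nm (f t - f s) < e / 2.
      rewrite nmB fE nmB; apply: hd'; rewrite opprD addrA.
      by apply: lt_le_trans xd _; rewrite ge_min lexx.
    move=> /ltW h; apply: (@le_trans _ _ (e / 2 * k0 (t - s) ^+ n)); first by rewrite ler_wpM2r.
    by rewrite lerDl !mulr_ge0 ?exprn_ge0.
  apply: (@le_trans _ _ (2 * B * r1 ^+ n)); last by rewrite lerDr mulr_ge0 ?(ltW e2).
  apply: ler_pM; rewrite ?nm_ge0 //.
    by apply: le_trans (nmD _ _) _; rewrite nmN; have := hB t; have := hB s; lra.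
  apply: lerXn2r; rewrite ?nnegrE // kE /r1 /k0.
  rewrite ler_pM2r ?invr_gt0 // lerD2l leNgt ltr_cos ?in_pi ?(ltW d0) // -leNgt.
  by rewrite ler_pM2l.
have Wt s : is_derive s 1 (fun s => e / 2 * Re (prim (fun s => trig F (t - s)) s) + s * (2 * B * r1 ^+ n))
    (e / 2 * k0 (t - s) ^+ n + 2 * B * r1 ^+ n).
  have [h _] := Df_prim (cflip t) s; rewrite -hF in h.
  apply: isd_eq (isdD (isdM (is_derive_cst (e / 2) _ _) h) (isdM (is_derive_id _ _) (is_derive_cst (2 * B * r1 ^+ n) _ _))) _ _ => //=.
  by rewrite mul0r add0r mul1r mulr0 addr0.
have := Df_bound (Df_prim cft) Wt (ltW T0) (fun s _ => bnd s).
rewrite !prim0 // subr0 mulr0 mul0r addr0 subr0 => H.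
rewrite nmM nm_real ger0_norm ?invr_ge0 ?(ltW kap0) // mulrC ler_pdivrMr //.
rewrite /mean nmM nm_real ger0_norm ?invr_ge0 ?(ltW T0) // mulrC ler_pdivrMr //.
apply: le_trans H _.
have -> : Re (prim (fun s => trig F (t - s)) T) = kap * T.
  have := mflip t; rewrite mreal {1}/mean => h.
  have -> : prim (fun s => trig F (t - s)) T = (kap * T)%:C%C.
    by rewrite rmorphM /= -h mulrAC -rmorphM mulVf ?gt_eqF // mul1r.
  by [].
have hr : 2 * B * r1 ^+ n <= e / 2 * kap.
  apply: (@le_trans _ _ ((2 * B * T / (d / 2)) * (r1 / r2) ^+ n * ((d / 2) * r2 ^+ n / T))).
    have fl (u v D S : R) : v != 0 -> D != 0 -> S != 0 ->
        2 * B * u = 2 * B * S / (D / 2) * (u / v) * ((D / 2) * v / S).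
      by move=> v0 D0 S0; field; rewrite v0 D0 S0.
    by rewrite [(r1 / r2) ^+ n]expr_div_n -fl // gt_eqF // exprn_gt0.
  apply: ler_pM => //; rewrite !mulr_ge0 ?invr_ge0 ?exprn_ge0 ?divr_ge0 ?(ltW r20) ?(ltW T0) ?(ltW d0) //.
have := ler_wpM2r (ltW T0) hr; lra.
Qed.

End TrigDensity.

(** * Fourier coefficients, Parseval and Cauchy-Schwarz on a period *)

Section Parseval.
Variables (R : realType) (T : R).
Local Notation C := R[i].
Local Notation Re := complex.Re.
Local Notation om := (2 * pi / T).
Local Notation e_ := (ee om).
Local Notation avg := (mean T).
Implicit Types (f g v : R -> C) (t : R) (j k : int) (a : int -> C).

Lemma psum_delta (V : zmodType) (x : V) k n :
  psum (fun j => if j == k then x else 0) n = if (`|k| <= n)%N then x else 0.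
Proof.
elim: n => [|n IH].
  by rewrite psum0 leqn0 absz_eq0 eq_sym.
rewrite psumS IH; case: (ltngtP `|k|%N n.+1) => h.
- by rewrite -ltnS h !ifN ?addr0 //; apply/eqP; lia.
- by rewrite leqNgt ltnW //= !ifN ?addr0 //; apply/eqP; lia.
- rewrite leqNgt h ltnSn /= add0r; have [kE|kE] : k = n.+1 \/ k = - n.+1%:Z by lia.
    by rewrite -kE eqxx ifN ?addr0 //; apply/eqP; lia.
  by rewrite -kE eqxx ifN ?add0r //; apply/eqP; lia.
Qed.

Lemma trig_psum (F : seq (int * C)) : exists a n, (forall j, (n < `|j|)%N -> a j = 0) /\
  forall m t, (n <= m)%N -> trig T F t = psum (fun j => a j * e_ j t) m.
Proof.
elim: F => [|[k c] F [a [n [an IH]]]].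
  exists (fun=> 0), 0%N; split=> // m t _; rewrite /trig big_nil.
  by elim: m => [|m IH]; rewrite ?psum0 ?psumS -?IH ?mul0r ?addr0.
exists (fun j => a j + if j == k then c else 0), (maxn n `|k|); split.
  move=> j; rewrite gtn_max => /andP[nj kj]; rewrite an // add0r ifN //.
  by apply: contraTneq kj => ->; rewrite ltnn.
move=> m t; rewrite geq_max => /andP[nm km].
rewrite /trig big_cons /= -/(trig T F t) (IH m t nm) addrC.
rewrite [RHS](eq_psum _ (b := fun j => a j * e_ j t + (if j == k then c * e_ k t else 0))).
  by rewrite psumD psum_delta km.
by move=> j; rewrite mulrDl; congr (_ + _); case: eqVneq => [->|_] //; rewrite mul0r.
Qed.

Lemma finite_dec a n : (forall j, (n < `|j|)%N -> a j = 0) -> exists A, dec A a.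
Proof.
move=> an; exists (psum (fun j => nm (a j) / wt j) n) => j.
have p0 i : 0 <= nm (a i) / wt i by rewrite mulr_ge0 ?nm_ge0 // invr_ge0 wt_ge0.
have [jn|nj] := leqP `|j|%N n; last by rewrite an // nm0 mulr_ge0 ?wt_ge0 // psum_ge0.
rewrite -ler_pdivrMr ?wt_gt0 //.
have := @le_psum R (fun i => if i == j then nm (a j) / wt j else 0) (fun i => nm (a i) / wt i) n _.
by rewrite psum_delta jn; apply => i; case: eqVneq => [->|_].
Qed.

Hypothesis T0 : 0 < T.

Lemma conjM (z w : C) : (z * w)^*%C = z^*%C * w^*%C. Proof. exact: rmorphM. Qed.
Lemma conjD (z w : C) : (z + w)^*%C = z^*%C + w^*%C. Proof. exact: rmorphD. Qed.
Lemma conjB (z w : C) : (z - w)^*%C = z^*%C - w^*%C. Proof. exact: rmorphB. Qed.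

Lemma Re2 : Re (2 : C) = 2. Proof. by rewrite -[2]/(1 + 1) cReD. Qed.
Lemma Im2 : complex.Im (2 : C) = 0. Proof. by rewrite -[2]/(1 + 1) cImD /= addr0. Qed.

Lemma contC_psum_ee a n : contC (fun t => psum (fun j => a j * e_ j t) n).
Proof. by apply: (@psum_contC R (fun j t => a j * e_ j t)) => j; exact/contCZ/contC_ee. Qed.

Lemma avg_psum (F : int -> R -> C) n : (forall j, contC (F j)) ->
  avg (fun t => psum (F^~ t) n) = psum (fun j => avg (F j)) n.
Proof.
move=> h; elim: n => [|n IH].
  by rewrite psum0; congr avg; apply/funext => t; rewrite psum0.
have c1 := psum_contC n h; have c2 := contCD (h n.+1) (h (- n.+1%:Z)).
rewrite psumS -IH -(meanD T (h n.+1)) // -(meanD T c1) //.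
by congr avg; apply/funext => t; rewrite psumS.
Qed.

Lemma avg_ext f g : (forall t, f t = g t) -> avg f = avg g.
Proof. by move=> /funext ->. Qed.

Lemma avgB f g : contC f -> contC g -> avg (fun t => f t - g t) = avg f - avg g.
Proof.
move=> hf hg; rewrite -mulN1r -(meanZ _ (-1) hg) -meanD //; last exact: contCZ.
by apply: avg_ext => t; rewrite mulN1r.
Qed.

Lemma avg_ge0 f : contC f -> (forall t, 0 <= Re (f t)) -> 0 <= Re (avg f).
Proof.
move=> cf h; rewrite /mean cReM /= mul0r subr0 mulr_ge0 ?invr_ge0 ?(ltW T0) //.
have := @isd_le R (fun t => Re (prim f t)) (fun t => Re (f t)) 0 T _ (fun t _ => h t) (ltW T0).
rewrite prim0 //; apply => t; by case: (Df_prim cf t).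
Qed.

Lemma avg_conj f : contC f -> avg (fun t => (f t)^*%C) = (avg f)^*%C.
Proof.
move=> cf; rewrite /mean primJ // conjM; congr (_ * _).
by apply: complex_eq; rewrite /= ?oppr0.
Qed.

Definition four v j : C := avg (fun t => v t * e_ (- j) t).
Definition energy v : R := Re (avg (fun t => v t * (v t)^*%C)).

Lemma contC_sq v : contC v -> contC (fun t => v t * (v t)^*%C).
Proof. by move=> cv; apply: contCM => //; exact: contCJ. Qed.

(** After expansion of the square, the two sides differ by the sum of the squared moduli of
    [four v j - a j]. *)
Lemma bessel v a n : contC v ->
  energy v - psum (fun j => nm (four v j) ^+ 2) n <=
  energy (fun t => v t - psum (fun j => a j * e_ j t) n).
Proof.
move=> cv; pose P t := psum (fun j => a j * e_ j t) n.
have cP : contC P := contC_psum_ee a n.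
have cPj : contC (fun t => (P t)^*%C) := contCJ cP.
have PJ t : (P t)^*%C = psum (fun j => (a j)^*%C * e_ (- j) t) n.
  rewrite /P; elim: (n) => [|m IH]; first by rewrite !psum0 conjM -eeN.
    by rewrite !psumS conjD IH conjD !conjM -!eeN.
have avgP f : contC f -> avg (fun t => f t * (P t)^*%C) = psum (fun j => (a j)^*%C * four f j) n.
  move=> cf; rewrite (@avg_ext _ (fun t => psum (fun j => (a j)^*%C * (f t * e_ (- j) t)) n)).
    rewrite (@avg_psum (fun j t => (a j)^*%C * (f t * e_ (- j) t))) => [|j].
      by apply: eq_psum => j; rewrite meanZ //; apply: contCM => //; exact: contC_ee.
    by apply: contCZ; apply: contCM => //; exact: contC_ee.
  by move=> t; rewrite PJ -psumZ; apply: eq_psum => j; ring.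
have fourP j : (`|j| <= n)%N -> four P j = a j.
  move=> jn; rewrite /four (@avg_ext _ (fun t => psum (fun i => a i * e_ (i - j) t) n)).
    rewrite (@avg_psum (fun i t => a i * e_ (i - j) t)) => [|i]; last exact/contCZ/contC_ee.
    rewrite (eq_psum _ (b := fun i => if i == j then a j else 0)) ?psum_delta ?jn // => i.
    rewrite meanZ ?mean_ee //; last exact: contC_ee.
    by rewrite subr_eq0; case: eqVneq => [->|]; rewrite ?mulr1 ?mulr0.
  by move=> t; rewrite mulrC /P -psumZ; apply: eq_psum => i; rewrite eeD; ring.
have E1 : avg (fun t => v t * (P t)^*%C) = psum (fun j => (a j)^*%C * four v j) n by exact: avgP.
have E2 : avg (fun t => P t * (P t)^*%C) = psum (fun j => (a j)^*%C * a j) n.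
  rewrite avgP //.
  suff : forall m, (m <= n)%N -> psum (fun j => (a j)^*%C * four P j) m = psum (fun j => (a j)^*%C * a j) m by exact.
  elim=> [|m IH] mn; first by rewrite !psum0 fourP.
  by rewrite !psumS IH ?fourP ?abszN // ltnW.
have E3 : energy (fun t => v t - P t) =
  energy v - 2 * Re (avg (fun t => v t * (P t)^*%C)) + Re (avg (fun t => P t * (P t)^*%C)).
  have -> : avg (fun t => v t * (P t)^*%C) = (avg (fun t => P t * (v t)^*%C))^*%C.
    rewrite -avg_conj; last by apply: contCM => //; exact: contCJ.
    by apply: avg_ext => t; rewrite conjM conjcK mulrC.
  rewrite cReJ.
  have c1 := contC_sq cv; have c2 : contC (fun t => P t * (v t)^*%C) by apply: contCM => //; exact: contCJ.
  have c3 : contC (fun t => v t * (P t)^*%C) by exact: contCM.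
  have c4 : contC (fun t => P t * (P t)^*%C) by exact: contCM.
  have -> : energy (fun t => v t - P t) = Re (avg (fun t => v t * (v t)^*%C) - avg (fun t => v t * (P t)^*%C)
     - avg (fun t => P t * (v t)^*%C) + avg (fun t => P t * (P t)^*%C)).
    rewrite -avgB // -avgB //; last exact: contCB.
    rewrite -meanD //; last by apply: contCB => //; exact: contCB.
    by congr Re; apply: avg_ext => t; rewrite conjB; ring.
  have -> : avg (fun t => v t * (P t)^*%C) = (avg (fun t => P t * (v t)^*%C))^*%C.
    rewrite -avg_conj //; apply: avg_ext => t; by rewrite conjM conjcK mulrC.
  by rewrite cReD !cReB cReJ /energy; ring.
rewrite -/P E3 E1 E2 -addrA lerD2l.
elim: {avgP PJ fourP E1 E2 E3 cPj cP P}n => [|n IH].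
  rewrite !psum0 nm_sqr; case: (a 0) (four v 0) => [x y] [z w]; simpc => /=.
  by have := sqr_ge0 (x - z); have := sqr_ge0 (y - w); nra.
have st j : - nm (four v j) ^+ 2 <= - (2 * Re ((a j)^*%C * four v j)) + Re ((a j)^*%C * a j).
  rewrite nm_sqr; case: (a j) (four v j) => [x y] [z w]; simpc => /=.
  by have := sqr_ge0 (x - z); have := sqr_ge0 (y - w); nra.
have ReD3 (x y z : C) : Re (x + (y + z)) = Re x + (Re y + Re z) by rewrite !cReD.
rewrite !psumS !ReD3; have := st n.+1%:Z; have := st (- n.+1%:Z); move: IH; lra.
Qed.

Lemma energy_ge0 v : contC v -> 0 <= energy v.
Proof.
move=> cv; apply: avg_ge0 => [|t]; first exact: contC_sq.
by rewrite Re_mul_conj exprn_ge0 ?nm_ge0.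
Qed.

Lemma energy_small v (e : R) : contC v -> (forall t, nm (v t) <= e) -> energy v <= e ^+ 2.
Proof.
move=> cv h; apply: le_trans (ler_norm _) _; apply: le_trans (Re_le_nm _) _.
apply: nm_mean => // [|t]; first exact: contC_sq.
rewrite nmM nmJ expr2; have := h t; have := nm_ge0 (v t); nra.
Qed.

(** The completeness half of Parseval: uniform approximation by trigonometric polynomials makes the
    right-hand side of [bessel] as small as desired. *)
Lemma energy_le_four v (X : R) : contC v -> periodicC T v ->
  (forall n, psum (fun j => nm (four v j) ^+ 2) n <= X) -> energy v <= X.
Proof.
move=> cv pv hX; apply/ler_addgt0Pr => d d0.
have s0 : 0 < Num.sqrt d by rewrite sqrtr_gt0.
have [F hF] := trig_density T0 cv pv s0.
have [a [n [_ hn]]] := trig_psum F.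
have H : energy (fun t => v t - psum (fun j => a j * e_ j t) n) <= Num.sqrt d ^+ 2.
  apply: energy_small => [|t]; first by apply: contCB => //; exact: contC_psum_ee.
  by rewrite -hn.
rewrite sqr_sqrtr ?(ltW d0) // in H.
have := bessel a n cv; have := hX n; lra.
Qed.

Lemma energy0 v : contC v -> periodicC T v -> energy v <= 0 -> forall t, v t = 0.
Proof.
move=> cv pv e0.
have key t : 0 <= t <= T -> v t = 0.
  move=> ht; apply/eqP; apply: contraTT e0 => vt0; rewrite -ltNge.
  have cs := contC_sq cv.
  rewrite /energy /mean cReM /= mul0r subr0 mulr_gt0 ?invr_gt0 //.
  pose W s := Re (prim (fun t => v t * (v t)^*%C) s).
  have dW (s : R) : is_derive s 1 W (nm (v s) ^+ 2).
    by have [h _] := Df_prim cs s; rewrite Re_mul_conj in h.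
  have W0 : W 0 = 0 by rewrite /W prim0.
  have W_mono (a b : R) : a <= b -> W a <= W b.
    by move=> ab; apply: (isd_le dW) => // s _; rewrite exprn_ge0 ?nm_ge0.
  have vpos : 0 < nm (v t) / 2 by rewrite divr_gt0 // nm_gt0.
  have /contC_epsP/(_ t _ vpos)[d d0 hd] := cv.
  pose d1 := Num.min (d / 2) (T / 2).
  have d10 : 0 < d1 by rewrite lt_min !divr_gt0.
  have d1d : d1 < d by rewrite gt_min; apply/orP; left; lra.
  have d1T : d1 <= T / 2 by rewrite ge_min lexx orbT.
  have inc (a b : R) : 0 <= a -> a < b -> b <= T -> (forall s, a <= s <= b -> `|s - t| < d) -> 0 < W T.
    move=> a0 ab bT hs; rewrite -W0; apply: le_lt_trans (W_mono 0 a a0) _.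
    apply: lt_le_trans (W_mono b T bT); apply: (isd_lt dW) => // s /hs /hd h.
    rewrite exprn_gt0 //; have := nm_sub_le (v t) (v s); rewrite nmB; lra.
  have /andP[t0 tT] := ht.
  have [h|h] := leP t (T / 2).
    apply: (inc t (t + d1)); try lra.
    by move=> s /andP[h1 h2]; rewrite ger0_norm; lra.
  apply: (inc (t - d1) t); try lra.
  by move=> s /andP[h1 h2]; rewrite ler0_norm; lra.
move=> t; rewrite -(periodic_int (- Num.floor (t / T)) t pv); apply: key.
rewrite intrN mulNr.
have := ge_floor (t / T); rewrite ler_pdivlMr // => h1.
have := ltW (floorD1_gt (t / T)); rewrite ler_pdivrMr // intrD mulrDl mul1r => h2.
by apply/andP; split; lra.
Qed.

(* Cauchy-Schwarz on the period. *)
Lemma avg_nm_sq v1 v2 : contC v1 -> contC v2 -> exists U : R,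
  U ^+ 2 <= 2 * (energy v1 + energy v2) /\ forall f g (M : R), contC f -> contC g ->
  (forall t, nm (f t) <= M) -> (forall t, nm (g t) <= M) ->
  nm (avg (fun t => v1 t * f t + v2 t * g t)) <= M * U.
Proof.
move=> c1 c2; pose u t : R := nm (v1 t) + nm (v2 t).
have cu : contC (fun t => (u t)%:C%C).
  split; last by move=> t; exact: cvg_cst.
  by move=> t; apply: cvgD; exact: contC_nm.
pose U := Re (avg (fun t => (u t)%:C%C)).
exists U; split.
  have h : 0 <= Re (avg (fun t => ((u t)%:C%C - U%:C%C) * ((u t)%:C%C - U%:C%C))).
    apply: avg_ge0 => [|t]; first by apply: contCM; apply: contCB => //; exact: contC_cst.
    by rewrite -rmorphB -rmorphM /= -expr2 sqr_ge0.
  have cuu : contC (fun t => (u t)%:C%C * (u t)%:C%C) by exact: contCM.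
  have E : avg (fun t => ((u t)%:C%C - U%:C%C) * ((u t)%:C%C - U%:C%C)) =
    avg (fun t => (u t)%:C%C * (u t)%:C%C) - (2 * U%:C%C) * avg (fun t => (u t)%:C%C) + U%:C%C * U%:C%C.
    have avg1 (c : C) : avg (fun=> c) = c.
      rewrite -{1}[c]mulr1 meanZ; last exact: contC_cst.
      rewrite (@avg_ext (fun=> 1) (e_ 0)) => [|t]; last by rewrite ee0.
      by rewrite mean_ee // eqxx mulr1.
    rewrite -[U%:C%C * U%:C%C]avg1 -(meanZ _ _ cu) -avgB //; last exact: contCZ.
    rewrite -meanD; [|by apply: contCB => //; exact: contCZ|exact: contC_cst].
    by apply: avg_ext => t; ring.
  have h2 : Re (avg (fun t => (u t)%:C%C * (u t)%:C%C)) <= 2 * (energy v1 + energy v2).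
    have c3 := contC_sq c1; have c4 := contC_sq c2.
    rewrite -subr_ge0.
    have -> : 2 * (energy v1 + energy v2) - Re (avg (fun t => (u t)%:C%C * (u t)%:C%C)) =
      Re (avg (fun t => 2 * (v1 t * (v1 t)^*%C + v2 t * (v2 t)^*%C) - (u t)%:C%C * (u t)%:C%C)).
      rewrite avgB //; last by apply: contCZ; exact: contCD.
      rewrite meanZ; last exact: contCD.
      rewrite meanD // cReB [Re (2 * _)]cReM [Re (avg _ + avg _)]cReD /energy.
      by rewrite Re2 Im2 mul0r subr0.
    apply: avg_ge0 => [|t]; first by apply: contCB => //; apply: contCZ; exact: contCD.
    rewrite !mul_conj cReB [Re (2 * _)]cReM Re2 Im2 [Re (_%:C%C * _%:C%C)]cReM.
    rewrite /= mul0r mul0r !subr0.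
    rewrite /u; have := sqr_ge0 (nm (v1 t) - nm (v2 t)); nra.
  move: h; rewrite E cReD cReB [Re (2 * _ * _)]cReM [Re (2 * _)]cReM [complex.Im (2 * _)]cImM.
  rewrite [Re (_%:C%C * _%:C%C)]cReM Re2 Im2 /= -/U !(mul0r, mulr0, subr0, addr0); lra.
move=> f g M cf cg hf hg.
have c3 : contC (fun t => v1 t * f t + v2 t * g t) by apply: contCD; exact: contCM.
rewrite /mean nmM nm_real ger0_norm ?invr_ge0 ?(ltW T0) // mulrC ler_pdivrMr //.
have dW t : is_derive t 1 (fun s => M * Re (prim (fun t => (u t)%:C%C) s)) (M * u t).
  have [h _] := Df_prim cu t; apply: isd_eq (isdM (is_derive_cst M _ _) h) _ _ => //=.
  by rewrite mul0r add0r.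
have -> : M * U * T = M * Re (prim (fun t => (u t)%:C%C) T).
  by rewrite /U /mean cReM /= mul0r subr0; field; rewrite gt_eqF.
have H := Df_bound (Df_prim c3) dW (ltW T0).
rewrite !prim0 // !subr0 mulr0 subr0 in H; apply: H => t _.
apply: le_trans (nmD _ _) _; rewrite !nmM /u mulrDr ![M * _]mulrC.
by apply: lerD; rewrite ler_wpM2l ?nm_ge0.
Qed.

End Parseval.

(** * Killing fields *)

Section Killing.
Variable R : realType.
Local Notation C := R[i].
Implicit Types (q x y : R -> C) (lam mu : C) (t : R).

(* [(b0, b1, b2)] are the entries [(B_00 - B_11, B_01, B_10)] of a solution of [B' = [B, alpha]]. *)
Definition killing q lam b0 b1 b2 :=
  [/\ Df b0 (fun t => - ((q t)^*%C * b1 t + q t * b2 t)),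
      Df b1 (fun t => 2^-1 * (q t * b0 t) - 'i%C * lam * b1 t) &
      Df b2 (fun t => 2^-1 * ((q t)^*%C * b0 t) + 'i%C * lam * b2 t)].

(** Symmetric products of rows, read as trace-free matrices through the invariant symplectic form:
    the classical squared eigenfunctions. *)
Lemma killing_square q lam x y x' y' : row_sol q lam x y -> row_sol q lam x' y' ->
  killing q lam (fun t => x t * y' t + y t * x' t) (fun t => y t * y' t) (fun t => - (x t * x' t)).
Proof.
move=> [hx hy] [hx' hy']; split.
- by apply: (Df_eq (DfD (DfM hx hy') (DfM hy hx'))) => t; field.
- by apply: (Df_eq (DfM hy hy')) => t; field.
- by apply: (Df_eq (DfN (DfM hx hx'))) => t; field.
Qed.

Lemma killing_lin q lam a b c b0 b1 b2 c0 c1 c2 d0 d1 d2 :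
  killing q lam b0 b1 b2 -> killing q lam c0 c1 c2 -> killing q lam d0 d1 d2 ->
  killing q lam (fun t => a * b0 t + b * c0 t + c * d0 t) (fun t => a * b1 t + b * c1 t + c * d1 t)
    (fun t => a * b2 t + b * c2 t + c * d2 t).
Proof.
move=> [h0 h1 h2] [k0 k1 k2] [l0 l1 l2]; split.
- by apply: (Df_eq (DfD (DfD (DfZ a h0) (DfZ b k0)) (DfZ c l0))) => t; ring.
- by apply: (Df_eq (DfD (DfD (DfZ a h1) (DfZ b k1)) (DfZ c l1))) => t; ring.
- by apply: (Df_eq (DfD (DfD (DfZ a h2) (DfZ b k2)) (DfZ c l2))) => t; ring.
Qed.

Lemma killing_cont q lam b0 b1 b2 : killing q lam b0 b1 b2 -> [/\ contC b0, contC b1 & contC b2].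
Proof. by move=> [/Df_contC h0 /Df_contC h1 /Df_contC h2]. Qed.

(** The pairing is [tr (B C)] for trace-free matrices. As the trace form is invariant under
    commutators, only the difference of the two [alpha], a diagonal matrix, contributes to the
    derivative. *)
Lemma killing_pairing q lam mu b0 b1 b2 c0 c1 c2 :
  killing q lam b0 b1 b2 -> killing q mu c0 c1 c2 ->
  Df (fun t => 2^-1 * (b0 t * c0 t) + b1 t * c2 t + b2 t * c1 t)
     (fun t => 'i%C * (mu - lam) * (b1 t * c2 t - b2 t * c1 t)).
Proof.
move=> [h0 h1 h2] [k0 k1 k2].
by apply: (Df_eq (DfD (DfD (DfZ 2^-1 (DfM h0 k0)) (DfM h1 k2)) (DfM h2 k1))) => t; field.
Qed.

Lemma killing_orth (T : R) q lam mu b0 b1 b2 c0 c1 c2 :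
  killing q lam b0 b1 b2 -> killing q mu c0 c1 c2 -> lam != mu ->
  [/\ b0 T = b0 0, b1 T = b1 0 & b2 T = b2 0] -> [/\ c0 T = c0 0, c1 T = c1 0 & c2 T = c2 0] ->
  mean T (fun t => b1 t * c2 t - b2 t * c1 t) = 0.
Proof.
move=> hb hc lm [e0 e1 e2] [g0 g1 g2].
have [cb0 cb1 cb2] := killing_cont hb; have [cc0 cc1 cc2] := killing_cont hc.
have cw : contC (fun t => b1 t * c2 t - b2 t * c1 t) by apply: contCB; exact: contCM.
have := mean_Df (T := T) (killing_pairing hb hc) (contCZ _ cw).
rewrite e0 e1 e2 g0 g1 g2 => /(_ erefl); rewrite meanZ // => /eqP.
rewrite mulf_eq0 mulf_eq0 subr_eq0 [mu == lam]eq_sym (negPf lm) orbF => /orP[|/eqP //].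
by rewrite eq_complex /= eqxx oner_eq0.
Qed.

Lemma row_sol_unique q lam x1 y1 x2 y2 x y t : basis_rows q lam x1 y1 x2 y2 ->
  row_sol q lam x y -> x t = x 0 * x1 t + y 0 * x2 t /\ y t = x 0 * y1 t + y 0 * y2 t.
Proof.
move=> hb h; have det := basis_det t hb; have [h1 h2 [i1 j1] [i2 j2]] := hb.
have W f g : row_sol q lam f g -> x t * g t - y t * f t = x 0 * g 0 - y 0 * f 0.
  move=> hf; have D := Df_wronskian h hf.
  by apply: (@Df0_cst R (fun t => x t * g t - y t * f t)); apply: (Df_eq D) => s; rewrite subrr mulr0 mul0r.
have w1 := W _ _ h1; have w2 := W _ _ h2.
rewrite i1 j1 mulr0 mulr1 sub0r in w1; rewrite i2 j2 mulr1 mulr0 subr0 in w2.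
split; rewrite -[LHS]mulr1 -det.
  have -> : x t * (x1 t * y2 t - y1 t * x2 t) =
   (x t * y2 t - y t * x2 t) * x1 t - (x t * y1 t - y t * x1 t) * x2 t by ring.
  by rewrite w1 w2; ring.
have -> : y t * (x1 t * y2 t - y1 t * x2 t) =
   (x t * y2 t - y t * x2 t) * y1 t - (x t * y1 t - y t * x1 t) * y2 t by ring.
by rewrite w1 w2; ring.
Qed.

Lemma Df_shift f f' (T : R) : Df f f' -> Df (fun t => f (t + T)) (fun t => f' (t + T)).
Proof.
move=> h t; have [a b] := h (t + T).
have sh : is_derive t 1 (fun s => s + T) 1.
  by apply: isd_eq (isdD (is_derive_id _ _) (is_derive_cst T _ _)) _ _ => //; rewrite addr0.
split.
  by apply: isd_eq (@is_derive1_comp _ (fun s => complex.Re (f s)) (fun s => s + T) t _ _ a sh) _ _ => //; rewrite mulr1.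
by apply: isd_eq (@is_derive1_comp _ (fun s => complex.Im (f s)) (fun s => s + T) t _ _ b sh) _ _ => //; rewrite mulr1.
Qed.

(* The trace-free part of [F^-1 M F]: a periodic Killing field at every [lam]. *)
Section Floquet.
Variables (T : R) (q : R -> C) (lam : C) (x1 y1 x2 y2 : R -> C).
Hypotheses (pq : periodicC T q) (hb : basis_rows q lam x1 y1 x2 y2).
Let a := x1 T. Let b := y1 T. Let c := x2 T. Let d := y2 T.

Definition flo0 t := (a - d) * (x1 t * y2 t + y1 t * x2 t) + b * (x2 t * y2 t + y2 t * x2 t) +
  - c * (x1 t * y1 t + y1 t * x1 t).
Definition flo1 t := (a - d) * (y1 t * y2 t) + b * (y2 t * y2 t) + - c * (y1 t * y1 t).
Definition flo2 t := (a - d) * - (x1 t * x2 t) + b * - (x2 t * x2 t) + - c * - (x1 t * x1 t).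

Lemma flo_killing : killing q lam flo0 flo1 flo2.
Proof. by have [h1 h2 _ _] := hb; apply: killing_lin; exact: killing_square. Qed.

Lemma flo_init : [/\ flo0 0 = a - d, flo1 0 = b & flo2 0 = c].
Proof.
by have [_ _ [i1 j1] [i2 j2]] := hb; rewrite /flo0 /flo1 /flo2 i1 j1 i2 j2; split; ring.
Qed.

(** Uniqueness gives [F (t + T) = M F t], and [M] commutes with itself, so [F^-1 M F] returns after
    a period. Multiplication by the determinant 1 turns each claim into a polynomial identity. *)
Lemma flo_periodic : [/\ periodicC T flo0, periodicC T flo1 & periodicC T flo2].
Proof.
have [h1 h2 [i1 j1] [i2 j2]] := hb.
have sh x y : row_sol q lam x y -> row_sol q lam (fun t => x (t + T)) (fun t => y (t + T)).
  move=> [hx hy]; split; first by apply: (Df_eq (Df_shift T hx)) => t; rewrite pq.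
  by apply: (Df_eq (Df_shift T hy)) => t; rewrite pq.
have det : a * d - b * c = 1 := basis_det T hb.
have E1 t := row_sol_unique t hb (sh _ _ h1); have E2 t := row_sol_unique t hb (sh _ _ h2).
by split=> t; have /= [u1 v1] := E1 t; have /= [u2 v2] := E2 t;
  rewrite /flo0 /flo1 /flo2 ?u1 ?v1 ?u2 ?v2 !add0r -/a -/b -/c -/d;
  rewrite -[RHS]mulr1 -det; ring.
Qed.

(** The pairings of [X] with the three products of basis rows are constant; since [X] returns after
    a period, its initial value commutes with [M]. The conclusions are the minors expressing linear
    dependence of this value and the trace-free part of [M]. *)
Lemma flo_commute X0 X1 X2 : killing q lam X0 X1 X2 ->
  [/\ X0 T = X0 0, X1 T = X1 0 & X2 T = X2 0] ->
  [/\ (a - d) * X1 0 = b * X0 0, (a - d) * X2 0 = c * X0 0 & b * X2 0 = c * X1 0].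
Proof.
move=> hX [e0 e1 e2]; have [h1 h2 [i1 j1] [i2 j2]] := hb.
have det : a * d - b * c = 1 := basis_det T hb.
have P c0 c1 c2 : killing q lam c0 c1 c2 ->
    2^-1 * (X0 T * c0 T) + X1 T * c2 T + X2 T * c1 T = 2^-1 * (X0 0 * c0 0) + X1 0 * c2 0 + X2 0 * c1 0.
  move=> hc; have D := killing_pairing hX hc.
  by apply: (@Df0_cst R (fun t => 2^-1 * (X0 t * c0 t) + X1 t * c2 t + X2 t * c1 t)); apply: (Df_eq D) => s; rewrite subrr mulr0 mul0r.
have := P _ _ _ (killing_square h1 h1); have := P _ _ _ (killing_square h1 h2).
have := P _ _ _ (killing_square h2 h2); rewrite !e0 !e1 !e2 i1 j1 i2 j2 -/a -/b -/c -/d.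
move: (X0 0) (X1 0) (X2 0) => u v w E22 E12 E11.
have F11 : a * b * u - a * a * v + b * b * w + v = 0.
  by move/eqP: E11; rewrite -subr_eq0 => /eqP <-; field.
have F12 : 2^-1 * ((a * d + b * c) * u) - a * c * v + b * d * w - 2^-1 * u = 0.
  by move/eqP: E12; rewrite -subr_eq0 => /eqP <-; field.
have F22 : c * d * u - c * c * v + d * d * w - w = 0.
  by move/eqP: E22; rewrite -subr_eq0 => /eqP <-; field.
have det0 : 1 - (a * d - b * c) = 0 by rewrite det subrr.
(* Each minor is certified as an explicit linear combination of two of [F11], [F12], [F22] and of
   the determinant relation. *)
have e (z z' r1 r2 : C) (k1 k2 k3 : C) : z - z' = k1 * r1 + k2 * r2 + k3 * (1 - (a * d - b * c)) ->
    r1 = 0 -> r2 = 0 -> z = z'.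
  by move=> E ? ?; apply/eqP; rewrite -subr_eq0 E det0; apply/eqP; subst; ring.
split.
- by apply: (e _ _ _ _ b (- d) (a * v - 2^-1 * (b * u)) _ F12 F11); field.
- by apply: (e _ _ _ _ c (- a) (- (2^-1 * (c * u) + d * w)) _ F12 F22); field.
- by apply: (e _ _ _ _ a (- c) (2^-1 * (a * u) + b * w) _ F12 F11); field.
Qed.

End Floquet.

End Killing.

(** * Floquet solutions at the closed gaps *)

Section GapRows.
Variables (R : realType) (T : R) (q : R -> R[i]).
Local Notation C := R[i].
Local Notation Re := complex.Re.
Local Notation Im := complex.Im.
Hypothesis T0 : 0 < T.
Local Notation om := (2 * pi / T).
Local Notation e_ := (ee om).
Local Notation avg := (mean T).
Implicit Types (k j : int) (t : R).

Lemma evl_periodic (a : int -> C) : periodicC T (evl om a).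
Proof. by move=> t; apply: eq_zsum => j; rewrite ee_periodic. Qed.

Lemma wt_tail (e : R) : 0 < e -> exists N1, forall N n, (N1 <= N)%N ->
  psum (fun j => if (N < `|j|)%N then wt j else 0 : R) n <= e.
Proof.
move=> e0; have e2 : 0 < e / 2 by lra.
have [N1 hN1] := zsum_unif (@wt_ge0 R) (@psum_wt0 R) e2.
exists N1 => N n NN; have e00 := ltW e0.
have small m : (m <= N)%N -> psum (fun j => if (N < `|j|)%N then wt j else 0 : R) m = 0.
  elim: m => [|m IH] mN; first by rewrite psum0.
  by rewrite psumS IH ?(ltnW mN) // abszN !absz_nat ltnNge mN addr0 addr0.
have big m : psum (fun j => if (N < `|j|)%N then wt j else 0 : R) (N + m) = psum wt (N + m) - psum wt N.
  elim: m => [|m IH]; first by rewrite addn0 subrr small.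
  by rewrite addnS !psumS IH abszN !absz_nat ltnS leq_addr; ring.
have [nN|Nn] := leqP n N; first by rewrite small.
rewrite -(subnKC (ltnW Nn)) big.
pose a j : C := (wt j)%:C%C.
have ha j : nm (a j) <= wt j by rewrite nm_real ger0_norm ?wt_ge0.
have aE m : psum a m = (psum wt m)%:C%C.
  by elim: m => [|m IH]; rewrite ?psum0 // !psumS IH !rmorphD.
have h1 := hN1 N a NN ha.
have h2 := hN1 (N + (n - N))%N a (leq_trans NN (leq_addr _ _)) ha.
have := nmD (psum a (N + (n - N)) - zsum a) (zsum a - psum a N); rewrite subrKA (nmB (zsum a)) => h3.
have : nm (psum a (N + (n - N)) - psum a N) <= e by lra.
have -> : psum a (N + (n - N)) - psum a N = (psum wt (N + (n - N)) - psum wt N)%:C%C.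
  by rewrite !aE rmorphB.
by rewrite nm_real; apply: le_trans (ler_norm _).
Qed.

(* [(h, g)] is the periodic factor of a Floquet solution at [om k + e], up to the phase [cis (om k t / 2)]. *)
Definition gap_pair k (e : C) (h g : R -> C) :=
  Df h (fun t => 2^-1 * ('i%C * e * h t - (q t)^*%C * g t)) /\
  Df g (fun t => 2^-1 * (q t * h t - 'i%C * e * g t) - iom om k * g t).

(** For odd [k] the phase is periodic only up to sign; just moduli and products of two phases
    matter, and these are periodic. *)
Let ph k t : C := cis (om * k%:~R / 2 * t).

Lemma ph_sq k t : ph k t * ph k t = e_ k t.
Proof. by rewrite /ph /ee -cisD; congr cis; field; rewrite gt_eqF. Qed.

Lemma gap_row k e h g : gap_pair k e h g ->
  row_sol q ((om * k%:~R)%:C%C + e) (fun t => h t * ph k t) (fun t => g t * ph k t).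
Proof.
move=> [hh hg].
have E : 'i%C * (om * k%:~R / 2)%:C%C = 2^-1 * iom om k :> C.
  have -> : (2^-1 : C) = (2^-1 : R)%:C%C by rewrite fmorphV rmorph_nat.
  by rewrite /iom mulrCA -rmorphM /= [2^-1 * _]mulrC.
have hp : Df (ph k) (fun t => 2^-1 * iom om k * ph k t) by rewrite -E; exact: Df_cis.
split.
- by apply: (Df_eq (DfM hh hp)) => t; rewrite /iom; ring.
- by apply: (Df_eq (DfM hg hp)) => t; rewrite /iom; move: (om * k%:~R)%:C%C => z; field.
Qed.

(** Over a period the energy identity gives [0 = Im e] times the integral of [|h|^2 - |g|^2], a
    positive number. Hence the resonances are real: they differ from every nonreal [lam], and
    [conj_row] applies to them. *)
Lemma gap_real k e h g : gap_pair k e h g -> periodicC T h -> periodicC T g ->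
  (forall t, nm (g t) < nm (h t)) -> Im e = 0.
Proof.
move=> hp ph_ pg lt; have hr := gap_row hp.
have nE f t : nm (f t * ph k t) = nm (f t) by rewrite nmM nm_cis mulr1.
pose D t := nm (h t) ^+ 2 + nm (g t) ^+ 2.
have dD t : is_derive t 1 D (- Im e * (nm (h t) ^+ 2 - nm (g t) ^+ 2)).
  apply: (isd_eq (isd_energy t hr)) => [s|]; rewrite !nE //.
  by rewrite cImD /= add0r.
have DT : D T = D 0 by rewrite /D -[T]add0r ph_ pg.
have pos t : 0 < nm (h t) ^+ 2 - nm (g t) ^+ 2.
  by rewrite subr_gt0 ltr_sqr ?nnegrE ?nm_ge0.
apply/eqP; rewrite eq_le !leNgt; apply/andP; split; apply/negP => ie.
  have dN t : is_derive t 1 (fun t => - D t) (Im e * (nm (h t) ^+ 2 - nm (g t) ^+ 2)).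
    by apply: isd_eq (isdB (is_derive_cst 0 _ _) (dD t)) _ _ => [s|]; rewrite sub0r // mulNr opprK.
  by have := isd_lt dN (fun t _ => mulr_gt0 ie (pos t)) T0; rewrite DT ltxx.
have ie' : 0 < - Im e by rewrite oppr_gt0.
by have := isd_lt dD (fun t _ => mulr_gt0 ie' (pos t)) T0; rewrite DT ltxx.
Qed.

(** For real [lam] the matrix [alpha] lies in su(2), whose symmetry turns a solution into an
    independent one. From a Floquet solution with multiplier 1 or -1 it produces a second one with
    the same multiplier, and the gap is closed. *)
Lemma conj_row lam x y : row_sol q lam x y -> Im lam = 0 ->
  row_sol q lam (fun t => - (y t)^*%C) (fun t => (x t)^*%C).
Proof.
move=> [hx hy] l0; have lj : lam^*%C = lam by case: lam l0 {hx hy} => a b /= ->; rewrite oppr0.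
have h2 : (2^-1 : C)^*%C = 2^-1 by rewrite fmorphV rmorph_nat.
split.
- by apply: (Df_eq (DfN (DfJ hy))) => t; rewrite conjM conjB !conjM conj_i lj h2; ring.
- by apply: (Df_eq (DfJ hx)) => t; rewrite conjM conjB !conjM conj_i lj h2 conjcK; ring.
Qed.

(** The two identities come from the squares of the two Floquet solutions at the resonance. For [h]
    near 1 and [g] near 0 they say that mode [- k] of [b1] and mode [k] of [b2] almost vanish. *)
Lemma gap_orth k e h g lam b0 b1 b2 : gap_pair k e h g -> periodicC T h -> periodicC T g ->
  (forall t, nm (g t) < nm (h t)) -> killing q lam b0 b1 b2 -> Im lam != 0 ->
  periodicC T b0 -> periodicC T b1 -> periodicC T b2 ->
  avg (fun t => b1 t * (h t * h t * e_ k t) + b2 t * (g t * g t * e_ k t)) = 0 /\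
  avg (fun t => b1 t * ((g t * g t)^*%C * e_ (- k) t) + b2 t * ((h t * h t)^*%C * e_ (- k) t)) = 0.
Proof.
move=> hp ph_ pg lt hb l0 p0 p1 p2; have e0 := gap_real hp ph_ pg lt.
have hr := gap_row hp.
have im0 : Im ((om * k%:~R)%:C%C + e) = 0 by rewrite cImD e0 addr0.
have hr' := conj_row hr im0.
have lm : lam != (om * k%:~R)%:C%C + e by apply: contraNneq l0 => ->; rewrite im0.
have at0 f : periodicC T f -> f T = f 0 by move=> pf; rewrite -[T]add0r pf.
have b_per : [/\ b0 T = b0 0, b1 T = b1 0 & b2 T = b2 0] by split; exact: at0.
have sq f f' t : f t * ph k t * (f' t * ph k t) = f t * f' t * e_ k t.
  by rewrite -ph_sq; ring.
have P (f f' : R -> C) : periodicC T f -> periodicC T f' ->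
   f T * ph k T * (f' T * ph k T) = f 0 * ph k 0 * (f' 0 * ph k 0).
  by move=> hf hf'; rewrite !sq !at0 // ?ee_periodic //; exact: ee_periodic.
have e_T : e_ k T = e_ k 0 by apply: at0; exact: ee_periodic.
have [cb0 cb1 cb2] := killing_cont hb.
have ch : contC h by case: hp => /Df_contC.
have cg : contC g by case: hp => _ /Df_contC.
have neg (f : R -> C) : contC f -> avg (fun t => - f t) = 0 -> avg f = 0.
  move=> cf; have -> : (fun t => - f t) = (fun t => -1 * f t) by apply/funext => t; rewrite mulN1r.
  by rewrite meanZ // mulN1r => /eqP; rewrite oppr_eq0 => /eqP.
split.
  have := killing_orth hb (killing_square hr hr) lm b_per.
  rewrite !P // => /(_ (And3 erefl erefl erefl)) H; apply: neg.
    by apply: contCD; do ?[apply: contCM => //]; exact: contC_ee.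
  by rewrite -H; apply: avg_ext => t; rewrite !sq; ring.
have := killing_orth hb (killing_square hr' hr') lm b_per.
have PJ (f f' : R -> C) : periodicC T f -> periodicC T f' ->
   (f T * ph k T)^*%C * (f' T * ph k T)^*%C = (f 0 * ph k 0)^*%C * (f' 0 * ph k 0)^*%C.
  by move=> hf hf'; rewrite -!conjM P.
rewrite !mulNr !mulrN !opprK !PJ // => /(_ (And3 erefl erefl erefl)) H; apply: neg.
  by apply: contCD; do ?[apply: contCM => //]; [apply: contCJ; exact: contCM|exact: contC_ee|
    apply: contCJ; exact: contCM|exact: contC_ee].
rewrite -H; apply: avg_ext => t.
by rewrite mulrNN -!conjM !sq !conjM eeN; ring.
Qed.

End GapRows.

(** * Killing fields polynomial in the spectral parameter *)

Section FiniteDimension.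
Variables (R : realType) (T : R).
Local Notation C := R[i].
Local Notation Re := complex.Re.
Local Notation Im := complex.Im.
Hypothesis T0 : 0 < T.
Local Notation om := (2 * pi / T).
Local Notation e_ := (ee om).
Local Notation avg := (mean T).
Implicit Types (k : int) (t : R).

Section Vanish.
Variables (K : R) (N : nat) (h g : int -> R -> C) (v1 v2 : R -> C).
Hypotheses (c1 : contC v1) (c2 : contC v2) (p1 : periodicC T v1) (p2 : periodicC T v2).
Hypothesis hg : forall k, (N < `|k|)%N -> [/\ contC (h k), contC (g k),
  K / br k <= 1 & forall t, nm (h k t - 1) <= K / br k /\ nm (g k t) <= K / br k].
Hypothesis orth : forall k, (N < `|k|)%N ->
  avg (fun t => v1 t * (h k t * h k t * e_ k t) + v2 t * (g k t * g k t * e_ k t)) = 0 /\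
  avg (fun t => v1 t * ((g k t * g k t)^*%C * e_ (- k) t) + v2 t * ((h k t * h k t)^*%C * e_ (- k) t)) = 0.
Hypothesis low : forall k, (`|k| <= N)%N -> four T v1 k = 0 /\ four T v2 k = 0.
Hypothesis tail : forall n, 72 * (K ^+ 2 + 1) *
  psum (fun j => if (N < `|j|)%N then wt j else 0 : R) n <= 1.

(** Orthogonality bounds each high mode by [3 * K / br k] times [U], which the energies control.
    Since the low modes vanish and the tail of the weights is small, Parseval bounds the total
    energy by half of itself. *)
Lemma vanish t : v1 t = 0 /\ v2 t = 0.
Proof.
have [U [U2 hU]] := avg_nm_sq T0 c1 c2.
have four_bound v w f f' k : contC v -> contC w -> contC f -> contC f' ->
   avg (fun t => v t * f t + w t * f' t) = 0 -> avg (fun t => v t * e_ k t) =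
   avg (fun t => v t * (e_ k t - f t) + w t * (- f' t)).
  move=> cv cw cf cf' z; rewrite -[LHS]subr0 -z -avgB.
  - by apply: avg_ext => s; ring.
  - by apply: contCM => //; exact: contC_ee.
  - by apply: contCD; exact: contCM.
have hi k : (N < `|k|)%N -> nm (four T v1 k) <= 3 * K / br k * U /\ nm (four T v2 k) <= 3 * K / br k * U.
  move=> kN.
  have bsq (z : C) (B : R) : nm (z - 1) <= B -> B <= 1 -> nm (1 - z * z) <= 3 * B.
    move=> zB B1; have -> : 1 - z * z = - ((z - 1) * (z - 1 + 2)) by ring.
    rewrite nmN nmM mulrC; apply: ler_pM; rewrite ?nm_ge0 //.
    by apply: le_trans (nmD _ _) _; rewrite nm_nat; lra.
  have bsq' (z : C) (B : R) : nm z <= B -> B <= 1 -> nm (z * z) <= 3 * B.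
    by move=> zB B1; rewrite nmM; have := nm_ge0 z; nra.
  have cee j : contC (e_ j) := contC_ee _ j.
  split.
    have kN' : (N < `|(- k)%R|)%N by rewrite abszN.
    have [ch cg b1 hb] := hg kN'; have [ort _] := orth kN'.
    have chh : contC (fun t => h (- k) t * h (- k) t * e_ (- k) t).
      by apply: contCM => //; exact: contCM.
    have cgg : contC (fun t => g (- k) t * g (- k) t * e_ (- k) t).
      by apply: contCM => //; exact: contCM.
    rewrite /four (four_bound _ _ _ _ _ c1 c2 chh cgg ort) -[3 * K / _]mulrA -(brN R k).
    apply: hU => [||s|s].
    - by apply: contCB; [exact: cee|].
    - exact: contCN.
    - have -> : e_ (- k) s - h (- k) s * h (- k) s * e_ (- k) s = (1 - h (- k) s * h (- k) s) * e_ (- k) s by ring.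
      by rewrite nmM nm_ee mulr1; apply: bsq => //; case: (hb s).
    - by rewrite nmN nmM nm_ee mulr1; apply: bsq' => //; case: (hb s).
  have [ch cg b1 hb] := hg kN; have [_ o2] := orth kN.
  have chh : contC (fun t => (h k t * h k t)^*%C * e_ (- k) t).
    by apply: contCM => //; apply: contCJ; exact: contCM.
  have cgg : contC (fun t => (g k t * g k t)^*%C * e_ (- k) t).
    by apply: contCM => //; apply: contCJ; exact: contCM.
  have o2' : avg (fun t => v2 t * ((h k t * h k t)^*%C * e_ (- k) t) + v1 t * ((g k t * g k t)^*%C * e_ (- k) t)) = 0.
    by rewrite -o2; apply: avg_ext => s; exact: addrC.
  rewrite /four (four_bound _ _ _ _ _ c2 c1 chh cgg o2') -[3 * K / _]mulrA.
  rewrite (@avg_ext R T _ (fun t => v1 t * (- ((g k t * g k t)^*%C * e_ (- k) t)) +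
    v2 t * (e_ (- k) t - (h k t * h k t)^*%C * e_ (- k) t))); last by move=> s; exact: addrC.
  apply: hU => [||s|s].
  - exact: contCN.
  - by apply: contCB; [exact: cee|].
  - by rewrite nmN nmM nm_ee mulr1 nmJ; apply: bsq' => //; case: (hb s).
  - have -> : e_ (- k) s - (h k s * h k s)^*%C * e_ (- k) s = (1 - h k s * h k s)^*%C * e_ (- k) s.
      by rewrite conjB conjc1; ring.
    by rewrite nmM nm_ee mulr1 nmJ; apply: bsq => //; case: (hb s).
pose W := (3 * K) ^+ 2 * U ^+ 2.
have W0 : 0 <= W by rewrite mulr_ge0 // sqr_ge0.
have sq (v : R -> C) : (forall k, (`|k| <= N)%N -> four T v k = 0) ->
   (forall k, (N < `|k|)%N -> nm (four T v k) <= 3 * K / br k * U) ->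
   forall n, psum (fun j => nm (four T v j) ^+ 2) n <= W / (72 * (K ^+ 2 + 1)).
  move=> lo hi' n.
  have k1 : 0 < 72 * (K ^+ 2 + 1) by have := sqr_ge0 K; lra.
  apply: (@le_trans _ _ (W * psum (fun j => if (N < `|j|)%N then wt j else 0 : R) n)).
    rewrite -psumZ; apply: le_psum => j; case: ltnP => jN; last by rewrite lo // nm0 expr0n /= mulr0.
    have -> : W * wt j = (3 * K / br j * U) ^+ 2.
      by rewrite /W /wt; field; rewrite gt_eqF // br_gt0.
    have := hi' j jN; have := nm_ge0 (four T v j); nra.
  by rewrite ler_wpM2l // -[_^-1]mul1r ler_pdivlMr // mulrC.
have e1 := energy_le_four T0 c1 p1 (sq v1 (fun k kN => (low kN).1) (fun k kN => (hi k kN).1)).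
have e2 := energy_le_four T0 c2 p2 (sq v2 (fun k kN => (low kN).2) (fun k kN => (hi k kN).2)).
have g1 := energy_ge0 T0 c1; have g2 := energy_ge0 T0 c2.
(* 72 = 9 * 2 * 4: the square of the 3 in the mode bound, the 2 in the bound of [U ^+ 2], and the
   desired quarter. *)
have WE : W / (72 * (K ^+ 2 + 1)) <= (energy T v1 + energy T v2) / 4.
  have K2 := sqr_ge0 K.
  rewrite ler_pdivrMr; last lra.
  rewrite /W exprMn.
  apply: (@le_trans _ _ (3 ^+ 2 * K ^+ 2 * (2 * (energy T v1 + energy T v2)))).
    by rewrite ler_wpM2l // mulr_ge0.
  nra.
by split; [apply: (energy0 T0 c1 p1)|apply: (energy0 T0 c2 p2)]; lra.
Qed.

End Vanish.

Lemma left_kernel (F : fieldType) (m d : nat) (A : 'M[F]_(m, d)) : (d < m)%N ->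
  exists c : 'rV[F]_m, c != 0 /\ c *m A = 0.
Proof.
move=> dm; have : kermx A != 0.
  by rewrite -mxrank_eq0 mxrank_ker subn_eq0 -ltnNge (leq_ltn_trans (rank_leq_col A)).
by move=> /rowV0Pn[v /sub_kermxP vA v0]; exists v.
Qed.

Lemma four_sum (I : finType) (c : I -> C) (b : I -> R -> C) j : (forall i, contC (b i)) ->
  four T (fun t => \sum_i c i * b i t) j = \sum_i c i * four T (b i) j.
Proof.
move=> cb; have ch i : contC (fun t => b i t * e_ (- j) t).
  by apply: contCM => //; exact: contC_ee.
rewrite /four -[RHS](eq_bigr _ (fun i _ => meanZ T (c i) (ch i))) -mean_sum => [|i]; last exact: contCZ.
by apply: avg_ext => t; rewrite mulr_suml; apply: eq_bigr => i _; ring.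
Qed.

Section Polynomials.
Variables (q : R -> C) (Q K : R) (N : nat).
Hypotheses (qQ : forall t, nm (q t) <= Q) (pq : periodicC T q).
Hypothesis tail : forall n, 72 * (K ^+ 2 + 1) *
  psum (fun j => if (N < `|j|)%N then wt j else 0 : R) n <= 1.
Hypothesis gaps : forall k, (N < `|k|)%N -> exists e h g, [/\ gap_pair T q k e h g,
  periodicC T h, periodicC T g, 4 * (K / br k) <= 1 &
  forall t, nm (h t - 1) <= K / br k /\ nm (g t) <= K / br k].
Variables (x1 y1 x2 y2 : C -> R -> C).
Hypothesis hF : forall lam, basis_rows q lam (x1 lam) (y1 lam) (x2 lam) (y2 lam).

Lemma commuting_polynomials : exists xi0 xi1 xi2 : {poly C},
  xi0 ^+ 2 + 4 * xi1 * xi2 != 0 /\ forall lam,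
  [/\ (x1 lam T - y2 lam T) * xi1.[lam] = y1 lam T * xi0.[lam],
      (x1 lam T - y2 lam T) * xi2.[lam] = x2 lam T * xi0.[lam] &
      y1 lam T * xi2.[lam] = x2 lam T * xi1.[lam]].
Proof.
(* The [n] modes from [- N] to [N] of two off-diagonal entries are [n + n] linear conditions; one
   more sample leaves a nontrivial combination. *)
pose n := (2 * N + 1)%N; pose m := (n + n).+1.
(* Distinct points on the imaginary axis above the bound [Q], so that [trace_off_axis] applies and
   no real resonance is met. *)
pose lam (j : 'I_m) : C := 'i%C * (Q + 1 + j%:R)%:C%C.
pose b0 (j : 'I_m) := flo0 T (x1 (lam j)) (y1 (lam j)) (x2 (lam j)) (y2 (lam j)).
pose b1 (j : 'I_m) := flo1 T (x1 (lam j)) (y1 (lam j)) (x2 (lam j)) (y2 (lam j)).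
pose b2 (j : 'I_m) := flo2 T (x1 (lam j)) (y1 (lam j)) (x2 (lam j)) (y2 (lam j)).
have kil j : killing q (lam j) (b0 j) (b1 j) (b2 j) by exact: flo_killing (hF _).
have per j : [/\ periodicC T (b0 j), periodicC T (b1 j) & periodicC T (b2 j)] by exact: flo_periodic (hF _).
have cb j : [/\ contC (b0 j), contC (b1 j) & contC (b2 j)] := killing_cont (kil j).
have cb1 j : contC (b1 j) by case: (cb j).
have cb2 j : contC (b2 j) by case: (cb j).
pose mode (l : 'I_n) : int := l%:Z - N%:Z.
pose A : 'M[C]_(m, n + n) := row_mx (\matrix_(j, l) four T (b1 j) (mode l)) (\matrix_(j, l) four T (b2 j) (mode l)).
have [c [c0 cA]] := left_kernel A (ltnSn _).
pose v1 t := \sum_j c 0 j * b1 j t; pose v2 t := \sum_j c 0 j * b2 j t.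
have cv1 : contC v1 by apply: (@contC_sum R _ _ xpredT (fun j t => c 0 j * b1 j t)) => j; exact: contCZ.
have cv2 : contC v2 by apply: (@contC_sum R _ _ xpredT (fun j t => c 0 j * b2 j t)) => j; exact: contCZ.
have pv1 : periodicC T v1 by move=> t; apply: eq_bigr => j _; case: (per j) => _ -> _.
have pv2 : periodicC T v2 by move=> t; apply: eq_bigr => j _; case: (per j) => _ _ ->.
have gap_ex k : exists eh : C * (R -> C) * (R -> C), (N < `|k|)%N -> [/\ gap_pair T q k eh.1.1 eh.1.2 eh.2,
  periodicC T eh.1.2, periodicC T eh.2, 4 * (K / br k) <= 1 &
  forall t, nm (eh.1.2 t - 1) <= K / br k /\ nm (eh.2 t) <= K / br k].
  case: (boolP (N < `|k|)%N) => kN; last by exists (0, fun=> 0, fun=> 0).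
  by have [e [h [g H]]] := gaps kN; exists (e, h, g).
have [eh hgap] := choice gap_ex.
have imE j : Im (lam j) = Q + 1 + j%:R by rewrite /lam cImM /= mul0r mul1r ?addr0 ?add0r.
have lowz k : (`|k| <= N)%N -> four T v1 k = 0 /\ four T v2 k = 0.
  move=> kN; have lk : (absz (k + N%:Z)%R < n)%N by rewrite /n; lia.
  pose l := Ordinal lk; have lE : mode l = k by rewrite /mode /=; lia.
  rewrite /v1 /v2 !four_sum //; split.
    transitivity ((c *m A) 0 (lshift n l)); last by rewrite cA mxE.
    by rewrite mxE; apply: eq_bigr => j _; rewrite /A row_mxEl [in RHS]mxE lE.
  transitivity ((c *m A) 0 (rshift n l)); last by rewrite cA mxE.
  by rewrite mxE; apply: eq_bigr => j _; rewrite /A row_mxEr [in RHS]mxE lE.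
have lt_hg k : (N < `|k|)%N -> forall t, nm ((eh k).2 t) < nm ((eh k).1.2 t).
  move=> kN t; have [_ _ _ k4 hb] := hgap k kN; have [h1 h2] := hb t.
  have := nm_sub_le 1 (1 - (eh k).1.2 t); rewrite subKr nm1 nmB; lra.
have orthv k : (N < `|k|)%N -> 
  avg (fun t => v1 t * ((eh k).1.2 t * (eh k).1.2 t * e_ k t) + v2 t * ((eh k).2 t * (eh k).2 t * e_ k t)) = 0 /\
  avg (fun t => v1 t * (((eh k).2 t * (eh k).2 t)^*%C * e_ (- k) t) + v2 t * (((eh k).1.2 t * (eh k).1.2 t)^*%C * e_ (- k) t)) = 0.
  move=> kN; have [gp ph_ pg k4 hb] := hgap k kN.
  have ch : contC (eh k).1.2 by case: gp => /Df_contC.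
  have cg : contC (eh k).2 by case: gp => _ /Df_contC.
  have o j := gap_orth T0 gp ph_ pg (lt_hg k kN) (kil j).
  have lamI j : Im (lam j) != 0.
    rewrite imE gt_eqF //.
    by have := le_trans (nm_ge0 _) (qQ 0); have := ler0n R j; lra.
  have lin (f f' : R -> C) : contC f -> contC f' ->
     (forall j, avg (fun t => b1 j t * f t + b2 j t * f' t) = 0) ->
     avg (fun t => v1 t * f t + v2 t * f' t) = 0.
    move=> cf cf' z.
    have cc j : contC (fun t => b1 j t * f t + b2 j t * f' t) by apply: contCD; exact: contCM.
    rewrite (@avg_ext R T _ (fun t => \sum_j c 0 j * (b1 j t * f t + b2 j t * f' t))).
      rewrite mean_sum => [|j]; last exact: contCZ.
      by rewrite big1 // => j _; rewrite meanZ // z mulr0.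
    move=> t; rewrite /v1 /v2 !mulr_suml -big_split /=; apply: eq_bigr => j _; ring.
  split; apply: lin.
  - by apply: contCM; [exact: contCM|exact: contC_ee].
  - by apply: contCM; [exact: contCM|exact: contC_ee].
  - by move=> j; have [p0 p1 p2] := per j; have [] := o j (lamI j) p0 p1 p2.
  - by apply: contCM; [apply: contCJ; exact: contCM|exact: contC_ee].
  - by apply: contCM; [apply: contCJ; exact: contCM|exact: contC_ee].
  - by move=> j; have [p0 p1 p2] := per j; have [] := o j (lamI j) p0 p1 p2.
have vz := @vanish K N (fun k => (eh k).1.2) (fun k => (eh k).2) v1 v2 cv1 cv2 pv1 pv2 _ orthv lowz tail.
have {}vz t : v1 t = 0 /\ v2 t = 0.
  apply: vz => k kN; have [gp _ _ k4 hb] := hgap k kN; split=> //.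
  - by case: gp => /Df_contC.
  - by case: gp => _ /Df_contC.
  - by have := le_trans (nm_ge0 _) (hb 0).1; lra.
pose pi_ (j : 'I_m) : {poly C} := \prod_(i | i != j) ('X - (lam i)%:P).
pose xi (b : 'I_m -> R -> C) : {poly C} := \sum_j (c 0 j * b j 0) *: pi_ j.
have xiE b z : (xi b).[z] = \sum_j c 0 j * (pi_ j).[z] * b j 0.
  by rewrite /xi horner_sum; apply: eq_bigr => j _; rewrite hornerZ; ring.
have piE (j : 'I_m) z : (pi_ j).[z] * (z - lam j) = \prod_i (z - lam i).
  rewrite (bigD1 j) //= mulrC; congr (_ * _); rewrite /pi_ horner_prod.
  by apply: eq_bigr => i _; rewrite hornerXsubC.
exists (xi b0), (xi b1), (xi b2); split; last first.
  move=> z; rewrite !xiE.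
  (* At time 0 this is the value of [xi b] at [z]. Each summand solves the equation for [lam j]
     instead of [z]; since [(pi_ j).[z] * (z - lam j)] is the full product for every [j], the
     discrepancy is a multiple of [v1] or [v2], hence zero. *)
  pose X (b : 'I_m -> R -> C) t := \sum_j c 0 j * (pi_ j).[z] * b j t.
  have hX : killing q z (X b0) (X b1) (X b2).
    split.
    - apply: (Df_eq (@Df_sum R _ _ xpredT (fun j t => c 0 j * (pi_ j).[z] * b0 j t) _ (fun j => DfZ (c 0 j * (pi_ j).[z]) (let: And3 h _ _ := kil j in h)))) => t.
      by rewrite /X !mulr_sumr -big_split -sumrN /=; apply: eq_bigr => j _; ring.
    - apply: (Df_eq (@Df_sum R _ _ xpredT (fun j t => c 0 j * (pi_ j).[z] * b1 j t) _ (fun j => DfZ (c 0 j * (pi_ j).[z]) (let: And3 _ h _ := kil j in h)))) => t.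
      rewrite /X !mulr_sumr -sumrB /=.
      apply/eqP; rewrite -subr_eq0 -sumrB; apply/eqP.
      transitivity ('i%C * (\prod_i (z - lam i)) * v1 t); last by rewrite (vz t).1 mulr0.
      by rewrite /v1 mulr_sumr; apply: eq_bigr => j _; rewrite -(piE j); ring.
    - apply: (Df_eq (@Df_sum R _ _ xpredT (fun j t => c 0 j * (pi_ j).[z] * b2 j t) _ (fun j => DfZ (c 0 j * (pi_ j).[z]) (let: And3 _ _ h := kil j in h)))) => t.
      rewrite /X !mulr_sumr -big_split /=.
      apply/eqP; rewrite -subr_eq0 -sumrB; apply/eqP.
      transitivity (- ('i%C * (\prod_i (z - lam i)) * v2 t)); last by rewrite (vz t).2 mulr0 oppr0.
      by rewrite /v2 mulr_sumr -sumrN; apply: eq_bigr => j _; rewrite -(piE j); ring.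
  have pT f : periodicC T f -> f T = f 0 by move=> pf; rewrite -[T]add0r pf.
  have eT : [/\ X b0 T = X b0 0, X b1 T = X b1 0 & X b2 T = X b2 0].
    by split; apply: eq_bigr => j _; congr (_ * _); apply: pT; case: (per j).
  exact: (flo_commute (hF z) hX eT).
(* At [lam j0] only the summand [j0] survives, and the discriminant is a nonzero multiple of
   [Delta^2 - 4], which does not vanish there. *)
have [j0 cj0] : exists j, c 0 j != 0.
  apply/existsP; rewrite -negb_forall; apply: contra c0 => /forallP z.
  by apply/eqP/rowP => j; rewrite mxE; exact/eqP.
have lam_inj i : i != j0 -> lam j0 != lam i.
  apply: contra => /eqP E; have : Im (lam j0) = Im (lam i) by rewrite E.
  rewrite !imE => /addrI /eqP.
  by rewrite eqr_nat eq_sym => /eqP /ord_inj ->.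
have ev b : (xi b).[lam j0] = c 0 j0 * (pi_ j0).[lam j0] * b j0 0.
  rewrite xiE (bigD1 j0) //= big1 ?addr0 // => j jj; rewrite /pi_ horner_prod (bigD1 j0) /=; last by rewrite eq_sym.
  by rewrite hornerXsubC subrr mul0r mulr0 mul0r.
have pi0 : (pi_ j0).[lam j0] != 0.
  by rewrite /pi_ horner_prod prodf_seq_neq0; apply/allP => i _; apply/implyP => ij; rewrite hornerXsubC subr_eq0 lam_inj.
apply/negP => /eqP z; have := congr1 (fun P : {poly C} => P.[lam j0]) z.
rewrite horner0 hornerD horner_exp !hornerM hornerMn hornerC !ev.
rewrite /b0 /b1 /b2; have [-> -> ->] := flo_init T (hF (lam j0)).
set a := x1 _ T; set bb := y1 _ T; set cc := x2 _ T; set d := y2 _ T.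
have det : a * d - bb * cc = 1 := basis_det T (hF (lam j0)).
have tr : (a + d) ^+ 2 != 4.
  apply: (trace_off_axis qQ T0 _ (hF (lam j0))).
  by have := ler0n R j0; lra.
have -> : (c 0 j0 * (pi_ j0).[lam j0] * (a - d)) ^+ 2 +
   4 * (c 0 j0 * (pi_ j0).[lam j0] * bb) * (c 0 j0 * (pi_ j0).[lam j0] * cc) =
   (c 0 j0 * (pi_ j0).[lam j0]) ^+ 2 * ((a + d) ^+ 2 - 4 * (a * d - bb * cc)) by ring.
rewrite det mulr1 => /eqP; rewrite mulf_eq0 expf_eq0 /= mulf_eq0 (negPf cj0) (negPf pi0) /=.
by rewrite subr_eq0 (negPf tr).
Qed.

End Polynomials.
End FiniteDimension.

(** * Entire functions with finitely many zeros *)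

Section Entire.
Variable R : realType.
Local Notation C := R[i].
Local Notation Re := complex.Re.
Local Notation Im := complex.Im.
Implicit Types (f g : C -> C) (z w : C).

Lemma complex_pos (e : C) : 0 < e -> 0 < Re e /\ e = (Re e)%:C%C.
Proof. by case: e => a b; rewrite ltcE /= => /andP[/eqP -> a0]. Qed.

Lemma ltc_nm z (e : R) : (`|z| < e%:C%C) = (nm z < e).
Proof. by rewrite -ltcR. Qed.

Lemma entire_quadratic f : (forall z, exists (l : C) (K : R), forall w, nm (w - z) <= 1 ->
  nm (f w - f z - (w - z) * l) <= K * nm (w - z) ^+ 2) -> entire f.
Proof.
move=> H z; have [l [K hK]] := H z.
apply/cvg_ex; exists (l : C^o); apply/cvgrPdist_lt => eps /complex_pos[e0 ->].
have dd : 0 < Num.min 1 (Re eps / (`|K| + 1)).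
  by rewrite lt_min ltr01 divr_gt0 // ltr_wpDl.
have dc : (0 : C) < (Num.min 1 (Re eps / (`|K| + 1)))%:C%C by rewrite ltcR.
near=> h.
have h0 : h != 0 by near: h; exact: nbhs_dnbhs_neq.
have hd : `|h| < (Num.min 1 (Re eps / (`|K| + 1)))%:C%C by near: h; exact: dnbhs0_lt.
move: hd; rewrite ltc_nm lt_min => /andP[h1 he].
rewrite [X in `|X|](_ : _ = - (h^-1 * (f (h + z) - f z - h * l))); last first.
  by rewrite /= /GRing.scale /= mulr1; field.
rewrite ltc_nm nmN nmM nmV.
have := hK (h + z); rewrite addrK => /(_ (ltW h1)) hq.
have n0 : 0 < nm h by rewrite nm_gt0.
rewrite mulrC ltr_pdivrMr //; apply: le_lt_trans hq _.
rewrite expr2 mulrA ltr_pM2r //; move: he; rewrite ltr_pdivlMr ?ltr_wpDl // => he.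
have := ler_norm K; nra.
Unshelve. all: by end_near.
Qed.

Lemma entire_cst z : entire (fun=> z).
Proof. by move=> w; exact: derivable_cst. Qed.
Lemma entire_id : entire (fun z => z).
Proof. by move=> w; exact: (@derivable_id C C^o w 1). Qed.
Lemma entireD f g : entire f -> entire g -> entire (fun z => f z + g z).
Proof. by move=> ef eg z; exact: (derivableD (ef z) (eg z)). Qed.
Lemma entireB f g : entire f -> entire g -> entire (fun z => f z - g z).
Proof. by move=> ef eg z; exact: (derivableB (ef z) (eg z)). Qed.
Lemma entireM f g : entire f -> entire g -> entire (fun z => f z * g z).
Proof. by move=> ef eg z; exact: (derivableM (ef z) (eg z)). Qed.

Lemma entire_ext f g : (forall z, f z = g z) -> entire f -> entire g.
Proof. by move=> fg ef; have <- : f = g by apply/funext. Qed.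

Lemma entire_poly (P : {poly C}) : entire (fun z => P.[z]).
Proof.
elim/poly_ind: P => [|P c ih]; first by apply: (@entire_ext (fun=> 0)) => [z|]; [rewrite horner0|exact: entire_cst].
apply: (@entire_ext (fun z => P.[z] * z + c)) => [z|]; first by rewrite hornerMXaddC.
exact: (entireD (entireM ih entire_id) (@entire_cst c)).
Qed.

Lemma entire_continuous f z (e : R) : entire f -> 0 < e ->
  exists2 d : R, 0 < d & forall w, nm (w - z) < d -> nm (f w - f z) < e.
Proof.
move=> ef e0.
have /differentiable_continuous /cvgrPdist_lt cf : differentiable (f : C^o -> C^o) (z : C^o) by apply/derivable1_diffP; exact: ef.
have ec : (0 : C) < e%:C%C by rewrite ltcR.
have /nbhs_ballP[d /complex_pos[d0 dE] hd] := cf _ ec.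
exists (Re d) => // w wd; rewrite -nmB -ltc_nm; apply: hd.
by rewrite -ball_normE /ball_ /= dE ltc_nm nmB.
Qed.

(* The zeros of a nonzero polynomial are too few to fill a disc. *)
Lemma entire_eq f g (D : {poly C}) : entire f -> entire g -> D != 0 ->
  (forall z, D.[z] * f z = D.[z] * g z) -> forall z, f z = g z.
Proof.
move=> ef eg D0 E z; apply/eqP; rewrite -subr_eq0; apply/negPn/negP => fg.
have [d d0 hd] := entire_continuous z (entireB ef eg) (ltac:(by rewrite nm_gt0) : 0 < nm (f z - g z)).
pose rs := [seq z + (d / k.+2%:R)%:C%C | k <- iota 0 (size D)].
have rr : all (root D) rs.
  apply/allP => _ /mapP[k _ ->]; apply/eqP; set w := z + _.
  have wz : nm (w - z) < d.
    rewrite /w [z + _]addrC addrK nm_real ger0_norm ?divr_ge0 ?ltW // ltr_pdivrMr //.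
    by rewrite -[X in X < _]mulr1 ltr_pM2l // ltr1n.
  have fw : f w - g w != 0.
    by have := hd w wz; apply: contraTneq => ->; rewrite sub0r nmN ltxx.
  by apply: (mulIf fw); rewrite mul0r mulrBr E subrr.
have ur : uniq rs.
  rewrite map_inj_uniq ?iota_uniq // => j k /addrI /(congr1 (@complex.Re R)) /= jk.
  by have /invr_inj/eqP := mulfI (lt0r_neq0 d0) jk; rewrite eqr_nat => /eqP[].
by have := max_poly_roots D0 rr ur; rewrite size_map size_iota ltnn.
Qed.

Lemma polynomial_zeros (g : {poly C}) : g != 0 -> finitely_many_zeros (fun z => g.[z]).
Proof.
move=> g0; have [s gE] := closed_field_poly_normal g.
exists s => z; exists (fun w => (lead_coef g *: \prod_(x <- s | x != z) ('X - x%:P)).[w]).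
split; first exact: entire_poly.
  rewrite hornerZ horner_prod mulf_eq0 lead_coef_eq0 (negPf g0) /= prodf_seq_neq0.
  by apply/allP => x _; apply/implyP => xz; rewrite hornerXsubC subr_eq0 eq_sym.
move=> w; rewrite [in LHS]gE !hornerZ mulrCA; congr (_ * _).
rewrite !horner_prod; elim: s {gE} => [|x s ih]; first by rewrite !big_nil mulr1.
rewrite !big_cons /= ih hornerXsubC; case: eqVneq => [->|xz] /=; rewrite ?exprS; ring.
Qed.

Lemma bezout3 (x0 x1 x2 : {poly C}) : [|| x0 != 0, x1 != 0 | x2 != 0] ->
  exists D A0 A1 A2 u0 u1 u2 : {poly C}, [/\ D != 0, x0 = A0 * D, x1 = A1 * D, x2 = A2 * D &
    u0 * A0 + u1 * A1 + u2 * A2 = 1].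
Proof.
move=> x012; pose D := gcdp x0 (gcdp x1 x2).
have D0 : D != 0 by rewrite !gcdp_eq0; apply: contraTN x012; rewrite !negb_or !negbK => /and3P[-> -> ->].
have d0 : D %| x0 by exact: dvdp_gcdl.
have d1 : D %| x1 by apply: dvdp_trans (dvdp_gcdr _ _) (dvdp_gcdl _ _).
have d2 : D %| x2 by apply: dvdp_trans (dvdp_gcdr _ _) (dvdp_gcdr _ _).
have [[u v] /eqpP[[k1 k2] /andP[/= k10 k20] E1]] := Bezoutp x1 x2.
have [[u' v'] /eqpP[[l1 l2] /andP[/= l10 l20] E2]] := Bezoutp x0 (gcdp x1 x2).
(* The scalars compensate for [Bezoutp] giving the greatest common divisor only up to a constant. *)
exists D, (x0 %/ D), (x1 %/ D), (x2 %/ D),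
  ((l1 / l2) *: u'), ((l1 / l2 * k1 / k2) *: (v' * u)), ((l1 / l2 * k1 / k2) *: (v' * v)).
split; rewrite ?divpK //; apply: (mulIf D0); rewrite mul1r !mulrDl -!mulrA !divpK //.
rewrite [RHS](_ : _ = (l1 / l2) *: (u' * x0 + v' * gcdp x1 x2)); last first.
  by rewrite mulrC -scalerA E2 scalerA mulVf // scale1r.
have -> : gcdp x1 x2 = (k1 / k2) *: (u * x1 + v * x2) by rewrite mulrC -scalerA E1 scalerA mulVf // scale1r.
rewrite -!mul_polyC !polyCM; ring.
Qed.

(** After removal of the common factor of [x0], [x1], [x2], the Bezout identity
    [u0 A0 + u1 A1 + u2 A2 = 1] shows how to recover the multiplier: [p = u0 f0 + u1 f1 + u2 f2]. It
    is entire as a combination of entire functions, and every common divisor of [f0], [f1], [f2]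
    divides it for the same reason. *)
Lemma gcd_of_proportional f0 f1 f2 (x0 x1 x2 : {poly C}) :
  entire f0 -> entire f1 -> entire f2 -> x0 ^+ 2 + 4 * x1 * x2 != 0 ->
  (forall z, [/\ f0 z * x1.[z] = f1 z * x0.[z], f0 z * x2.[z] = f2 z * x0.[z] &
    f1 z * x2.[z] = f2 z * x1.[z]]) ->
  exists (A0 A1 A2 : {poly C}) p, [/\ entire_gcd3 f0 f1 f2 p, A0 ^+ 2 + 4 * A1 * A2 != 0 &
    forall z, [/\ f0 z = A0.[z] * p z, f1 z = A1.[z] * p z & f2 z = A2.[z] * p z]].
Proof.
move=> e0 e1 e2 d0 E.
have [|D [A0 [A1 [A2 [u0 [u1 [u2 [D0 E0 E1 E2 bz]]]]]]]] := @bezout3 x0 x1 x2.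
  apply: contraNT d0; rewrite !negb_or !negbK => /and3P[/eqP -> /eqP -> /eqP ->].
  by rewrite expr0n /= mulr0 addr0.
(* Cancelling [D] at its own zeros is a matter of continuity, supplied by [entire_eq]. *)
have canc f g (A B : {poly C}) : entire f -> entire g ->
    (forall z, f z * (A * D).[z] = g z * (B * D).[z]) -> forall z, f z * A.[z] = g z * B.[z].
  move=> ef eg H; apply: (@entire_eq (fun z => f z * A.[z]) (fun z => g z * B.[z]) D _ _ D0).
  - exact: (entireM ef (@entire_poly A)).
  - exact: (entireM eg (@entire_poly B)).
  - by move=> z; have := H z; rewrite !hornerM => H'; rewrite mulrC -mulrA H' mulrA mulrC.
have F1 := canc f0 f1 A1 A0 e0 e1; have F2 := canc f0 f2 A2 A0 e0 e2.
have F3 := canc f1 f2 A2 A1 e1 e2; rewrite -E0 -E1 -E2 in F1 F2 F3.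
have {}F1 := F1 (fun z => let: And3 h _ _ := E z in h).
have {}F2 := F2 (fun z => let: And3 _ h _ := E z in h).
have {}F3 := F3 (fun z => let: And3 _ _ h := E z in h).
have eP (u v w : {poly C}) g0 g1 g2 : entire g0 -> entire g1 -> entire g2 ->
    entire (fun z => u.[z] * g0 z + v.[z] * g1 z + w.[z] * g2 z).
  move=> h0 h1 h2; exact: (entireD (entireD (entireM (@entire_poly u) h0)
    (entireM (@entire_poly v) h1)) (entireM (@entire_poly w) h2)).
pose p z := u0.[z] * f0 z + u1.[z] * f1 z + u2.[z] * f2 z.
have bz' z : u0.[z] * A0.[z] + u1.[z] * A1.[z] + u2.[z] * A2.[z] = 1.
  by rewrite -!hornerM -!hornerD bz hornerC.
have ep : entire p.
  exact: eP.
have fE z : [/\ f0 z = A0.[z] * p z, f1 z = A1.[z] * p z & f2 z = A2.[z] * p z].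
  have := F1 z; have := F2 z; have := F3 z; have := bz' z; rewrite /p => b g3 g2 g1.
  split.
  - transitivity ((u0.[z] * A0.[z] + u1.[z] * A1.[z] + u2.[z] * A2.[z]) * f0 z); first by rewrite b mul1r.
    rewrite !mulrDl -![_ * _ * f0 z]mulrA ![_ * f0 z]mulrC g1 g2; ring.
  - transitivity ((u0.[z] * A0.[z] + u1.[z] * A1.[z] + u2.[z] * A2.[z]) * f1 z); first by rewrite b mul1r.
    rewrite !mulrDl -![_ * _ * f1 z]mulrA ![_ * f1 z]mulrC -g1 g3; ring.
  - transitivity ((u0.[z] * A0.[z] + u1.[z] * A1.[z] + u2.[z] * A2.[z]) * f2 z); first by rewrite b mul1r.
    rewrite !mulrDl -![_ * _ * f2 z]mulrA ![_ * f2 z]mulrC -g2 -g3; ring.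
exists A0, A1, A2, p; split=> //.
  split=> //.
  - by exists (fun z => A0.[z]); [exact: entire_poly|move=> z; rewrite mulrC; case: (fE z)].
  - by exists (fun z => A1.[z]); [exact: entire_poly|move=> z; rewrite mulrC; case: (fE z)].
  - by exists (fun z => A2.[z]); [exact: entire_poly|move=> z; rewrite mulrC; case: (fE z)].
  move=> r er [h0 eh0 k0] [h1 eh1 k1] [h2 eh2 k2].
  exists (fun z => u0.[z] * h0 z + u1.[z] * h1 z + u2.[z] * h2 z).
    exact: eP.
  by move=> z; rewrite /p k0 k1 k2; ring.
apply: contraNneq d0 => z; have -> : x0 ^+ 2 + 4 * x1 * x2 = (A0 ^+ 2 + 4 * A1 * A2) * D ^+ 2.
  by rewrite E0 E1 E2; ring.
by rewrite z mul0r.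
Qed.

End Entire.

(** * Finite gap potentials near trigonometric polynomials *)

Section FiniteGap.
Variables (R : realType) (T : R).
Local Notation C := R[i].
Local Notation Re := complex.Re.
Local Notation Im := complex.Im.
Hypothesis T0 : 0 < T.
Local Notation om := (2 * pi / T).
Implicit Types (q f : R -> C) (t s : R).

Lemma contC_continuous f : contC f -> continuous (f : R -> C^o).
Proof.
move=> /contC_epsP cf t; apply/cvgrPdist_lt => eps /complex_pos[e0 ->].
have [d d0 hd] := cf t _ e0; near=> s; rewrite ltc_nm nmB; apply: hd.
by near: s; apply: cvgr_distC_lt d0.
Unshelve. all: by end_near. Qed.

Lemma Cintegral_Df f f' t : Df f f' -> contC f' -> 0 <= t -> Cintegral `[0, t] f' = f t - f 0.
Proof.
move=> df [c1 c2] t0; rewrite /Cintegral.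
rewrite (FTC2_cont (fun s => (df s).1) c1 t0) (FTC2_cont (fun s => (df s).2) c2 t0).
by case: (f t) => a b; case: (f 0).
Qed.

Section Basis.
Variables (q : R -> C) (Q : R).
Hypotheses (cq : contC q) (qQ : forall t, nm (q t) <= Q).
Variables (x1 y1 x2 y2 : C -> R -> C).
Hypothesis hF : forall lam, basis_rows q lam (x1 lam) (y1 lam) (x2 lam) (y2 lam).

Let F t lam := mx2 (x1 lam t) (y1 lam t) (x2 lam t) (y2 lam t).

Lemma basis_fundamental : fundamental_solution T q F.
Proof.
move=> lam; have [h1 h2 [i1 j1] [i2 j2]] := hF lam.
have E i j : exists f', [/\ Df (fun t => F t lam i j) f', contC f', F 0 lam i j = (1%:M : 'M[C]_2) i j &
   forall s, (F s lam *m alpha (q s) lam) i j = f' s].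
  have cR x y : row_sol q lam x y -> contC (fun t => 2^-1 * ('i%C * lam * x t - (q t)^*%C * y t)) /\
      contC (fun t => 2^-1 * (q t * x t - 'i%C * lam * y t)).
    move=> [/Df_contC cx /Df_contC cy]; split; apply: contCZ; apply: contCB.
    - exact: contCZ.
    - by apply: contCM => //; exact: contCJ.
    - exact: contCM.
    - exact: contCZ.
  have [c1 c1'] := cR _ _ h1; have [c2 c2'] := cR _ _ h2.
  have eqF (G : R -> C) G' : (forall t, F t lam i j = G t) -> Df G G' -> Df (fun t => F t lam i j) G'.
    by move=> FG dG; apply: Df_ext dG _ => t; rewrite FG.
  case: i j eqF => [[|[|//]] hi] [[|[|//]] hj] eqF.
  - exists (fun t => 2^-1 * ('i%C * lam * x1 lam t - (q t)^*%C * y1 lam t)); split=> //.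
    + by apply: eqF h1.1 => t; rewrite mxE.
    + by rewrite !mxE.
    + move=> s; rewrite mxE !big_ord_recl big_ord0 !mxE /=; ring.
  - exists (fun t => 2^-1 * (q t * x1 lam t - 'i%C * lam * y1 lam t)); split=> //.
    + by apply: eqF h1.2 => t; rewrite mxE.
    + by rewrite !mxE.
    + move=> s; rewrite mxE !big_ord_recl big_ord0 !mxE /=; ring.
  - exists (fun t => 2^-1 * ('i%C * lam * x2 lam t - (q t)^*%C * y2 lam t)); split=> //.
    + by apply: eqF h2.1 => t; rewrite mxE.
    + by rewrite !mxE.
    + move=> s; rewrite mxE !big_ord_recl big_ord0 !mxE /=; ring.
  - exists (fun t => 2^-1 * (q t * x2 lam t - 'i%C * lam * y2 lam t)); split=> //.
    + by apply: eqF h2.2 => t; rewrite mxE.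
    + by rewrite !mxE.
    + move=> s; rewrite mxE !big_ord_recl big_ord0 !mxE /=; ring.
split=> [i j|t].
  have [f' [/Df_contC cf _ _ _]] := E i j.
  by apply: continuous_subspaceT; exact: contC_continuous.
rewrite in_itv /= => /andP[t0 _] i j; have [f' [df cf' <- /funext ->]] := E i j.
by rewrite (Cintegral_Df df cf' t0) addrC subrK.
Qed.

(** As [det M = 1], [Delta^2 - 4 = (a - d)^2 + 4 b c], which is [p^2] times the polynomial
    [A0^2 + 4 A1 A2]. At a point given by [trace_off_axis] the left-hand side is nonzero, hence so
    is [p]. *)
Lemma basis_finite_gap (x0 x1' x2' : {poly C}) : x0 ^+ 2 + 4 * x1' * x2' != 0 ->
  (forall lam, [/\ (x1 lam T - y2 lam T) * x1'.[lam] = y1 lam T * x0.[lam],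
      (x1 lam T - y2 lam T) * x2'.[lam] = x2 lam T * x0.[lam] &
      y1 lam T * x2'.[lam] = x2 lam T * x1'.[lam]]) -> finite_gap T q.
Proof.
move=> d0 rel.
have r1 lam : [/\ row_sol q lam (x1 lam) (y1 lam), x1 lam 0 = 1 & y1 lam 0 = 0] by have [? ? []] := hF lam.
have r2 lam : [/\ row_sol q lam (x2 lam) (y2 lam), x2 lam 0 = 0 & y2 lam 0 = 1] by have [? ? ? []] := hF lam.
have ent X Y a b : (forall lam, [/\ row_sol q lam (X lam) (Y lam), X lam 0 = a & Y lam 0 = b]) ->
    entire (fun lam => X lam T) /\ entire (fun lam => Y lam T).
  move=> h; split; apply: entire_quadratic => lam; have [lx [ly [K H]]] := row_quadratic cq qQ h T0 lam.
    by exists lx, K => mu /H[].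
  by exists ly, K => mu /H[].
have [ex1 ey1] := ent _ _ _ _ r1; have [ex2 ey2] := ent _ _ _ _ r2.
have [A0 [A1 [A2 [p [gp g0 pE]]]]] := gcd_of_proportional (entireB ex1 ey2) ey1 ex2 d0 rel.
pose g := A0 ^+ 2 + 4 * A1 * A2.
have trE z : (x1 z T + y2 z T) ^+ 2 - 4 = g.[z] * p z ^+ 2.
  have det := basis_det T (hF z).
  have [a1 a2 a3] := pE z.
  rewrite /g hornerD horner_exp !hornerM hornerMn hornerC.
  transitivity ((x1 z T - y2 z T) ^+ 2 + 4 * y1 z T * x2 z T); last by rewrite a1 a2 a3; ring.
  by rewrite -[4 in LHS]mulr1 -[X in 4 * X]det; ring.
exists (F T), p, (fun z => g.[z]); split.
- by exists F => //; exact: basis_fundamental.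
- have -> : (fun z => F T z 0 0 - F T z 1 1) = (fun z => x1 z T - y2 z T) by apply/funext => z; rewrite !mxE.
  have -> : (fun z => F T z 0 1) = (fun z => y1 z T) by apply/funext => z; rewrite !mxE.
  have -> : (fun z => F T z 1 0) = (fun z => x2 z T) by apply/funext => z; rewrite !mxE.
  split=> //; exists ('i%C * (Q + 1)%:C%C).
  have Qk : Q < Q + 1 by rewrite ltrDl.
  have := trace_off_axis qQ T0 Qk (hF _); apply: contraNneq => pz.
  by rewrite -subr_eq0 trE pz expr0n mulr0.
- exact: entire_poly.
- by move=> z; rewrite -trE /mxtrace !big_ord_recl big_ord0 !mxE /= addr0.
- exact: polynomial_zeros.
Qed.

End Basis.

Lemma finite_gap_near_trig (F : seq (int * C)) (e : R) : 0 < e ->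
  exists q, [/\ contC q, periodicC T q, forall t, nm (q t - trig T F t) <= e & finite_gap T q].
Proof.
move=> e0; have [a [n [an aE]]] := trig_psum T F.
have [A hA] := finite_dec an.
have A0 : 0 <= A by apply: dec_ge0 hA.
have om0 : 0 < om := om_gt0 T0.
have [K hK] := gap_closing om0 A0.
(* The 4 is the constant of [evl_le], which turns coefficient bounds into pointwise ones. *)
pose delta := Num.min 1 (e / 4).
have delta0 : 0 < delta by rewrite lt_min ltr01 /=; lra.
have delta1 : delta <= 1 by rewrite ge_min lexx.
have deltae : 4 * delta <= e.
  have : delta <= e / 4 by rewrite ge_min lexx orbT.
  lra.
have [N1 hN1] := hK delta delta0 delta1.
have K72 : 0 < 72 * (K ^+ 2 + 1) by have := sqr_ge0 K; lra.
have tl0 : 0 < (72 * (K ^+ 2 + 1))^-1 by rewrite invr_gt0.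
have [N2 hN2] := wt_tail tl0.
have [N3 hN3] := archi_gt (4 * K / 1).
(* [N1] serves the contraction, [N2] the tail condition of [vanish], [N3] the bound
   [4 * (K / br k) <= 1], and [n] bounds the modes of the given trigonometric polynomial. *)
pose N := maxn (maxn N1 N2) (maxn N3 n).
have [N1N N2N N3N nN] : [/\ (N1 <= N)%N, (N2 <= N)%N, (N3 <= N)%N & (n <= N)%N] by rewrite /N !leq_max !leqnn ?orbT; split.
have [qh [dq dd hk]] := hN1 N a N1N hA (fun j jN => an j (leq_ltn_trans nN jN)).
pose q := evl om qh.
have cq : contC q := contC_evl om dq.
have pq : periodicC T q := evl_periodic T0 qh.
have [Q _ qQ] := periodic_bounded T0 cq pq.
have sol lam : exists s : (R -> C) * (R -> C) * ((R -> C) * (R -> C)), basis_rows q lam s.1.1 s.1.2 s.2.1 s.2.2.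
  have [x1 [y1 [h1 i1 j1]]] := row_sol_exists lam 1 0 cq qQ.
  have [x2 [y2 [h2 i2 j2]]] := row_sol_exists lam 0 1 cq qQ.
  by exists ((x1, y1), (x2, y2)).
have [s hs] := choice sol.
have tail m : 72 * (K ^+ 2 + 1) * psum (fun j => if (N < `|j|)%N then wt j else 0 : R) m <= 1.
  by rewrite mulrC -ler_pdivlMr // mul1r; exact: hN2.
have gaps k : (N < `|k|)%N -> exists e' h g, [/\ gap_pair T q k e' h g,
    periodicC T h, periodicC T g, 4 * (K / br k) <= 1 &
    forall t, nm (h t - 1) <= K / br k /\ nm (g t) <= K / br k].
  move=> kN; have [e' [f [g [df dg bd D1 D2]]]] := hk k kN.
  exists e', (fun t => 1 + evl om f t), (evl om g); split.
  - by split.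
  - by move=> t; rewrite evl_periodic.
  - exact: evl_periodic.
  - rewrite mulrA; apply: br_large kN => //.
    by apply: le_trans (ltW hN3) _; rewrite ler_nat.
  - by move=> t; rewrite addrC addKr; exact: bd.
have [xi0 [xi1 [xi2 [xi_n0 rel]]]] := commuting_polynomials T0 qQ pq tail gaps hs.
exists q; split=> //; last exact: (basis_finite_gap cq qQ hs xi_n0 rel).
move=> t; have -> : trig T F t = evl om a t.
  rewrite (aE n t (leqnn n)); symmetry; apply: zsum_supp => j jn.
  by rewrite an // mul0r.
by rewrite -(evlB om t dq hA); apply: le_trans deltae; exact: evl_le.
Qed.

End FiniteGap.

(** * Density in L^2 *)

Section Approximation.
Variables (R : realType) (T : R).
Local Notation C := R[i].
Local Notation Re := complex.Re.
Local Notation Im := complex.Im.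
Hypothesis T0 : 0 < T.
Local Notation mu := (@lebesgue_measure R).
Local Notation D := (`]0, T[%classic : set R).
Local Notation J f := (\int[mu]_(t in D) (f t)%:E)%E.
Implicit Types (f g h : R -> R) (a t : R).

Definition clip a (x : R) : R := Num.max (- a) (Num.min a x).
(** A cutoff that, for [a >= 0], vanishes outside the open interval, so that the approximations
    extend continuously and periodically; as [a] grows it tends to 1 inside. *)
Definition chi a t : R := Num.max 0 (Num.min 1 (a * (t * (T - t)))).

Lemma clip_le a x : 0 <= a -> `|clip a x| <= a.
Proof. by move=> a0; rewrite /clip maxEle minEle; case: (leP a x) => ?; case: (leP (- a)) => ?; rewrite ler_norml; apply/andP; split; lra. Qed.

Lemma clip_id a x : `|x| <= a -> clip a x = x.
Proof. by rewrite ler_norml => /andP[? ?]; rewrite /clip maxEle minEle; case: (leP a x) => ?; case: (leP (- a)) => ?; lra. Qed.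

Lemma clip_lip a x y : 0 <= a -> `|clip a x - clip a y| <= `|x - y|.
Proof.
move=> a0; wlog xy : x y / x <= y.
  by case: (leP x y) => [xy|/ltW yx] H; [|rewrite distrC [leRHS]distrC]; exact: H.
rewrite [leRHS]distrC [leRHS]ger0_norm ?subr_ge0 // /clip !maxEle !minEle.
by case: (leP a x) => ?; case: (leP a y) => ?; do ?case: (leP (- a)) => ?; rewrite ler_norml; apply/andP; split; lra.
Qed.

(** [c * clip a x] lies between [0] and [x], so the remainder is no larger than [x]; this is the
    majorant for dominated convergence in [real_L2_density]. *)
Lemma clip_shrink a x c : 0 <= a -> 0 <= c <= 1 -> (x - c * clip a x) ^+ 2 <= x ^+ 2.
Proof.
move=> a0 /andP[c0 c1]; rewrite -[leLHS]real_normK ?num_real // -[leRHS]real_normK ?num_real //.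
rewrite ler_sqr ?nnegrE // /clip maxEle minEle.
have [x0|x0] := leP 0 x.
  by rewrite (ger0_norm x0); case: (leP a x) => ?; case: (leP (- a)) => ?; rewrite ler_norml; apply/andP; split; nra.
by rewrite (ltr0_norm x0); case: (leP a x) => ?; case: (leP (- a)) => ?; rewrite ler_norml; apply/andP; split; nra.
Qed.

Lemma chi_ge0_le1 a t : 0 <= chi a t <= 1.
Proof. by rewrite /chi le_max lexx ge_max ler01 ge_min lexx. Qed.

Lemma chi_id a t : 1 <= a * (t * (T - t)) -> chi a t = 1.
Proof. by move=> h; rewrite /chi min_l // max_r. Qed.

Lemma chi_out a t : 0 <= a -> t <= 0 \/ T <= t -> chi a t = 0.
Proof.
move=> a0 h; have h' : a * (t * (T - t)) <= 0.
  by rewrite mulr_ge0_le0 //; have T0' := T0; case: h => h; nra.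
by rewrite /chi max_l // ge_min h' orbT.
Qed.

Lemma clip_continuous a : continuous (clip a).
Proof.
move=> x; apply: (@continuous_max _ _ (cst (- a)) (cst a \min id)); first exact: cvg_cst.
by apply: (@continuous_min _ _ (cst a) id); [exact: cvg_cst|exact: cvg_id].
Qed.

Lemma chi_continuous a : continuous (chi a).
Proof.
move=> t; apply: (@continuous_max _ _ (cst 0) (cst 1 \min (fun t => a * (t * (T - t))))); first exact: cvg_cst.
apply: (@continuous_min _ _ (cst 1) (fun t => a * (t * (T - t)))); first exact: cvg_cst.
apply: cvgM; first exact: cvg_cst.
by apply: cvgM; [exact: cvg_id|apply: cvgB; [exact: cvg_cst|exact: cvg_id]].
Qed.

Lemma integral_small (u : nat -> \bar R) (e : R) : (forall n, (0 <= u n)%E) ->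
  u @ \oo --> 0%E -> 0 < e -> exists n, (u n < e%:E)%E.
Proof.
move=> u0 /fine_cvgP[[m _ fin] /cvgrPdist_lt/(_ e)] H e0; have [k _ hk] := H e0.
exists (m + k)%N; have fu := fin (m + k)%N (leq_addr _ _).
rewrite -(fineK fu) lte_fin; have := hk (m + k)%N (leq_addl _ _).
by rewrite /= sub0r normrN ger0_norm // fine_ge0.
Qed.

Lemma le_int f g : measurable_fun D f -> measurable_fun D g ->
  (forall t, 0 < t < T -> 0 <= f t <= g t) -> (J f <= J g)%E.
Proof.
move=> mf mg fg; apply: ge0_le_integral => //.
- by move=> t; rewrite /= in_itv lee_fin => /fg/andP[].
- exact/measurable_EFinP.
- exact/measurable_EFinP.
- by move=> t; rewrite /= in_itv lee_fin => /fg/andP[].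
Qed.

(** The pointwise inequality [(x + y)^2 <= 2 x^2 + 2 y^2] stands in for the triangle inequality, at
    the cost of the factors 2. *)
Lemma int_sq_split f g h (d e : R) : measurable_fun D f -> measurable_fun D g -> measurable_fun D h ->
  (J (fun t => (f t - g t) ^+ 2) < d%:E)%E -> (J (fun t => (g t - h t) ^+ 2) < e%:E)%E ->
  (J (fun t => (f t - h t) ^+ 2) < (2 * d + 2 * e)%:E)%E.
Proof.
move=> mf mg mh dl el.
have m1 : measurable_fun D (fun t => (f t - g t) ^+ 2) by apply: measurable_funX; exact: measurable_funB.
have m2 : measurable_fun D (fun t => (g t - h t) ^+ 2) by apply: measurable_funX; exact: measurable_funB.
have -> : 2 * d + 2 * e = 2 * (d + e) by ring.
apply: (@le_lt_trans _ _ (J (fun t => 2 * ((f t - g t) ^+ 2 + (g t - h t) ^+ 2)))%E).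
  apply: le_int.
  - by apply: measurable_funX; exact: measurable_funB.
  - by apply: measurable_funM => //; exact: measurable_funD.
  - by move=> t _; rewrite sqr_ge0 /=; have := sqr_ge0 ((f t - g t) - (g t - h t)); nra.
under eq_integral do rewrite EFinM.
rewrite ge0_integralZl_EFin //; last 2 first.
- by move=> t _; rewrite lee_fin addr_ge0 ?sqr_ge0.
- by apply/measurable_EFinP; exact: measurable_funD.
under eq_integral do rewrite EFinD.
rewrite ge0_integralD //; try by move=> t _; rewrite lee_fin sqr_ge0.
- by rewrite EFinM lte_pmul2l // EFinD lteD.
- exact/measurable_EFinP.
- exact/measurable_EFinP.
Qed.

(** Truncation with cutoff converges in L^2 by dominated convergence. A truncated function is
    integrable, hence a limit of continuous functions in L^1; once these are truncated as well,
    boundedness turns L^1 closeness into L^2 closeness. *)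
Lemma real_L2_density f (e : R) : measurable_fun D f -> (J (fun t => (f t) ^+ 2) < +oo)%E -> 0 < e ->
  exists g, [/\ continuous g, forall t, t <= 0 \/ T <= t -> g t = 0 &
    (J (fun t => (f t - g t) ^+ 2) < e%:E)%E].
Proof.
move=> mf ff e0; have mD : measurable D by [].
have mclip a h : measurable_fun D h -> measurable_fun D (fun t => clip a (h t)).
  by move=> mh; exact: (measurableT_comp (continuous_measurable_fun (@clip_continuous a))).
have mchi a : measurable_fun D (chi a).
  exact: measurable_funTS (continuous_measurable_fun (@chi_continuous a)).
pose F n t := chi n%:R t * clip n%:R (f t).
have mF n : measurable_fun D (F n) by apply: measurable_funM => //; exact: mclip.
have [n hn] : exists n, (J (fun t => (f t - F n t) ^+ 2)%R < (e / 4)%:E)%E.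
  apply: (@integral_small (fun n => J (fun t => (f t - F n t) ^+ 2)%R)); last by lra.
    by move=> m; apply: integral_ge0 => t _; rewrite lee_fin sqr_ge0.
  rewrite -(@integral0 _ _ R mu D).
  apply: (@dominated_cvg _ _ R mu D mD (fun n t => ((f t - F n t) ^+ 2)%:E) (fun=> 0%E) (fun t => ((f t) ^+ 2)%:E)) => //.
  - by move=> m; apply/measurable_EFinP; apply: measurable_funX; exact: measurable_funB mf (mF m).
  - move=> t /=; rewrite in_itv /= => /andP[t0 tT].
    have tt : 0 < t * (T - t) by apply: mulr_gt0; lra.
    have [N hN] := archi_gt (Num.max `|f t| (t * (T - t))^-1).
    apply: cvg_near_cst; exists N => // n /= Nn.
    have : N%:R <= n%:R :> R by rewrite ler_nat.
    move: hN; rewrite gt_max => /andP[h1 h2] h3.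
    rewrite /F clip_id ?chi_id; first by rewrite mul1r subrr expr0n.
      by rewrite -ler_pdivrMr // div1r; lra.
    by lra.
  - apply/integrableP; split; first by apply/measurable_EFinP; exact: measurable_funX.
    by under eq_integral => t _ do rewrite gee0_abs ?lee_fin ?sqr_ge0 //.
  - move=> n t _; rewrite gee0_abs lee_fin ?sqr_ge0 // /F.
    by apply: clip_shrink => //; exact: chi_ge0_le1.
have mcf : measurable_fun D (fun t => clip n%:R (f t)) by exact: mclip.
have muD : (mu D < +oo)%E by rewrite lebesgue_measure_itv /= lte_fin T0 -EFinB ltry.
have icf : mu.-integrable D (EFin \o (fun t => clip n%:R (f t))).
  apply: measurable_bounded_integrable => //.
  exists n%:R; split; first exact: num_real.
  by move=> x nx t _ /=; apply: le_trans (clip_le _ _) (ltW nx).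
have [G [cG iG GE]] := approximation_continuous_integrable mD muD icf.
(* Truncations at height [n] differ by at most [2 * n]; the additional 1 keeps the denominator
   positive for [n = 0]. *)
have d0 : 0 < e / (4 * (2 * n%:R + 1)).
  by apply: divr_gt0 => //; have := ler0n R n; lra.
have [|k hk] := integral_small _ GE d0; first by move=> k; exact: integral_ge0.
have mG : measurable_fun D (G k) by exact: measurable_funTS (continuous_measurable_fun (cG k)).
exists (fun t => chi n%:R t * clip n%:R (G k t)); split.
- move=> t; apply: cvgM; first exact: chi_continuous.
  by apply: continuous_comp; [exact: cG|exact: clip_continuous].
- by move=> t ht; rewrite chi_out // mul0r.
have -> : e = 2 * (e / 4) + 2 * (e / 4) by lra.
apply: (int_sq_split mf (mF n)) => //.
  by apply: measurable_funM => //; exact: mclip.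
have n0 : 0 <= n%:R :> R by [].
apply: (@le_lt_trans _ _ (J (fun t => (2 * n%:R + 1) * `|clip n%:R (f t) - G k t|)%R)).
  apply: le_int.
  - by apply: measurable_funX; apply: measurable_funB => //; apply: measurable_funM => //; exact: mclip.
  - by apply: measurable_funM => //; apply: measurableT_comp => //; exact: measurable_funB.
  move=> t _; rewrite sqr_ge0 /= /F -mulrBr.
  have := chi_ge0_le1 n%:R t; set c := chi _ _ => /andP[c0 c1].
  have := clip_lip (clip n%:R (f t)) (G k t) n0; rewrite (clip_id (clip_le _ n0)).
  have := clip_le (f t) n0; have := clip_le (G k t) n0.
  set u := clip _ (f t); set v := clip _ (G k t) => hv hu huv.
  have h2 : `|u - v| <= 2 * n%:R + 1 by have := ler_normB u v; lra.
  rewrite -[leLHS]real_normK ?num_real // normrM (ger0_norm c0).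
  have := normr_ge0 (u - v) => d0'.
  apply: (@le_trans _ _ (`|u - v| ^+ 2)).
    by rewrite ler_sqr ?nnegrE ?mulr_ge0 // ler_piMl.
  by rewrite expr2; apply: ler_pM.
under eq_integral do rewrite EFinM.
rewrite ge0_integralZl_EFin //; last first.
  by apply/measurable_EFinP; apply: measurableT_comp => //; exact: measurable_funB.
have -> : e / 4 = (2 * n%:R + 1) * (e / (4 * (2 * n%:R + 1))).
  by field; rewrite gt_eqF //; lra.
by rewrite EFinM lte_pmul2l // lte_fin; lra.
Qed.

(** [P] is [G] evaluated at [t] reduced modulo [T]. It is continuous across a multiple of [T]
    because [G] vanishes at both end points. *)
Lemma periodize (G : R -> C) : contC G -> (forall t, t <= 0 \/ T <= t -> G t = 0) ->
  exists P, [/\ contC P, periodicC T P & forall t, 0 < t < T -> P t = G t].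
Proof.
move=> cG G0; pose m t := Num.floor (t / T); pose r t := t - (m t)%:~R * T.
have rE t : 0 <= r t < T.
  have := ge_floor (t / T); rewrite ler_pdivlMr // => h1.
  have := floorD1_gt (t / T); rewrite ltr_pdivrMr // intrD mulrDl mul1r => h2.
  by rewrite /r /m; apply/andP; split; lra.
have mE t (k : int) : 0 <= t - k%:~R * T < T -> m t = k.
  move=> /andP[h1 h2]; apply: floor_def; rewrite ler_pdivlMr // ltr_pdivrMr // intrD mulrDl mul1r.
  by apply/andP; split; lra.
exists (fun t => G (r t)); split.
- apply/contC_epsP => t e e0; have e2 : 0 < e / 2 by lra.
  have [d d0 hd] := heine 0 T cG e2; exists d => // s sd.
  have hd' x y : 0 <= x < T -> `|y - x| < d -> nm (G y - G x) < e / 2.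
    by move=> /andP[h1 h2]; apply: hd; rewrite h1 ltW.
  (* If [u] and [v] belong to different periods, adding the small displacement to either reduced
     point leads out of []0, T[], where [G] vanishes; so both values are below [e / 2]. *)
  have cross u v : (m u < m v)%R -> `|u - v| < d -> nm (G (r u)) < e / 2 /\ nm (G (r v)) < e / 2.
    move=> uv duv; have muv : (m u)%:~R * T + T <= (m v)%:~R * T.
      rewrite -[X in _ + X]mul1r -mulrDl ler_pM2r // -[1]/(1%:~R) -intrD ler_int; lia.
    have /andP[u0 uT] := rE u; have /andP[v0 vT] := rE v.
    split.
      have := hd' (r u) (r u + (v - u)) (rE u).
      rewrite (_ : _ - _ = v - u) 1?distrC; last by ring.
      move=> /(_ duv); rewrite [G (r u + _)]G0; first by rewrite sub0r nmN.
      by right; move: v0; rewrite /r; lra.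
    have := hd' (r v) (r v + (u - v)) (rE v).
    rewrite (_ : _ - _ = u - v); last by ring.
    move=> /(_ duv); rewrite [G (r v + _)]G0; first by rewrite sub0r nmN.
    by left; move: uT; rewrite /r; lra.
  have nB : nm (G (r s) - G (r t)) <= nm (G (r s)) + nm (G (r t)).
    by apply: le_trans (nmD _ _) _; rewrite nmN.
  have [st|st|st] := ltgtP (m s) (m t).
  + by have [] := cross _ _ st sd; lra.
  + by rewrite distrC in sd; have [] := cross _ _ st sd; lra.
  have : nm (G (r s) - G (r t)) < e / 2; last by lra.
  apply: hd' => //; suff -> : r s - r t = s - t by [].
  by rewrite /r st; ring.
- move=> t; congr G; rewrite /r (mE (t + T) (m t + 1)); first by rewrite intrD; ring.
  by have := rE t; rewrite /r intrD mulrDl mul1r => /andP[h1 h2]; apply/andP; split; lra.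
- by move=> t /andP[h1 h2]; congr G; rewrite /r (mE t 0); rewrite mul0r subr0 // ltW.
Qed.

(** End points have measure zero; the open interval is used because only there does the cutoff [chi]
    tend to 1. *)
Lemma L2normE (q : R -> C) : measurable_fun D (fun t => Re (q t)) -> measurable_fun D (fun t => Im (q t)) ->
  L2norm T q = ((J (fun t => Re (q t) ^+ 2) + J (fun t => Im (q t) ^+ 2)) `^ 2^-1)%E.
Proof.
move=> mr mi; have mr2 := measurable_funX 2 mr; have mi2 := measurable_funX 2 mi.
rewrite /L2norm unlock /=; congr (_ `^ _)%E.
transitivity (\int[mu]_(t in `[0%R, T]) (Re (q t) ^+ 2 + Im (q t) ^+ 2)%:E)%E.
  rewrite [RHS]integral_mkcond; apply: eq_integral => t _; rewrite /patch; case: ifP => _ /=.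
    by rewrite ger0_norm ?nm_ge0 // powR_mulrn ?nm_ge0 // nm_sqr.
  by rewrite normr0 powR0 // pnatr_eq0.
rewrite integral_itv_bndoo; last by apply/measurable_EFinP; exact: measurable_funD.
under eq_integral do rewrite EFinD.
rewrite ge0_integralD //; try by move=> t _; rewrite lee_fin sqr_ge0.
- exact/measurable_EFinP.
- exact/measurable_EFinP.
Qed.

End Approximation.

Theorem corollary6p3 (R : realType) (T : R) (hT : 0 < T) :
  dense_in_L2 T (finite_gap T).
Proof.
move=> q [mr' mi' qfin] eps eps0.
have sub : (`]0, T[%classic : set R) `<=` `[0, T]%classic by exact: subset_itv_oo_cc.
have mr : measurable_fun `]0, T[ (fun t => complex.Re (q t)) by apply: measurable_funS mr'.
have mi : measurable_fun `]0, T[ (fun t => complex.Im (q t)) by apply: measurable_funS mi'.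
have int0 (f : R -> R) : (0 <= \int[lebesgue_measure]_(t in `]0%R, T[) (f t ^+ 2)%:E)%E.
  by apply: integral_ge0 => t _; rewrite lee_fin sqr_ge0.
have [fr fi] : (\int[lebesgue_measure]_(t in `]0%R, T[) (complex.Re (q t) ^+ 2)%:E < +oo /\
    \int[lebesgue_measure]_(t in `]0%R, T[) (complex.Im (q t) ^+ 2)%:E < +oo)%E.
  move: qfin; rewrite L2normE // => /lty_poweRy; rewrite invr_eq0 pnatr_eq0 => /(_ isT) h.
  by split; apply: le_lt_trans h; [exact: leeDl|exact: leeDr].
(* Each of the two components contributes [2 * eta + 2 * eta] through [int_sq_split], hence the
   8. *)
pose eta := eps ^+ 2 / 8; have eta0 : 0 < eta by rewrite divr_gt0 // exprn_gt0.
have [g1 [c1 z1 h1]] := real_L2_density hT mr fr eta0.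
have [g2 [c2 z2 h2]] := real_L2_density hT mi fi eta0.
have [P [cP pP PE]] : exists P, [/\ contC P, periodicC T P & forall t, 0 < t < T -> P t = (g1 t +i* g2 t)%C].
  apply: periodize => // t /[dup] /z1 -> /z2 -> //.
(* The trigonometric and the finite gap approximation each cost [c], so a component contributes at
   most [4 * c ^+ 2 * T]; [c <= 1] reduces this to a bound linear in [c]. *)
pose c := Num.min 1 (eta / (8 * T)).
have c0 : 0 < c by rewrite lt_min ltr01 divr_gt0 // mulr_gt0.
have cle : 4 * c ^+ 2 * T < eta.
  have c_1 : c <= 1 by rewrite ge_min lexx.
  have c_e : 8 * T * c <= eta by rewrite mulrC -ler_pdivlMr ?mulr_gt0 // ge_min lexx orbT.
  have : T * c * c <= T * c by rewrite ler_piMr // mulr_ge0 // ltW.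
  by rewrite expr2; nra.
have [F hF] := trig_density hT cP pP c0.
have [q' [[cr ci] pq' hq' gq']] := finite_gap_near_trig hT F c0.
have close t : 0 < t < T -> (g1 t - complex.Re (q' t)) ^+ 2 <= (2 * c) ^+ 2 /\
    (g2 t - complex.Im (q' t)) ^+ 2 <= (2 * c) ^+ 2.
  move=> /PE tE; have c2_0 : 0 <= 2 * c by lra.
  have : nm (P t - q' t) ^+ 2 <= (2 * c) ^+ 2.
    rewrite ler_sqr ?nnegrE ?nm_ge0 //; have -> : P t - q' t = (P t - trig T F t) - (q' t - trig T F t) by ring.
    by apply: le_trans (nmD _ _) _; rewrite nmN; have := hF t; have := hq' t; lra.
  rewrite nm_sqr tE cReB cImB /=.
  by have := sqr_ge0 (g1 t - complex.Re (q' t)); have := sqr_ge0 (g2 t - complex.Im (q' t)); lra.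
have ms (f : R -> R) (E : set R) : continuous f -> measurable_fun E f.
  by move=> cf; exact: measurable_funTS (continuous_measurable_fun cf).
have intc (r : R) : (\int[lebesgue_measure]_(t in `]0%R, T[) r%:E = (r * T)%:E)%E.
  rewrite integral_cst // EFinM; congr (_ * _)%E; apply: eq_trans (lebesgue_measure_itv _) _.
  by rewrite /= lte_fin hT -EFinB subr0.
have small (g f : R -> R) : continuous g -> continuous f ->
    (forall t, 0 < t < T -> (g t - f t) ^+ 2 <= (2 * c) ^+ 2) ->
    (\int[lebesgue_measure]_(t in `]0%R, T[) ((g t - f t) ^+ 2)%:E < eta%:E)%E.
  move=> cg cf gf; apply: (@le_lt_trans _ _ (\int[lebesgue_measure]_(t in `]0%R, T[) ((2 * c) ^+ 2)%:E)%E).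
    apply: le_int => //; first by apply: measurable_funX; apply: measurable_funB; exact: ms.
    by move=> t tT; rewrite sqr_ge0 /=; exact: gf.
  by rewrite intc lte_fin exprMn; have -> : 2 ^+ 2 = 4 :> R by ring.
exists q'.
  split=> //; split; [exact: ms|exact: ms|].
  have [B _ hB] := periodic_bounded hT (conj cr ci : contC q') pq'.
  have fin (f : R -> R) : continuous f -> (forall t, f t ^+ 2 <= B ^+ 2) ->
      (\int[lebesgue_measure]_(t in `]0%R, T[) (f t ^+ 2)%:E < +oo)%E.
    move=> cf fB; apply: (@le_lt_trans _ _ (\int[lebesgue_measure]_(t in `]0%R, T[) (B ^+ 2)%:E)%E).
      by apply: le_int => // [|t _]; [apply: measurable_funX; exact: ms|rewrite sqr_ge0 /=].
    by rewrite intc ltry.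
  have hB2 t : complex.Re (q' t) ^+ 2 + complex.Im (q' t) ^+ 2 <= B ^+ 2.
    by rewrite -nm_sqr; have := hB t; have := nm_ge0 (q' t); nra.
  rewrite L2normE; try exact: ms.
  apply: poweR_lty; apply: lte_add_pinfty; apply: fin => // t; have := hB2 t;
    have := sqr_ge0 (complex.Re (q' t)); have := sqr_ge0 (complex.Im (q' t)); lra.
have k1 := int_sq_split mr (ms _ _ c1) (ms _ _ cr) h1 (small _ _ c1 cr (fun t tT => (close t tT).1)).
have k2 := int_sq_split mi (ms _ _ c2) (ms _ _ ci) h2 (small _ _ c2 ci (fun t tT => (close t tT).2)).
have reB : (fun t => complex.Re (q t - q' t)) = (fun t => complex.Re (q t) - complex.Re (q' t)).
  by apply/funext => t; exact: cReB.
have imB : (fun t => complex.Im (q t - q' t)) = (fun t => complex.Im (q t) - complex.Im (q' t)).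
  by apply/funext => t; exact: cImB.
have mrB : measurable_fun `]0, T[ (fun t => complex.Re (q t - q' t)).
  by rewrite reB; apply: measurable_funB => //; exact: ms.
have miB : measurable_fun `]0, T[ (fun t => complex.Im (q t - q' t)).
  by rewrite imB; apply: measurable_funB => //; exact: ms.
rewrite (L2normE mrB miB).
under eq_integral => t _ do rewrite (congr1 (@^~ t) reB).
under [X in (_ + X)%E]eq_integral => t _ do rewrite (congr1 (@^~ t) imB).
have := lteD k1 k2; rewrite -EFinD (_ : 2 * eta + 2 * eta + (2 * eta + 2 * eta) = eps ^+ 2); last by rewrite /eta; field.
have := adde_ge0 (int0 (fun t => complex.Re (q t) - complex.Re (q' t)))
  (int0 (fun t => complex.Im (q t) - complex.Im (q' t))).
set X := (_ + _)%E; case: X => [x| |] //; rewrite lee_fin lte_fin => x0 xe.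
rewrite poweR_EFin lte_fin powR12_sqrt //.
by rewrite -[eps]ger0_norm ?ltW // -sqrtr_sqr ltr_sqrt // exprn_gt0.
Qed.
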